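(* For all $k$ one has the equality of classes of maps $$\mathrm{Lip}^{k}_{\mathrm{FKa}}=\mathcal D^{k}_{\mathrm{BGN}}\big(\mathrm{Lip}^{0}_{\mathrm{FKa}},\mathbb R\big).$$ That is, for every $k\in\{0,1,2,\dots\}\cup\{\infty\}$, a triple $(E,F,f)$ is a Lipschitz map of order $k$ between arc-generated Frölicher–Kriegl convenient spaces if and only if it is of order $k$ in the sense of the Bertram–Glöckner–Neeb construction based on the class $\mathrm{Lip}^0_{\mathrm{FKa}}$ as $C^0$-concept. (For $k\notin\{0,1,2,\dots\}\cup\{\infty\}$ both classes are empty by convention.)
   Context: All vector spaces are real. A structured vector space is a pair $E=(X,S)$ of a vector space $X$ and a further structure $S$; we write $x\in E$ for $x\in X$. A composition $g\circ f$ of functions has domain $\{x\in\operatorname{dom} f: f(x)\in\operatorname{dom} g\}$. **Dualized spaces.** $\mathrm{DVS}$ is the class of pairs $E=(X,E')$ where $E'$ is a nonempty set of linear functionals $X\to\mathbb R$ that is closed under linear combinations and separates the points of $X$. The smooth $E'$-topology $\mathcal T_E$ on $X$ consists of all $U\subseteq X$ such that $c^{-1}(U)$ is open in $\mathbb R$ for every $c:\mathbb R\to X$ with $\ell\circ c\in C^\infty(\mathbb R)$ for all $\ell\in E'$. Put $\tau(E)=(X,\mathcal T_E)$. **Convenient spaces.** $\mathrm{Con}_{\mathrm{FKd}}$ is the class of $E=(X,E')\in\mathrm{DVS}$ such that (a) every linear functional $X\to\mathbb R$ continuous for $\mathcal T_E$ belongs to $E'$, and (b) for every $c:\mathbb R\to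 X$ with $\ell\circ c\in C^\infty(\mathbb R)$ for all $\ell\in E'$ there is $c_1:\mathbb R\to X$ with $\ell\circ c_1=(\ell\circ c)'$ for all $\ell\in E'$. Put $\mathrm{Con}_{\mathrm{FKa}}=\{\tau(E):E\in\mathrm{Con}_{\mathrm{FKd}}\}$. The map $\tau:\mathrm{Con}_{\mathrm{FKd}}\to\mathrm{Con}_{\mathrm{FKa}}$ is bijective, with inverse $\delta$ sending $E=(X,\mathcal T)$ to $(X,\mathcal L(E,\mathbb R))$, where $\mathcal L(E,\mathbb R)$ is the set of continuous linear functionals. The space $\mathbb R$ with its usual topology belongs to $\mathrm{Con}_{\mathrm{FKa}}$. **Products.** For $E=(X,E')$, $F=(Y,F')$ in $\mathrm{DVS}$, $E\sqcap_d F=(X\times Y,\{(x,y)\mapsto\ell_1(x)+\ell_2(y):\ell_1\in E',\ell_2\in F'\})$. For $E,F\in\mathrm{Con}_{\mathrm{FKa}}$, $E\sqcap_a F=\tau(\delta(E)\sqcap_d\delta(F))$, which again belongs to $\mathrm{Con}_{\mathrm{FKa}}$; it coincides with the usual topological product $E\sqcap F$ if $E$ or $F$ is finite-dimensional. **Lipschitz maps.** Let $k\in\{0,1,2,\dots\}\cup\{\infty\}$. - $\mathrm{Lip}$ is the set of functions $\chi:\Omega\to\mathbb R$, with $\Omega\subseteq\mathbb R$ open, that are locally Lipschitz: for every $t_0\in\Omega$ there is $\delta>0$ with $|\chi(s)-\chi(t)|\le\delta^{-1}|s-t|$ for all $s,t\in\Omega$ with $|s-t_0|+|t-t_0|<\delta$.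 - $\mathrm{Lip}^k$ is the set of functions $\chi:\Omega\to\mathbb R$, $\Omega\subseteq\mathbb R$ open, such that all derivatives $\chi^{(i)}$, $0\le i\le k$ ($i<\infty$), exist on $\Omega$ and belong to $\mathrm{Lip}$. - For $E=(X,E')\in\mathrm{DVS}$, $\mathrm{Lip}^kE$ is the set of $X$-valued functions $c$ with $\ell\circ c\in\mathrm{Lip}^k$ for all $\ell\in E'$ (so $\operatorname{dom} c$ is an open subset of $\mathbb R$). - $\mathrm{Lip}^k_{\mathrm{FKd}}$ is the class of triples $(E,F,f)$ with $E,F\in\mathrm{Con}_{\mathrm{FKd}}$, $f$ a function with $\operatorname{dom} f\subseteq E$ and values in $F$, such that $f\circ c\in\mathrm{Lip}^kF$ for all $c\in\mathrm{Lip}^kE$. - $\mathrm{Lip}^k_{\mathrm{FKa}}=\{(\tau(E),\tau(F),f):(E,F,f)\in\mathrm{Lip}^k_{\mathrm{FKd}}\}$. **The Bertram–Glöckner–Neeb classes.** Let $E,F\in\mathrm{Con}_{\mathrm{FKa}}$ and let $f$ be a function with $\operatorname{dom} f\subseteq E$ and values in $F$; put $\tilde f=(E,F,f)$. We say that $\bar\Delta\tilde f$ exists if there is a function $g$ with $\operatorname{dom} g=\{(x,u,t):x,u\in E,\ t\in\mathbb R,\ x+tu\in\operatorname{dom} f\}\cap\{(x,u,t): x\in\operatorname{dom} f\}$, with $g(x,u,t)=t^{-1}(f(x+tu)-f(x))$ whenever $(x,u,t)\in\operatorname{dom} g$ and $t\ne0$, and with $((E\sqcap_aE)\sqcap\mathbb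 R,F,g)\in\mathrm{Lip}^0_{\mathrm{FKa}}$. Such $g$ is then unique and $\bar\Delta\tilde f:=((E\sqcap_aE)\sqcap\mathbb R,F,g)$. Writing $\mathcal D^k=\mathcal D^k_{\mathrm{BGN}}(\mathrm{Lip}^0_{\mathrm{FKa}},\mathbb R)$, one sets $\mathcal D^0=\mathrm{Lip}^0_{\mathrm{FKa}}$; for $k\in\{0,1,2,\dots\}$, $\mathcal D^{k+1}$ is the class of $\tilde f\in\mathrm{Lip}^0_{\mathrm{FKa}}$ such that $\bar\Delta\tilde f$ exists and $\bar\Delta\tilde f\in\mathcal D^k$; and $\mathcal D^\infty=\bigcap_{k<\infty}\mathcal D^k$. *)

(* Defs.v *)
From HB Require Import structures.
From mathcomp Require Import all_boot all_order all_algebra.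
From mathcomp Require Import all_classical all_reals all_analysis.

Set Implicit Arguments.
Unset Strict Implicit.
Unset Printing Implicit Defensive.

Import Order.TTheory GRing.Theory Num.Theory.
Import numFieldNormedType.Exports.

Local Open Scope classical_set_scope.
Local Open Scope ring_scope.

(* A function whose domain is a subset of A is encoded as an option-valued
   total function, so that two such functions are equal exactly when they have
   the same domain and the same values on it. *)
Definition pfun (A B : Type) := A -> option B.

Definition pdom A B (f : pfun A B) : set A := [set x | isSome (f x)].

(* The domain is { x in dom f | f x in dom g }. *)
Definition pcomp A B C (g : pfun B C) (f : pfun A B) : pfun A C :=
  fun x => obind g (f x).

Definition pfun_of A B (f : A -> B) : pfun A B := fun x => Some (f x).

(* Orders of differentiability: [Some n] is the finite order n, and [None] is
   the order oo. *)
Definition lip_order := option nat.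

Definition le_order (i : nat) (k : lip_order) : bool :=
  if k is Some n then (i <= n)%N else true.

Section RealFunctions.
Variable R : realType.
Implicit Types (chi : pfun R R) (k : lip_order).

Definition smooth (h : R -> R) : Prop :=
  forall (n : nat) (t : R), derivable (derive1n n h) t 1.

Definition Lip chi : Prop :=
  open (pdom chi) /\
  forall t0, pdom chi t0 -> exists2 delta : R, 0 < delta &
    forall s t a b, chi s = Some a -> chi t = Some b ->
      `|s - t0| + `|t - t0| < delta -> `|a - b| <= delta^-1 * `|s - t|.

(* On an open domain, derivatives do not depend on the extension by 0. *)
Definition pext chi : R -> R := fun t => odflt 0 (chi t).

Definition pderivable chi : Prop :=
  forall t, pdom chi t -> derivable (pext chi) t 1.

Definition pderive chi : pfun R R :=
  fun t => omap (fun=> derive1 (pext chi) t) (chi t).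

Definition Lipk k chi : Prop :=
  open (pdom chi) /\
  forall i, le_order i k ->
    (forall j, (j < i)%N -> pderivable (iter j pderive chi)) /\
    Lip (iter i pderive chi).

End RealFunctions.

(* A structured vector space (X, S) is given by a vector space X together with
   S : set (X -> R) for a dualized space, and S : set (set X), the family of
   open sets, for a space carrying a topology. *)

Section Spaces.
Variable R : realType.
Implicit Types X Y : lmodType R.

Definition DVS X (E : set (X -> R)) : Prop :=
  [/\ E !=set0,
      forall l, E l -> scalar l,
      forall (a b : R) l1 l2, E l1 -> E l2 ->
        E (fun x => a * l1 x + b * l2 x)
    & forall x y, x <> y -> exists2 l, E l & l x <> l y].

Definition smooth_curve X (E : set (X -> R)) (c : R -> X) : Prop :=
  forall l, E l -> smooth (l \o c).

Definition tau X (E : set (X -> R)) : set (set X) :=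
  [set U | forall c, smooth_curve E c -> open (c @^-1` U)].

(* The set L(E, R) of continuous linear functionals. *)
Definition delta X (E : set (set X)) : set (X -> R) :=
  [set l | scalar l /\ forall V : set R, open V -> E (l @^-1` V)].

Definition ConFKd X (E : set (X -> R)) : Prop :=
  [/\ DVS E,
      delta (tau E) `<=` E
    & forall c, smooth_curve E c ->
        exists c1 : R -> X, forall l, E l -> l \o c1 = derive1 (l \o c)].

Definition prodd X Y (E : set (X -> R)) (F : set (Y -> R)) :
    set (X * Y -> R) :=
  [set l | exists l1 l2,
     [/\ E l1, F l2 & l = fun xy => l1 xy.1 + l2 xy.2]].

Definition proda X Y (E : set (set X)) (F : set (set Y)) :
    set (set (X * Y)) :=
  tau (prodd (delta E) (delta F)).

(* The usual product topology, with basis the products of open sets. *)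
Definition prodtop (S T : Type) (E : set (set S)) (F : set (set T)) :
    set (set (S * T)) :=
  [set W | forall p, W p -> exists U V,
     [/\ E U, F V, U p.1, V p.2 & U `*` V `<=` W]].

Definition real_top : set (set R^o) := [set U | open U].

Definition LipkE (k : lip_order) X (E : set (X -> R)) (c : pfun R X) : Prop :=
  forall l, E l -> Lipk k (pcomp (pfun_of l) c).

Definition LipFKd (k : lip_order) X Y (E : set (X -> R)) (F : set (Y -> R))
    (f : pfun X Y) : Prop :=
  [/\ ConFKd E, ConFKd F
    & forall c : pfun R X, LipkE k E c -> LipkE k F (pcomp f c)].

Definition LipFKa (k : lip_order) X Y (E : set (set X)) (F : set (set Y))
    (f : pfun X Y) : Prop :=
  exists E0 F0, [/\ LipFKd k E0 F0 f, E = tau E0 & F = tau F0].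

(* The source space (E x_a E) x R of the extended difference quotient. *)
Definition bgn_top X (E : set (set X)) : set (set (X * X * R^o)) :=
  prodtop (proda E E) real_top.

(* [is_bgn_quot E F f g] says that the extended difference quotient of
   (E, F, f) exists and is the triple with underlying function g; such a g is
   unique. *)
Definition is_bgn_quot X Y (E : set (set X)) (F : set (set Y))
    (f : pfun X Y) (g : pfun (X * X * R^o) Y) : Prop :=
  [/\ pdom g = [set p | pdom f (p.1.1 + (p.2 : R) *: p.1.2)]
                 `&` [set p | pdom f p.1.1],
      forall (x u : X) (t : R) (a b d : Y),
        g (x, u, t) = Some d -> f x = Some a -> f (x + t *: u) = Some b ->
        t != 0 -> d = t^-1 *: (b - a)
    & LipFKa (Some 0%N) (bgn_top E) F g].

Fixpoint DBGN_fin (n : nat) X Y (E : set (set X)) (F : set (set Y))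
    (f : pfun X Y) : Prop :=
  if n is n'.+1 then
    LipFKa (Some 0%N) E F f /\
    exists2 g, is_bgn_quot E F f g & DBGN_fin n' (bgn_top E) F g
  else LipFKa (Some 0%N) E F f.

Definition DBGN (k : lip_order) X Y (E : set (set X)) (F : set (set Y))
    (f : pfun X Y) : Prop :=
  if k is Some n then DBGN_fin n E F f else forall n, DBGN_fin n E F f.

End Spaces.

(* Main.v *)
(* Both conditions on f are equivalent to an a priori weaker one: f maps smooth
   curves R -> E to Lip^k curves.

   The basic tool is a curve lemma: points converging fast to p0, together with
   short affine pieces through them, can be joined by one smooth curve through
   p0, so a failure of a uniform bound near p0 shows up along a single curve.
   It shows that a map which is Lip^0 along smooth curves is Lip^0; that
   E'-topologies of products with R are product topologies; and, applied to the
   curve t * x_n interpolated between fast converging x_n, that weak derivatives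
   of Lip^1 curves exist in a convenient space.

   From Lip^(k+1) along smooth curves to Lip^k of the difference quotient g: only
   the curves (x, u, t) near a zero r0 of t matter. By the curve lemma the
   (k+2)-nd differences of l (f (x r + (s * t r + y) *: u r)) in the direction w,
   a vector of the (r, y)-plane, are bounded by C |w|^(k+2), uniformly in s in
   [0, 1]. Polarization and subdivision turn this into bounds for the mixed
   differences, of order 1 in y and k+1 in r, hence for the (k+1)-st differences
   in r of the derivative h (r, s) at y = 0. As g (x r, u r, t r) is the mean
   value of h (r, .) over [0, 1], it satisfies the same bounds, and a Lip^(k-1)
   function satisfying them is Lip^k.

   Conversely, if g is Lip^k then so is (f o c)' = g (c, c', 0). *)
From mathcomp Require Import all_boot all_order all_algebra.
From mathcomp Require Import all_classical all_reals all_analysis.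
From mathcomp Require Import ring lra.
(* Imported last, as [ssrfun.pcomp] would otherwise hide [Defs.pcomp]. *)
Require Import Defs.

Set Implicit Arguments.
Unset Strict Implicit.
Unset Printing Implicit Defensive.

Import Order.TTheory GRing.Theory Num.Theory.
Import numFieldNormedType.Exports.

Local Open Scope classical_set_scope.
Local Open Scope ring_scope.

(** * Functions of class Lip^k near a point *)

(** All estimates have to be extracted from curves, and a curve through affine pieces controls only
    differences with equal steps, all in one direction. Hence two conversions. Polarization allows
    arbitrary steps, but bounds a difference by a power of the largest step instead of the product
    of the steps. Cutting every step in r into pieces of length at most t, where t is also the step
    in y, makes the two comparable, and the number of pieces restores the product up to a constant.
    What remains is the product times t, so dividing by t and letting t tend to 0 bounds the
    differences of the derivative in y.

    Differences replace derivatives because f is known only along curves: h (r, s) exists pointwise,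
    but at that stage no regularity in r or s is at hand that would allow differentiating it in r or
    integrating it in s. Bounds on differences in r survive the passage to a mean value. The price
    is a converse of Taylor type: bounded differences of order k+2 make a Lip^k function
    Lip^(k+1). *)

Section LocalLip.
Variable R : realType.
Implicit Types f g h : R -> R.

Lemma nearR (P : R -> Prop) (t0 : R) :
  (\forall t \near t0, P t) <->
  exists2 d : R, 0 < d & forall t, `|t - t0| < d -> P t.
Proof.
split.
  move=> /nbhs_ballP[d /= d0 dP]; exists d => // t td; apply: dP.
  by rewrite /ball /= distrC.
move=> [d d0 dP]; apply/nbhs_ballP; exists d => //= t.
by rewrite /ball /= distrC => /dP.
Qed.

(** A germ version of Lip^k for total functions. Partial functions get an arbitrary value off their
    open domain, and [derive1] is arbitrary where no derivative exists; as only values near [t0]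
    enter ([LK_near]), neither choice matters. *)
Fixpoint LK (k : nat) h (t0 : R) : Prop :=
  if k is k'.+1 then (\forall t \near t0, derivable h t 1) /\ LK k' ((derive1 h)) t0
  else exists C : R, exists2 d : R, 0 < d &
    forall s t, `|s - t0| < d -> `|t - t0| < d -> `|h s - h t| <= C * `|s - t|.

Lemma near_near (P : R -> Prop) (t0 : R) :
  (\forall t \near t0, P t) -> \forall t \near t0, \forall s \near t, P s.
Proof. exact: near_join. Qed.

Lemma near_derive1 f g (t0 : R) : (\forall t \near t0, f t = g t) ->
  \forall t \near t0, (derive1 f) t = (derive1 g) t.
Proof.
move=> /near_near; apply: filterS => t fg.
by rewrite !derive1E; apply: near_eq_derive.
Qed.

Lemma LK_near k f g (t0 : R) : (\forall t \near t0, f t = g t) ->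
  LK k f t0 -> LK k g t0.
Proof.
elim: k f g => [|k IH] f g fg /=.
  move=> [C [d d0 fC]]; move/nearR : fg => [e e0 fg].
  exists C; exists (Num.min d e); first by rewrite lt_min d0.
  move=> s t; rewrite !lt_min => /andP[sd se] /andP[td te].
  by rewrite -!fg//; exact: fC.
move=> [df f'k]; split; last exact: IH (near_derive1 fg) f'k.
have := near_near fg; apply: filterS2 df => t df fgt.
exact: near_eq_derivable df.
Qed.

Lemma mvt_lipschitz f (t0 d M : R) :
  (forall t, `|t - t0| < d -> derivable f t 1 /\ `|(derive1 f) t| <= M) ->
  forall s t, `|s - t0| < d -> `|t - t0| < d -> `|f s - f t| <= M * `|s - t|.
Proof.
move=> H s t.
wlog st : s t / t <= s.
  move=> W sd td; have [ts|/ltW st] := leP t s; first exact: W.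
  by rewrite distrC (distrC s); exact: W.
move=> sd td.
have I c : c \in `[t, s] -> `|c - t0| < d.
  rewrite in_itv/= => /andP[tc cs]; move: sd td; rewrite !ltr_norml.
  by move=> /andP[? ?] /andP[? ?]; apply/andP; split; lra.
have [c cI ->] : exists2 c, c \in `[t, s] & f s - f t = (derive1 f) c * (s - t).
  apply: MVT_segment => //.
    move=> x xI; rewrite derive1E; apply: derivableP.
    by have [] := H _ (I x (subset_itv_oo_cc xI)).
  apply: derivable_within_continuous => x xI.
  by have [] := H _ (I x xI).
rewrite normrM ler_wpM2r//; by have [] := H _ (I c cI).
Qed.

Lemma LK0_ge0 f (t0 : R) : LK 0 f t0 -> exists2 C : R, 0 <= C &
  exists2 d : R, 0 < d &
    forall s t, `|s - t0| < d -> `|t - t0| < d -> `|f s - f t| <= C * `|s - t|.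
Proof.
move=> [C [d d0 fC]]; exists `|C| => //; exists d => // s t sd td.
by rewrite (le_trans (fC _ _ sd td))// ler_wpM2r// ler_norm.
Qed.

Lemma LK0_bounded f (t0 : R) : LK 0 f t0 ->
  exists M : R, exists2 d : R, 0 < d & forall t, `|t - t0| < d -> `|f t| <= M.
Proof.
move=> /LK0_ge0[C C0 [d d0 fC]]; exists (`|f t0| + C * d), d => // t td.
rewrite -(subrK (f t0) (f t)) addrC (le_trans (ler_normD _ _))// lerD2l.
rewrite (le_trans (fC _ _ td _))// ?subrr ?normr0//.
by rewrite ler_pM// ltW.
Qed.

(** A derivative that is Lipschitz near [t0] is bounded there, so the mean value inequality makes
    the function itself Lipschitz. *)
Lemma LK_pred k f (t0 : R) : LK k.+1 f t0 -> LK k f t0.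
Proof.
elim: k f => [|k IH] f; last by move=> [df /IH]; split.
move=> [/nearR[e e0 df] /LK0_bounded[M [d d0 fM]]].
exists M, (Num.min d e); first by rewrite lt_min d0.
apply: mvt_lipschitz => t; rewrite lt_min => /andP[td te].
by split; [exact: df | exact: fM].
Qed.

Lemma LK_le j k f (t0 : R) : (j <= k)%N -> LK k f t0 -> LK j f t0.
Proof.
move=> /subnK <-; elim: (k - j)%N => [//|n IH].
by rewrite addSn => /LK_pred.
Qed.

Lemma LK0 k f (t0 : R) : LK k f t0 -> LK 0 f t0.
Proof. exact: LK_le. Qed.

Lemma LK_derivable k f (t0 : R) : LK k.+1 f t0 -> derivable f t0 1.
Proof. by move=> [/nbhs_singleton]. Qed.

Lemma LK_continuous k f (t0 : R) : LK k f t0 -> {for t0, continuous f}.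
Proof.
move=> /LK0[C [d d0 fC]]; apply/cvgrPdist_le => /= e e0.
apply/nearR; exists (Num.min d (e / (`|C| + 1))).
  by rewrite lt_min d0 divr_gt0// ltr_wpDl.
move=> t; rewrite lt_min => /andP[td te].
rewrite (le_trans (fC _ _ _ td)) ?subrr ?normr0// distrC.
rewrite (@le_trans _ _ ((`|C| + 1) * `|t - t0|))//.
  by rewrite ler_wpM2r// ler_wpDr// ler_norm.
by rewrite mulrC -ler_pdivlMr ?ltr_wpDl// ltW.
Qed.

Lemma LK_is_derive k f (t0 : R) : LK k.+1 f t0 ->
  \forall t \near t0, is_derive (t : R) 1 f ((derive1 f) t).
Proof.
move=> [+ _]; apply: filterS => t df.
by rewrite derive1E; apply: derivableP.
Qed.

Lemma LKS k f g (t0 : R) : (\forall t \near t0, is_derive (t : R) 1 f (g t)) ->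
  LK k g t0 -> LK k.+1 f t0.
Proof.
move=> fg gk; split; first by apply: filterS fg => t [].
by apply: LK_near gk; apply: filterS fg => t [_ <-]; rewrite derive1E.
Qed.

Lemma LK_cst k (c : R) (t0 : R) : LK k (fun=> c) t0.
Proof.
elim: k c => [|k IH] c.
  by exists 0, 1 => // s t _ _; rewrite subrr normr0 mul0r.
apply: (@LKS k _ (fun=> 0)); last exact: IH.
by near=> t; exact: is_derive_cst.
Unshelve. all: end_near. Qed.

Lemma LK_id k (t0 : R) : LK k id t0.
Proof.
case: k => [|k]; first by exists 1, 1 => // s t _ _; rewrite mul1r.
apply: (@LKS k _ (fun=> 1)); last exact: LK_cst.
by near=> t; exact: is_derive_id.
Unshelve. all: end_near. Qed.

Lemma LK_add k f g (t0 : R) :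
  LK k f t0 -> LK k g t0 -> LK k (fun t => f t + g t) t0.
Proof.
elim: k f g => [|k IH] f g.
  move=> [C [d d0 fC]] [D [e e0 gD]].
  exists (C + D), (Num.min d e); first by rewrite lt_min d0.
  move=> s t; rewrite !lt_min => /andP[sd se] /andP[td te].
  rewrite opprD addrACA (le_trans (ler_normD _ _))// mulrDl lerD//.
    exact: fC. exact: gD.
move=> fk gk; apply: (@LKS k _ (fun t => (derive1 f) t + (derive1 g) t)).
  have := LK_is_derive gk; apply: filterS2 (LK_is_derive fk) => t ft gt.
  exact: is_deriveD.
by case: fk gk => _ fk [_ gk]; exact: IH.
Qed.

Lemma LK_mul k f g (t0 : R) :
  LK k f t0 -> LK k g t0 -> LK k (fun t => f t * g t) t0.
Proof.
elim: k f g => [|k IH] f g.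
  move=> f0 g0; have [M [d1 d10 fM]] := LK0_bounded f0.
  have [N [e1 e10 gN]] := LK0_bounded g0.
  move: f0 g0 => /LK0_ge0[C C0 [d d0 fC]] /LK0_ge0[D D0 [e e0 gD]].
  exists (C * N + M * D), (Num.min (Num.min d e) (Num.min d1 e1)).
    by rewrite !lt_min d0 e0 d10.
  move=> s t; rewrite !lt_min => /andP[/andP[sd se] /andP[sd1 se1]].
  move=> /andP[/andP[td te] /andP[td1 te1]].
  have -> : f s * g s - f t * g t = (f s - f t) * g s + f t * (g s - g t) by ring.
  rewrite (le_trans (ler_normD _ _))// [leRHS]mulrDl !normrM lerD//.
    by rewrite mulrAC ler_pM//; [exact: fC|exact: gN].
  by rewrite -mulrA ler_pM//; [exact: fM|exact: gD].
move=> fk gk.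
apply: (@LKS k _ (fun t => f t * (derive1 g) t + g t * (derive1 f) t)).
  have := LK_is_derive gk; apply: filterS2 (LK_is_derive fk) => t ft gt.
  exact: is_deriveM.
by apply: LK_add; apply: IH; (exact: LK_pred || by case: fk gk => _ + []).
Qed.

Lemma LK_comp k f g (t0 : R) :
  LK k f (g t0) -> LK k g t0 -> LK k (fun t => f (g t)) t0.
Proof.
elim: k f g => [|k IH] f g.
  move=> [C [d d0 fC]] g0; have /cvgrPdist_lt gc := LK_continuous g0.
  have /nearR [a a0 ga] := gc _ d0.
  move: g0 => [D [e e0 gD]]; exists (`|C| * D), (Num.min a e).
    by rewrite !lt_min a0.
  move=> s t; rewrite !lt_min => /andP[sa se] /andP[ta te].
  rewrite (le_trans (fC _ _ _ _))//; try by rewrite distrC; exact: ga.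
  rewrite -mulrA (@le_trans _ _ (`|C| * `|g s - g t|))//.
    by rewrite ler_wpM2r// ler_norm.
  by rewrite ler_wpM2l//; exact: gD.
move=> fk gk.
apply: (@LKS k _ (fun t => (derive1 f) (g t) * (derive1 g) t)).
  have gc := LK_continuous gk; have := gc _ (LK_is_derive fk).
  apply: filterS2 (LK_is_derive gk) => t gt fgt.
  exact: is_derive1_comp.
by case: (fk) (gk) => _ fk' [_ gk']; apply: LK_mul => //; apply: IH => //; exact: LK_pred.
Qed.

Lemma LK_opp k f (t0 : R) : LK k f t0 -> LK k (fun t => - f t) t0.
Proof.
move=> fk; have := LK_mul (LK_cst k (-1) t0) fk; apply: LK_near.
by near=> t; rewrite mulN1r.
Unshelve. all: end_near. Qed.

Lemma LK_sub k f g (t0 : R) :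
  LK k f t0 -> LK k g t0 -> LK k (fun t => f t - g t) t0.
Proof. by move=> fk gk; apply: LK_add => //; exact: LK_opp. Qed.

Lemma LK_inv k f (t0 : R) : f t0 != 0 -> LK k f t0 ->
  LK k (fun t => (f t)^-1) t0.
Proof.
move=> f0; elim: k => [|k IH] fk.
  have fc := LK_continuous fk.
  have /nearR[a a0 fa] : \forall t \near t0, `|f t0| / 2 < `|f t|.
    have f2 : `|f t0| / 2 < `|f t0| by rewrite ltr_pdivrMr// ltr_pMr ?normr_gt0// ltr1n.
    exact: (cvgr_gt _ (cvg_norm fc)).
  move: fk => [C [d d0 fC]].
  exists (`|C| * (`|f t0| / 2)^-1 ^+ 2), (Num.min a d); first by rewrite lt_min a0.
  move=> s t; rewrite !lt_min => /andP[sa sd] /andP[ta td].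
  have p0 : 0 < `|f t0| / 2 by rewrite divr_gt0 ?normr_gt0.
  have fs := fa _ sa; have ft := fa _ ta.
  have fs0 : f s != 0 by rewrite -normr_gt0 (lt_trans _ fs).
  have ft0 : f t != 0 by rewrite -normr_gt0 (lt_trans _ ft).
  have -> : (f s)^-1 - (f t)^-1 = (f t - f s) * ((f s)^-1 * (f t)^-1).
    by field; rewrite fs0 ft0.
  rewrite !normrM mulrAC ler_pM//.
    rewrite (le_trans (fC _ _ td sd))// distrC ler_wpM2r ?ler_norm//.
  by rewrite expr2 ler_pM// normfV lef_pV2 ?posrE ?normr_gt0//; exact: ltW.
have fi := LK_pred fk.
apply: (@LKS k _ (fun t => - ((derive1 f) t * ((f t)^-1 * (f t)^-1)))).
  have fc := LK_continuous fk.
  have fn : \forall t \near t0, f t != 0 by exact: (cvgr_neq0 _ fc f0).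
  have fd := LK_is_derive fk.
  near=> t.
  have ft : is_derive (t : R) 1 f (derive1 f t) by near: t.
  have fn0 : f t != 0 by near: t.
  apply: is_derive_eq.
  by rewrite scaleNr expr2 invfM -[_ *: _]/(_ * _) [X in - X]mulrC.
apply: LK_opp; apply: LK_mul; first by case: fk.
by apply: LK_mul; exact: IH.
Unshelve. all: end_near. Qed.

End LocalLip.

Section LipkLK.
Variable R : realType.
Implicit Types (f g h : R -> R) (chi : pfun R R).

Lemma open_near (T : topologicalType) (A : set T) :
  open A <-> forall t, A t -> \forall s \near t, A s.
Proof.
rewrite openE; split => [AA t /AA//|AA t At]; exact: AA.
Qed.

Lemma pextE chi t a : chi t = Some a -> pext chi t = a.
Proof. by rewrite /pext => ->. Qed.

Lemma pdomP (A B : Type) (f : pfun A B) x : pdom f x <-> exists y, f x = Some y.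
Proof. by rewrite /pdom /=; case: (f x) => [y|]; split => //; [exists y|case]. Qed.

Lemma some_pext chi t : pdom chi t -> chi t = Some (pext chi t).
Proof. by move=> /pdomP[a ca]; rewrite (pextE ca). Qed.

Lemma Lip_LK0 chi : Lip chi <->
  open (pdom chi) /\ forall t, pdom chi t -> LK 0 (pext chi) t.
Proof.
split=> -[oc H]; split => // t0 dt0.
  have [d d0 Hd] := H _ dt0.
  have /nearR[e e0 He] := (open_near _).1 oc _ dt0.
  exists d^-1, (Num.min e (d / 2)); first by rewrite lt_min e0 divr_gt0.
  move=> s t; rewrite !lt_min => /andP[/He se sd] /andP[/He te td].
  apply: (Hd _ _ _ _ (some_pext se) (some_pext te)).
  by rewrite (splitr d) ltrD.
have /LK0_ge0[C C0 [d d0 Hd]] := H _ dt0.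
exists (Num.min d (C + 1)^-1); first by rewrite lt_min d0 invr_gt0 ltr_wpDl.
move=> s t a b /pextE <- /pextE <-; rewrite lt_min => /andP[std _].
rewrite (le_trans (Hd _ _ _ _))//.
- by rewrite (le_lt_trans _ std)// lerDl.
- by rewrite (le_lt_trans _ std)// lerDr.
rewrite ler_wpM2r// (@le_trans _ _ (C + 1)) ?lerDl// -[leLHS]invrK.
by rewrite lef_pV2 ?posrE ?lt_min ?d0 ?invr_gt0 ?ltr_wpDl// ge_min lexx orbT.
Qed.

Lemma pdom_pderive chi : pdom (pderive chi) = pdom chi.
Proof. by rewrite /pdom /pderive; apply/funext => t /=; case: (chi t). Qed.

Lemma pext_pderive chi t : pdom chi t -> pext (pderive chi) t = derive1 (pext chi) t.
Proof. by move=> /pdomP[a ca]; rewrite {1}/pext /pderive ca. Qed.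

Lemma LipkS k chi : Lipk (Some k.+1) chi <->
  [/\ Lip chi, pderivable chi & Lipk (Some k) (pderive chi)].
Proof.
split.
  move=> [oc H]; split; first by have [] := H 0%N isT.
    by have [/(_ 0%N isT)] := H 1%N isT.
  split; first by rewrite pdom_pderive.
  move=> i ik; have [H1 H2] := H i.+1 ik; split; last by rewrite -iterSr.
  by move=> j ji; rewrite -iterSr; exact: H1.
move=> [Lc dc [oc H]]; split; first by have [] := Lc.
case=> [_|i ik]; first by split.
have [H1 H2] := H i ik; split; last by rewrite iterSr.
by case=> // j ji; rewrite iterSr; exact: H1.
Qed.

Lemma Lipk_LK k chi : Lipk (Some k) chi <->
  open (pdom chi) /\ forall t, pdom chi t -> LK k (pext chi) t.
Proof.
elim: k chi => [|k IH] chi.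
  rewrite -Lip_LK0; split=> [[oc /(_ 0%N isT)[]]//|Lc].
  by split; [have [] := Lc|case].
split.
  move=> /LipkS[/Lip_LK0[oc Lc] dc /IH[_]]; rewrite pdom_pderive => H.
  split=> // t dt; split.
    by apply: filterS ((open_near _).1 oc _ dt); exact: dc.
  apply: LK_near (H t dt); apply: filterS ((open_near _).1 oc _ dt) => s.
  exact: pext_pderive.
move=> [oc H]; apply/LipkS; split.
- by apply/Lip_LK0; split=> // t /H /LK0.
- by move=> t /H; exact: LK_derivable.
apply/IH; rewrite pdom_pderive; split=> // t dt.
have [_] := H t dt; apply: LK_near.
apply: filterS ((open_near _).1 oc _ dt) => s ds.
by rewrite pext_pderive.
Qed.

Lemma LipkN chi : Lipk None chi <-> forall n, Lipk (Some n) chi.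
Proof.
split=> [[oc H] n|H]; first by split=> // i _; exact: H.
split=> [|i _]; first by have [] := H 0%N.
by have [_] := H i; apply; exact: (leqnn i).
Qed.

Lemma smooth_derive1 h : smooth h <->
  (forall t, derivable h t 1) /\ smooth (derive1 h).
Proof.
split=> [sh|[d0 dS]].
  by split=> [t|n t]; [exact: (sh 0%N)|rewrite -derive1Sn; exact: sh].
by case=> [|n] t; [exact: d0|rewrite derive1Sn; exact: dS].
Qed.

Lemma smoothP h : smooth h <-> forall k t, LK k h t.
Proof.
split.
  move=> + k; elim: k h => [|k IH] h.
    move=> /smooth_derive1[dh /smooth_derive1[d1 _]] t0.
    have : {for t0, continuous (derive1 h)}.
      by apply: differentiable_continuous; apply/derivable1_diffP.
    move=> /cvg_norm; move/cvgr_lt => /(_ (`|derive1 h t0| + 1)).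
    rewrite ltrDl ltr01 => /(_ isT)/nearR[d p0 hd].
    exists (`|derive1 h t0| + 1), d => //.
    by apply: mvt_lipschitz => t /hd/ltW.
  move=> /smooth_derive1[dh sh] t0; split; last exact: IH.
  by near=> t.
move=> H n; elim: n h H => [|n IH] h H t; first by have /LK_derivable := H 1%N t.
rewrite derive1Sn; apply: IH => k s.
by have [] := H k.+1 s.
Unshelve. all: end_near. Qed.

Lemma smooth_continuous h : smooth h -> continuous h.
Proof. by move=> /smoothP H t; exact: LK_continuous (H 0%N t). Qed.

Lemma smooth_cst (c : R) : smooth (fun=> c : R).
Proof. by apply/smoothP => k t; exact: LK_cst. Qed.

Lemma smooth_id : smooth (@id R).
Proof. by apply/smoothP => k t; exact: LK_id. Qed.

Lemma smoothD f g : smooth f -> smooth g -> smooth (fun t => f t + g t).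
Proof. by move=> /smoothP F /smoothP G; apply/smoothP => k t; exact: LK_add. Qed.

Lemma smoothM f g : smooth f -> smooth g -> smooth (fun t => f t * g t).
Proof. by move=> /smoothP F /smoothP G; apply/smoothP => k t; exact: LK_mul. Qed.

Lemma smoothN f : smooth f -> smooth (fun t => - f t).
Proof. by move=> /smoothP F; apply/smoothP => k t; exact: LK_opp. Qed.

Lemma smoothB f g : smooth f -> smooth g -> smooth (fun t => f t - g t).
Proof. by move=> F G; exact: smoothD F (smoothN G). Qed.

Lemma smooth_comp f g : smooth f -> smooth g -> smooth (fun t => f (g t)).
Proof. by move=> /smoothP F /smoothP G; apply/smoothP => k t; exact: LK_comp. Qed.

Lemma smoothV f : (forall t, f t != 0) -> smooth f -> smooth (fun t => (f t)^-1).
Proof. by move=> f0 /smoothP F; apply/smoothP => k t; exact: LK_inv. Qed.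

End LipkLK.
Arguments smooth_cst {R} c.
Arguments smooth_id {R}.

(** * A smooth step function *)

Section SmoothStep.
Variable R : realType.
Implicit Types (f g h : R -> R).

Lemma is_deriveP f (x d : R) : is_derive x 1 f d <->
  forall e : R, 0 < e -> exists2 r : R, 0 < r &
    forall s : R, s != 0 -> `|s| < r -> `|s^-1 * (f (x + s) - f x) - d| <= e.
Proof.
pose q (s : R) := s^-1 *: ((f \o shift x) (s *: (1 : R)) - f x).
have qE s : q s = s^-1 * (f (x + s) - f x).
  by rewrite /q /= -[s *: 1]/(s * 1) mulr1 (addrC s).
have qP : (q s @[s --> 0^'] --> d) <->
  forall e : R, 0 < e -> exists2 r : R, 0 < r &
    forall s : R, s != 0 -> `|s| < r -> `|s^-1 * (f (x + s) - f x) - d| <= e.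
  split=> [/cvgrPdist_le H e /H|H].
    rewrite near_withinE => /nearR[r r0 Hr]; exists r => // s s0 sr.
    by rewrite -qE distrC Hr// subr0.
  apply/cvgrPdist_le => /= e /H[r r0 Hr].
  rewrite near_withinE; apply/nearR; exists r => // s; rewrite subr0 => sr s0.
  by rewrite distrC qE Hr.
rewrite -qP; split=> [[fx <-]|qd]; first exact: fx.
by apply: DeriveDef; [apply/cvg_ex; exists d|exact: cvg_lim].
Qed.

(* The quadratic bound makes 0 the derivative at 0 of every [H k]. *)
Lemma flat_smooth (H : nat -> R -> R) :
  (forall k (t : R), t != 0 -> is_derive t 1 (H k) (H k.+1 t)) ->
  (forall k, H k 0 = 0) ->
  (forall k, exists C : R, \forall t \near (0 : R), `|H k t| <= C * t ^+ 2) ->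
  smooth (H 0%N).
Proof.
move=> Hd H0 Hb.
have Hd0 k (t : R) : is_derive t 1 (H k) (H k.+1 t).
  have [->|t0] := eqVneq t 0; last exact: Hd.
  rewrite H0; apply/is_deriveP => e e0.
  have [C /nearR[r r0 HC]] := Hb k.
  exists (Num.min r (e / (`|C| + 1))); first by rewrite lt_min r0 divr_gt0// ltr_wpDl.
  move=> s s0; rewrite lt_min => /andP[sr se].
  rewrite add0r H0 !subr0 normrM normfV.
  rewrite mulrC ler_pdivrMr ?normr_gt0//.
  rewrite (le_trans (HC s _)) ?subr0// -real_normK ?num_real// expr2 mulrA ler_wpM2r//.
  rewrite (@le_trans _ _ ((`|C| + 1) * `|s|))//.
    by rewrite ler_wpM2r// ler_wpDr// ler_norm.
  by rewrite mulrC -ler_pdivlMr ?ltr_wpDl// ltW.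
have Hn n : derive1n n (H 0%N) = H n.
  elim: n => // n IH; rewrite derive1nS IH; apply/funext => t.
  by rewrite derive1E derive_val.
by move=> n t; rewrite Hn.
Qed.

(** The exponential is split into two equal halves: one absorbs the new factor X, by 1 + y <= exp y,
    and the other goes to the induction hypothesis. This is why the rate [a] varies in the
    induction. *)
Lemma poly_expR_bounded (p : {poly R}) (a : R) : 0 < a ->
  exists2 C : R, 0 <= C & forall x, 0 < x -> `|p.[x]| * expR (- (a * x)) <= C.
Proof.
elim/poly_ind: p a => [|p c IH] a a0.
  by exists 0 => // x _; rewrite horner0 normr0 mul0r.
have [C C0 HC] := IH _ (divr_gt0 a0 (ltr0Sn _ 1)).
have a2 : 0 < a / 2 by rewrite divr_gt0.
exists (C * (a / 2)^-1 + `|c|); first by rewrite addr_ge0// mulr_ge0// invr_ge0 ltW.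
move=> x x0; rewrite !hornerE (le_trans (ler_wpM2r _ (ler_normD _ _))) ?expR_ge0//.
rewrite mulrDl lerD//; last first.
  by rewrite ler_piMr// -expR0 ler_expR oppr_le0 mulr_ge0// ltW.
have -> : - (a * x) = - (a / 2 * x) + - (a / 2 * x) by rewrite {1}(splitr a); ring.
rewrite expRD normrM mulrACA ler_pM// ?mulr_ge0 ?expR_ge0//; first exact: HC.
rewrite expRN gtr0_norm// ler_pdivrMr ?expR_gt0// mulrC ler_pdivlMr//.
by rewrite mulrC (le_trans _ (expR_ge1Dx _))// lerDr.
Qed.

Definition fexp (t : R) : R := if 0 < t then expR (- t^-1) else 0.

(** For t > 0 the k-th derivative of exp (-1/t) is P_k (1/t) exp (-1/t), with these polynomials
    P_k. *)
Fixpoint fexp_poly (k : nat) : {poly R} :=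
  if k is k'.+1 then 'X ^+ 2 * (fexp_poly k' - deriv (fexp_poly k')) else 1.

Lemma fexp_smooth : smooth fexp.
Proof.
pose H k (t : R) := if 0 < t then (fexp_poly k).[t^-1] * expR (- t^-1) else 0.
have -> : fexp = H 0%N by apply/funext => t; rewrite /fexp /H hornerE mul1r.
apply: flat_smooth => [k t|k|k]; last 2 first.
- by rewrite /H ltxx.
(* The extra factor X^2, evaluated at 1/t, becomes the t^2 of the quadratic bound. *)
- have [C C0 HC] := poly_expR_bounded ('X ^+ 2 * fexp_poly k) ltr01.
  exists C; near=> t; rewrite /H; case: ifPn => t0; last first.
    by rewrite normr0 mulr_ge0// sqr_ge0.
  have := HC t^-1; rewrite invr_gt0 => /(_ t0).
  rewrite mul1r hornerM hornerXn normrM -mulrA.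
  rewrite (@ger0_norm _ (_ ^+ 2)) ?sqr_ge0// exprVn.
  rewrite mulrC ler_pdivrMr ?exprn_gt0// normrM (@ger0_norm _ (expR _)) ?expR_ge0//.
have [t0 _|t0 _|-> /eqP//] := ltrgtP t 0.
  rewrite {2}/H ltNge (ltW t0)/=.
  have := is_derive_cst (0 : R) t 1; apply: near_eq_is_derive.
  near=> s; rewrite /H ltNge ltW//=.
  by near: s; exact: lt_nbhsl.
rewrite {2}/H t0.
have tn0' : id t != 0 by rewrite gt_eqF.
have di : is_derive t 1 (fun s : R => s^-1) (- t ^- 2).
  by have := is_deriveV tn0' (is_derive_id t (1 : R)); rewrite -[_ *: 1]/(_ * 1) mulr1.
have dp := @is_derive1_comp _ (horner (fexp_poly k)) _ t _ _ (is_derive_poly _ _) di.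
have dn := is_deriveN di; rewrite opprK in dn.
have de := @is_derive1_comp _ expR _ t _ _ (is_derive_expR _) dn.
have dpe := is_deriveM dp de.
have dH : is_derive t 1 (H k) _ := near_eq_is_derive _ dpe.
apply: (is_derive_eq (dH _)) => /=.
  near=> s; rewrite /H ifT//.
  by near: s; exact: lt_nbhsr.
rewrite hornerM hornerXn hornerD hornerN exprVn -![_ *: _]/(_ * _).
by ring.
Unshelve. all: end_near. Qed.

Lemma fexp_gt0 t : 0 < t -> 0 < fexp t.
Proof. by move=> t0; rewrite /fexp t0 expR_gt0. Qed.

Lemma fexp_ge0 t : 0 <= fexp t.
Proof. by rewrite /fexp; case: ifP => // _; rewrite expR_ge0. Qed.

Lemma fexp_le0 t : t <= 0 -> fexp t = 0.
Proof. by move=> t0; rewrite /fexp ltNge t0. Qed.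

(** The plateaus reach to 1/3 and back from 2/3, not just to 0 and 1. These margins make consecutive
    blends coincide on an interval, which is also where the interpolated curve is exactly affine. *)
Definition step (x : R) : R :=
  fexp (3 * x - 1) * (fexp (3 * x - 1) + fexp (2 - 3 * x))^-1.

Lemma step_smooth : smooth step.
Proof.
have s3 := smoothM (smooth_cst (3 : R)) smooth_id.
have s1 := smooth_comp fexp_smooth (smoothB s3 (smooth_cst 1)).
have s2 := smooth_comp fexp_smooth (smoothB (smooth_cst 2) s3).
refine (smoothM s1 (smoothV _ (smoothD s1 s2))).
move=> x; rewrite gt_eqF//; have [x0|x0] := ltP 0 (3 * x - 1).
  by rewrite ltr_pwDl ?fexp_ge0 ?fexp_gt0.
by rewrite ltr_wpDl ?fexp_ge0// fexp_gt0//; lra.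
Qed.

Lemma step0 x : x <= 3^-1 -> step x = 0.
Proof. by move=> x0; rewrite /step fexp_le0 ?mul0r//; lra. Qed.

Lemma step1 x : 2 / 3 <= x -> step x = 1.
Proof.
move=> x0; rewrite /step (@fexp_le0 (2 - 3 * x)); last by lra.
by rewrite addr0 divff// gt_eqF// fexp_gt0//; lra.
Qed.

End SmoothStep.

(** * Smooth curves through fast converging affine pieces *)

Section Scalar.
Variables (R : realType) (X : lmodType R) (l : X -> R).
Hypothesis ll : scalar l.

Lemma scalar_fD u v : l (u + v) = l u + l v.
Proof. by have := ll 1 u v; rewrite scale1r mul1r. Qed.

Lemma scalar_f0 : l 0 = 0.
Proof. by have := scalar_fD 0 0; rewrite addr0 -[LHS]addr0 => /addrI. Qed.

Lemma scalar_fZ a u : l (a *: u) = a * l u.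
Proof. by have := ll a u 0; rewrite !addr0 scalar_f0 addr0. Qed.

Lemma scalar_fN u : l (- u) = - l u.
Proof. by rewrite -scaleN1r scalar_fZ mulN1r. Qed.

Lemma scalar_fB u v : l (u - v) = l u - l v.
Proof. by rewrite scalar_fD scalar_fN. Qed.

End Scalar.

Section Dyadic.
Variable R : realType.

Definition dy (n : nat) : R := 2^-1 ^+ n.

Lemma dy_gt0 n : 0 < dy n. Proof. by rewrite exprn_gt0// invr_gt0. Qed.

Lemma dy_ge0 n : 0 <= dy n. Proof. by rewrite ltW// dy_gt0. Qed.

Lemma dyS n : dy n.+1 = dy n / 2. Proof. by rewrite /dy exprSr. Qed.

Lemma dy_le m n : (m <= n)%N -> dy n <= dy m.
Proof.
by move=> mn; rewrite ler_wiXn2l// ?invr_ge0// invf_le1// ler1n.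
Qed.

Lemma dy_le1 n : dy n <= 1. Proof. by have := dy_le (leq0n n); rewrite /dy expr0. Qed.

Lemma dy_small (e : R) : 0 < e -> \forall n \near \oo, dy n < e.
Proof.
move=> e0; have := near_infty_natSinv_expn_lt (PosNum e0).
by apply: filterS => n /=; rewrite div1r /dy exprVn.
Qed.

Lemma near_natP (P : nat -> Prop) : (\forall n \near \oo, P n) <->
  exists N : nat, forall n, (N <= n)%N -> P n.
Proof. by split=> [[N _ H]|[N H]]; [exists N|exists N]. Qed.

Lemma blk_ex (t : R) : 0 < t -> exists n, dy n.+1 < t /\ (n = 0%N \/ t <= dy n).
Proof.
move=> t0; have /near_natP[N HN] := dy_small t0.
have ex : exists n, dy n.+1 < t by exists N; apply: HN.
case: (ex_minnP ex) => -[|n] nt min; first by exists 0%N; split=> //; left.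
exists n.+1; split=> //; right; rewrite leNgt; apply/negP => /min.
by rewrite ltnn.
Qed.

Definition blk (t : R) : nat :=
  get [set n | dy n.+1 < t /\ (n = 0%N \/ t <= dy n)].

Lemma blkP (t : R) : 0 < t -> dy (blk t).+1 < t /\ (blk t = 0%N \/ t <= dy (blk t)).
Proof. by move=> /blk_ex/getPex. Qed.

Section Interp.
Variable X : lmodType R.
Implicit Types a v : nat -> X.

Definition piece a v n (t : R) : X := a n + (t - dy n) *: v n.

(** The argument of [step] runs from 0 to 1 while t runs from 2^-(n+1) to 2^-n, so the curve changes
    from piece n+1 to piece n on this block. *)
Definition blend a v n (t : R) : X :=
  piece a v n.+1 t +
  step (2 ^+ n.+1 * t - 1) *: (piece a v n t - piece a v n.+1 t).

(* Equal to [piece a v n] on [dy n, 4/3 dy n[, where dy n = 2^-n, and to 0 on the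
   negative half-line. *)
Definition interp a v (t : R) : X := if 0 < t then blend a v (blk t) t else 0.

Lemma pow2_dy n : 2 ^+ n * dy n = 1 :> R.
Proof. by rewrite /dy exprVn divff// expf_neq0. Qed.

Lemma blend_right a v n t : dy n <= t -> blend a v n t = piece a v n t.
Proof.
move=> nt; have s1 : step (2 ^+ n.+1 * t - 1) = 1.
  apply: step1; have : 2 ^+ n.+1 * dy n <= 2 ^+ n.+1 * t.
    by rewrite ler_wpM2l// exprn_ge0.
  by rewrite exprS -mulrA pow2_dy; lra.
by rewrite /blend s1 scale1r addrC subrK.
Qed.

Lemma blend_left a v n t : t <= 4 / 3 * dy n.+1 -> blend a v n t = piece a v n.+1 t.
Proof.
move=> nt; have s0 : step (2 ^+ n.+1 * t - 1) = 0.
  apply: step0; have : 2 ^+ n.+1 * t <= 2 ^+ n.+1 * (4 / 3 * dy n.+1).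
    by rewrite ler_wpM2l// exprn_ge0.
  by rewrite mulrCA pow2_dy; lra.
by rewrite /blend s0 scale0r addr0.
Qed.

(** The formula extends beyond block n, up to 4/3 of its right end, since blends n and n-1 both
    equal piece n there. Every positive t thus has a neighbourhood on which a single blend describes
    the curve. *)
Lemma interp_blend a v n t : dy n.+1 < t -> n = 0%N \/ t < 4 / 3 * dy n ->
  interp a v t = blend a v n t.
Proof.
move=> nt tn; have t0 : 0 < t by rewrite (lt_trans _ nt)// dy_gt0.
rewrite /interp t0; have [] := blkP t0; set m := blk t => mt tm.
have [mn|nm|->//] := ltngtP m n; last first.
  case: tm => [m0|tm]; first by rewrite m0 in nm.
  by have := dy_le nm; rewrite leNgt (lt_le_trans nt tm).
case: tn => [n0|tn]; first by rewrite n0 in mn.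
have [mn1|mn1|nE] := ltngtP m.+1 n.
- have := dy_le mn1; rewrite dyS => H; exfalso; lra.
- by exfalso; move: mn1; rewrite ltnS leqNgt mn.
rewrite -nE in tn nt *; rewrite blend_left ?ltW// blend_right//.
by rewrite ltW.
Qed.

Lemma interp_piece a v n t : dy n <= t -> t < 4 / 3 * dy n ->
  interp a v t = piece a v n t.
Proof.
move=> nt tn; rewrite -blend_right//; apply: interp_blend; last by right.
by rewrite dyS; have := dy_gt0 n; lra.
Qed.

End Interp.

Lemma interp_linear (X : lmodType R) (l : X -> R) (a v : nat -> X) (t : R) :
  scalar l -> l (interp a v t) = interp (l \o a : nat -> R^o) (l \o v) t.
Proof.
move=> ll; rewrite /interp; case: ifP => _; last exact: scalar_f0.
by rewrite /blend /piece !(scalar_fD ll, scalar_fN ll, scalar_fZ ll).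
Qed.

(** Decay is measured against 2^-n, the time at which the n-th point is reached: k derivatives cost
    a factor of order 2^(n k), which rapid decay outweighs for every k. *)
Definition rapid (a : nat -> R) := forall m, \forall n \near \oo, `|a n| <= dy n ^+ m.


Lemma derive1n_near n (f g : R -> R) (t0 : R) : (\forall t \near t0, f t = g t) ->
  \forall t \near t0, derive1n n f t = derive1n n g t.
Proof.
move=> fg; elim: n => [//|n IH].
by rewrite !derive1nS; exact: near_derive1.
Qed.

Lemma LK_derive1n n k (f : R -> R) (t : R) : LK (n + k) f t -> LK k (derive1n n f) t.
Proof.
elim: n f => [//|n IH] f; rewrite addSn => -[_ /IH].
by rewrite derive1Sn.
Qed.

(** The candidate [H k] for the k-th derivative is set to 0 at the origin, where the derivative is
    not yet known to exist. *)
Lemma flat_smooth_at0 (h : R -> R) : h 0 = 0 ->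
  (forall t : R, t != 0 -> forall k, LK k h t) ->
  (forall k, exists C : R, \forall t \near (0 : R), t != 0 ->
    `|derive1n k h t| <= C * t ^+ 2) ->
  smooth h.
Proof.
move=> h0 hs hb; pose H k (t : R) := if t == 0 then 0 else derive1n k h t.
have -> : h = H 0%N.
  by apply/funext => t; rewrite /H; case: eqP => [->|].
apply: flat_smooth => [k t t0|k|k].
- have /LK_derive1n := hs _ t0 (k + 1)%N => /LK_derivable/derivableP.
  rewrite -derive1E -derive1nS /H (negPf t0); apply: near_eq_is_derive.
  near=> s; rewrite ifF//; apply/negbTE.
  by near: s; exact: (cvgr_neq0 _ cvg_id t0).
- by rewrite /H eqxx.
have [C HC] := hb k; exists (`|C|); near=> t; rewrite /H; case: ifPn => t0.
  by rewrite normr0 mulr_ge0// sqr_ge0.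
rewrite (@le_trans _ _ (C * t ^+ 2))//; last by rewrite ler_wpM2r ?ler_norm ?sqr_ge0.
by move: t0; near: t.
Unshelve. all: end_near. Qed.

End Dyadic.

Section InterpSmooth.
Variable R : realType.

Lemma derive1n_stepD k (t : R) :
  is_derive t 1 (derive1n k (@step R)) (derive1n k.+1 (@step R) t).
Proof.
rewrite derive1nS derive1E; apply: derivableP.
by have := @step_smooth R => /(_ k t).
Qed.

Definition blend_lin k (A B t : R) : R :=
  match k with 0 => A + B * t | 1 => B | _ => 0 end.

(** The k-th derivative of A + B t + step (lam t - 1) (A' + B' t). The last factor is affine, so the
    Leibniz rule leaves two terms; for k = 0 the coefficient [k%:R] removes the second. *)
Definition blendD k (lam A B A' B' t : R) : R :=
  blend_lin k A B t + lam ^+ k * derive1n k (@step R) (lam * t - 1) * (A' + B' * t)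
  + k%:R * lam ^+ k.-1 * derive1n k.-1 (@step R) (lam * t - 1) * B'.

Lemma is_derive_affine (c d t : R) : is_derive t 1 (fun t => c + d * t) d.
Proof.
have := is_deriveD (is_derive_cst c t 1) (is_deriveZ d (is_derive_id t (1 : R))).
by rewrite add0r -[_ *: 1]/(_ * 1) mulr1.
Qed.

Lemma is_derive_blendD k (lam A B A' B' t : R) :
  is_derive t 1 (blendD k lam A B A' B') (blendD k.+1 lam A B A' B' t).
Proof.
have daff : is_derive t 1 (fun t => lam * t - 1) lam.
  have := is_derive_affine (-1) lam t; congr is_derive.
  by apply/funext => s; rewrite addrC.
have dst j : is_derive t 1 (fun t => derive1n j (@step R) (lam * t - 1))
    (derive1n j.+1 (@step R) (lam * t - 1) * lam).
  exact: (@is_derive1_comp _ (derive1n j (@step R)) (fun t => lam * t - 1) t _ _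
    (derive1n_stepD j (lam * t - 1)) daff).
have dlin : is_derive t 1 (blend_lin k A B) (blend_lin k.+1 A B t).
  case: k => [|[|k]]; [exact: is_derive_affine|exact: is_derive_cst|exact: is_derive_cst].
have d2 := is_deriveM (is_deriveZ (lam ^+ k) (dst k)) (is_derive_affine A' B' t).
have d3 := is_deriveM (is_deriveZ (k%:R * lam ^+ k.-1) (dst k.-1)) (is_derive_cst B' t 1).
apply: (is_derive_eq (is_deriveD (is_deriveD dlin d2) d3)).
rewrite /blendD /= -![_ *: _]/(_ * _) -addrA -[RHS]addrA; congr (_ + _).
case: k {dlin d2 d3} => [|k] /=; first by rewrite expr1 expr0; ring.
by rewrite !exprS -(natr1 k.+1); ring.
Qed.

Lemma derive1n_blendD k (lam A B A' B' : R) :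
  derive1n k (blendD 0 lam A B A' B') = blendD k lam A B A' B'.
Proof.
elim: k => // k IH; rewrite derive1nS IH; apply/funext => t.
rewrite derive1E; have := is_derive_blendD k lam A B A' B' t.
by move=> ?; rewrite derive_val.
Qed.

Lemma blend_smooth (a v : nat -> R^o) n : smooth (blend a v n).
Proof.
have -> : blend a v n = blendD 0 (2 ^+ n.+1) (a n.+1 - dy R n.+1 * v n.+1) (v n.+1)
    (a n - a n.+1 - (dy R n * v n - dy R n.+1 * v n.+1)) (v n - v n.+1).
  apply/funext => t.
  by rewrite /blend /blendD /piece /= -![_ *: _]/(_ * _) expr0; ring.
by move=> k t; rewrite derive1n_blendD; have [] := is_derive_blendD k (2 ^+ n.+1)
 (a n.+1 - dy R n.+1 * v n.+1) (v n.+1)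
    (a n - a n.+1 - (dy R n * v n - dy R n.+1 * v n.+1)) (v n - v n.+1) t.
Qed.

Lemma derive1n_step_bounded k : exists2 M : R, 0 <= M &
  forall x, 0 <= x <= 2 -> `|derive1n k (@step R) x| <= M.
Proof.
have sc : continuous (derive1n k (@step R)).
  move=> x; apply: differentiable_continuous; apply/derivable1_diffP.
  exact: step_smooth.
have [] := @EVT_max R (fun x => `|derive1n k (@step R) x|) 0 2 (ler0n _ 2).
  by apply: continuous_subspaceT => x; apply: cvg_norm; exact: sc.
move=> c _ H; by exists (`|derive1n k (@step R) c|).
Qed.

(** Each derivative costs a factor 2^(n+1), the speed of the argument of [step]. This argument stays
    in [0, 2], where the derivatives of [step] are bounded, and t <= 2 controls the affine
    factors. *)
Lemma blend_bound k : exists2 K : R, 0 <= K & forall (a v : nat -> R^o) n (t : R),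
  dy R n.+1 < t -> t < 4 / 3 * dy R n ->
  `|derive1n k (blend a v n) t| <=
    K * (2 ^+ n.+1) ^+ k * (`|a n| + `|v n| + (`|a n.+1| + `|v n.+1|)).
Proof.
have [M M0 HM] := derive1n_step_bounded k.
have [N N0 HN] := derive1n_step_bounded k.-1.
exists (3 + 6 * M + k%:R * N); first by rewrite !addr_ge0// mulr_ge0.
move=> a v n t nt tn.
have -> : blend a v n = blendD 0 (2 ^+ n.+1) (a n.+1 - dy R n.+1 * v n.+1) (v n.+1)
    (a n - a n.+1 - (dy R n * v n - dy R n.+1 * v n.+1)) (v n - v n.+1).
  apply/funext => s.
  by rewrite /blend /blendD /piece /= -![_ *: _]/(_ * _) expr0; ring.
rewrite derive1n_blendD.
have t0 : 0 < t by rewrite (lt_trans _ nt)// dy_gt0.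
have t2 : t <= 2 by have := dy_le1 R n; lra.
set lam : R := 2 ^+ n.+1.
have lam0 : 0 < lam by rewrite exprn_gt0.
have lam1 : 1 <= lam by rewrite exprn_ege1// ler1n.
have lt02 : 0 <= lam * t - 1 <= 2.
  have e1 : lam * dy R n.+1 = 1 by exact: pow2_dy.
  have e2 : lam * (4 / 3 * dy R n) = 8 / 3.
    by have := pow2_dy R n; rewrite /lam exprS; lra.
  have : lam * dy R n.+1 < lam * t by rewrite ltr_pM2l.
  have : lam * t < lam * (4 / 3 * dy R n) by rewrite ltr_pM2l.
  by rewrite e1 e2 => h1 h2; apply/andP; split; lra.
set S := `|a n| + _ + _.
have S0 : 0 <= S by rewrite !addr_ge0.
have pos x := normr_ge0 (x : R).
have dyb m (x : R) : `|dy R m * x| <= `|x|.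
  by rewrite normrM ger0_norm ?dy_ge0// ler_piMl// dy_le1.
have anS : `|a n| <= S by rewrite /S -!addrA lerDl !addr_ge0.
have vnS : `|v n| <= S by rewrite /S; have := pos (a n); have := pos (a n.+1); have := pos (v n.+1); lra.
have A1 : `|a n.+1 - dy R n.+1 * v n.+1| <= S.
  rewrite (le_trans (ler_normB _ _))// /S.
  by have := dyb n.+1 (v n.+1); have := pos (a n); have := pos (v n); lra.
have B1 : `|v n.+1| <= S.
  by rewrite /S; have := pos (a n.+1); have := pos (a n); have := pos (v n); lra.
have A2 : `|a n - a n.+1 - (dy R n * v n - dy R n.+1 * v n.+1)| <= S.
  rewrite (le_trans (ler_normB _ _))//.
  rewrite (le_trans (lerD (ler_normB _ _) (ler_normB _ _)))//.
  by have := dyb n.+1 (v n.+1); have := dyb n (v n); rewrite /S; lra.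
have B2 : `|v n - v n.+1| <= S.
  rewrite (le_trans (ler_normB _ _))// /S.
  by have := pos (a n); have := pos (a n.+1); lra.
move: A1 B1 A2 B2.
move: (a n - a n.+1 - _) (v n - _) (a n.+1 - _) => A' B' A.
move: (v n.+1 : R) => B A1 B1 A2 B2.
have lk1 : 1 <= lam ^+ k by rewrite exprn_ege1.
rewrite /blendD (le_trans (ler_normD _ _))//.
have -> : (3 + 6 * M + k%:R * N) * lam ^+ k * S =
  (3 * S * lam ^+ k + 6 * (M * (S * lam ^+ k))) + k%:R * N * S * lam ^+ k by ring.
rewrite lerD//.
  rewrite (le_trans (ler_normD _ _))// lerD//.
    apply: (@le_trans _ _ (3 * S)); last by rewrite ler_peMr// mulr_ge0.
    rewrite /blend_lin; case: k {HM HN lk1} => [|[|k]].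
    - rewrite (le_trans (ler_normD _ _))// normrM (ger0_norm (ltW t0)).
      have : `|B| * t <= S * 2 by rewrite ler_pM// ltW.
      lra.
    - lra.
    - by rewrite normr0 mulr_ge0.
  rewrite !normrM (ger0_norm (exprn_ge0 _ (ltW lam0))) mulrC.
  have h1 : `|A' + B' * t| <= 3 * S.
    rewrite (le_trans (ler_normD _ _))// normrM (ger0_norm (ltW t0)).
    have : `|B'| * t <= S * 2 by rewrite ler_pM// ltW.
    lra.
  have h2 : `|derive1n k (@step R) (lam * t - 1)| <= M by apply: HM.
  rewrite (_ : 6 * (M * (S * lam ^+ k)) = (6 * S) * (lam ^+ k * M)); last by ring.
  rewrite ler_pM//; first by rewrite mulr_ge0// exprn_ge0// ltW.
    by rewrite (le_trans h1)// ler_wpM2r//; lra.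
  by rewrite ler_wpM2l// exprn_ge0// ltW.
rewrite !normrM (ger0_norm (exprn_ge0 _ (ltW lam0))) normr_nat.
have h2 : `|derive1n k.-1 (@step R) (lam * t - 1)| <= N by apply: HN.
rewrite (_ : k%:R * N * S * lam ^+ k = (k%:R * lam ^+ k) * N * S); last by ring.
have p1 : 0 <= k%:R * lam ^+ k.-1 by rewrite mulr_ge0// exprn_ge0// ltW.
have h1 : k%:R * lam ^+ k.-1 <= k%:R * lam ^+ k.
  by rewrite ler_wpM2l// ler_weXn2l// leq_pred.
apply: ler_pM => //; first by rewrite mulr_ge0.
exact: ler_pM.
Qed.

Lemma interp_smooth (a v : nat -> R^o) : rapid a -> rapid v -> smooth (interp a v).
Proof.
move=> ra rv; apply: flat_smooth_at0; first by rewrite /interp ltxx.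
  move=> t t0 k; have [tn|tp|tE] := ltrgtP t 0; last by rewrite tE eqxx in t0.
    have := LK_cst k (0 : R) t; apply: LK_near; near=> s.
    rewrite /interp ltNge ltW//; by near: s; exact: lt_nbhsl.
  have [nt tn] := blkP tp; have /smoothP/(_ k t) := @blend_smooth a v (blk t).
  have tn' : blk t = 0%N \/ \forall s \near t, s < 4 / 3 * dy R (blk t).
    case: tn => [|tn]; [by left|right].
    have tn' : t < 4 / 3 * dy R (blk t) by have := dy_gt0 R (blk t); lra.
    exact: lt_nbhsl.
  apply: LK_near; case: tn' => tn'; near=> s; apply/esym/interp_blend.
  - by near: s; exact: lt_nbhsr.
  - by left.
  - by near: s; exact: lt_nbhsr.
  - by right; near: s.
move=> k; have [K K0 HK] := blend_bound k.
have /near_natP[N HN] : \forall n \near \oo,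
    `|a n| <= dy R n ^+ k.+2 /\ `|v n| <= dy R n ^+ k.+2.
  by near=> n; split; near: n; [exact: ra|exact: rv].
(* Of the k+2 powers of 2^-n, k cancel (2^n)^k, leaving 2^k from (2^(n+1))^k. One factor 4 counts
   the terms [a n], [v n], [a n.+1], [v n.+1]; the other comes from 2^-n < 2 t, squared. *)
exists (K * 2 ^+ k * 4 * 4); near=> t => t0.
have [tn|tp|tE] := ltrgtP t 0; last by rewrite tE eqxx in t0.
  have -> : derive1n k (interp a v) t = derive1n k (fun=> 0 : R) t.
    have : \forall s \near t, interp a v s = (fun=> 0 : R) s.
      near=> s; rewrite /interp ltNge ltW//; by near: s; exact: lt_nbhsl.
    by move/(derive1n_near k)/nbhs_singleton.
  have -> : derive1n k (fun=> 0 : R) t = 0.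
    elim: k {HK HN} => // k IH.
    by rewrite derive1Sn (_ : derive1 _ = fun=> 0)//; apply/funext => s; exact: derive1_cst.
  by rewrite normr0 mulr_ge0 ?sqr_ge0// !mulr_ge0// exprn_ge0.
have [nt tn] := blkP tp; set n := blk t in nt tn.
have Nn : (N < n)%N.
  have : t < dy R N.+2.
    near: t; apply: lt_nbhsl; exact: dy_gt0.
  move=> tN; rewrite ltnNge; apply/negP => nN.
  by have := @dy_le R n.+1 N.+2; rewrite ltnS leqW// => /(_ isT); lra.
have {}tn : t <= dy R n by case: tn => // n0; rewrite n0 in Nn.
have tn' : t < 4 / 3 * dy R n by have := dy_gt0 R n; lra.
have -> : derive1n k (interp a v) t = derive1n k (blend a v n) t.
  have : \forall s \near t, interp a v s = blend a v n s.
    near=> s; apply: interp_blend; first by near: s; exact: lt_nbhsr.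
    by right; near: s; exact: lt_nbhsl.
  by move/(derive1n_near k)/nbhs_singleton.
rewrite (le_trans (HK _ _ _ _ nt tn'))//.
have [an vn] := HN _ (ltnW Nn); have [an1 vn1] := HN n.+1 (leqW (ltnW Nn)).
have dyy : dy R n.+1 ^+ k.+2 <= dy R n ^+ k.+2.
  by rewrite lerXn2r// ?nnegrE ?dy_ge0// dy_le.
have : `|a n| + `|v n| + (`|a n.+1| + `|v n.+1|) <= 4 * dy R n ^+ k.+2 by lra.
move=> H; apply: (@le_trans _ _ (K * (2 ^+ n.+1) ^+ k * (4 * dy R n ^+ k.+2))).
  by rewrite ler_wpM2l// mulr_ge0// !exprn_ge0.
have -> : K * (2 ^+ n.+1) ^+ k * (4 * dy R n ^+ k.+2) = K * 2 ^+ k * 4 * dy R n ^+ 2.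
  rewrite -(addn2 k) exprD (exprS _ n) exprMn.
  transitivity (K * 2 ^+ k * 4 * dy R n ^+ 2 * (2 ^+ n * dy R n) ^+ k).
    by rewrite exprMn; ring.
  by rewrite pow2_dy expr1n mulr1.
rewrite -!mulrA ler_wpM2l// ler_wpM2l ?exprn_ge0// ler_wpM2l//.
by move: nt; rewrite dyS; have := dy_gt0 R n; nra.
Unshelve. all: end_near. Qed.

End InterpSmooth.

(** * Finite differences and the curve lemma *)

Section Differences.
Variables (R : realType) (V : zmodType).

Fixpoint DL (s : seq V) (f : V -> R) (p : V) : R :=
  if s is a :: s' then DL s' f (p + a) - DL s' f p else f p.

Lemma DL0 s f p : 0 \in s -> DL s f p = 0.
Proof.
elim: s p => // a s IH p; rewrite inE => /orP[/eqP <-|as0] /=.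
  by rewrite addr0 subrr.
by rewrite !IH// subrr.
Qed.

End Differences.

Section RealDifferences.
Variable R : realType.
Implicit Types f g h : R -> R.

Lemma DL_swap (a b : R) s f p : DL (a :: b :: s) f p = DL (b :: a :: s) f p.
Proof. by rewrite /= (addrAC p a b); ring. Qed.

(* [LocM k h t0]: the mixed differences of order k+1 of h near t0 are bounded as
   they are for a function of class Lip^k. *)
Definition LocM k f (t0 : R) : Prop := exists C : R, exists2 d : R, 0 < d &
  forall (s : seq R) t, size s = k.+1 -> (forall a, a \in s -> `|a| < d) ->
    `|t - t0| < d -> `|DL s f t| <= C * \prod_(a <- s) `|a|.

Definition norm_sum (s : seq R) : R := \sum_(a <- s) `|a|.

Lemma norm_sum_cons a s : norm_sum (a :: s) = `|a| + norm_sum s.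
Proof. by rewrite /norm_sum big_cons. Qed.

Lemma norm_sum_ge0 s : 0 <= norm_sum s.
Proof. exact: sumr_ge0. Qed.

Lemma norm_sum_le s d : (forall a, a \in s -> `|a| <= d) ->
  norm_sum s <= (size s)%:R * d.
Proof.
elim: s => [|a s IH] H; first by rewrite /norm_sum big_nil mul0r.
rewrite norm_sum_cons /= -natr1 mulrDl mul1r addrC lerD ?H ?mem_head//.
by apply: IH => b bs; apply: H; rewrite inE bs orbT.
Qed.

Lemma DL_is_derive f g s (t : R) :
  (forall q : R, `|q - t| <= norm_sum s -> is_derive q 1 f (g q)) ->
  is_derive t 1 (DL s f) (DL s g t).
Proof.
elim: s t => [|a s IH] t H /=; first by apply: H; rewrite subrr normr0 norm_sum_ge0.
apply: is_deriveB.
  have dt : is_derive t 1 (fun x : R => x + a) 1.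
    by have := is_deriveD (is_derive_id t (1 : R)) (is_derive_cst a t 1); rewrite addr0.
  rewrite -[DL s g _]mulr1.
  apply: (@is_derive1_comp _ (DL s f) (fun x => x + a) t _ _ _ dt).
  apply: IH => q qt; apply: H; rewrite norm_sum_cons.
  have -> : q - t = a + (q - (t + a)) by ring.
  by rewrite (le_trans (ler_normD _ _))// lerD2l.
by apply: IH => q qt; apply: H; rewrite norm_sum_cons ler_wpDl.
Qed.

(** The mean value theorem in the first step trades one order of difference for one derivative. *)
Lemma LK_LocM k f t0 : LK k f t0 -> LocM k f t0.
Proof.
elim: k f => [|k IH] f.
  move=> [C [d d0 fC]]; exists C, (d / 2); first by rewrite divr_gt0.
  case=> [|a [|b s]]// t _ /(_ a (mem_head _ _)) ad td /=.
  rewrite big_seq1 (le_trans (fC _ _ _ _))//.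
  - have -> : t + a - t0 = (t - t0) + a by ring.
    by rewrite (le_lt_trans (ler_normD _ _))// (splitr d) ltrD.
  - by rewrite (lt_trans td)//; lra.
  - by rewrite addrAC subrr add0r.
move=> fk; have /nearR[e e0 He] := LK_is_derive fk.
have [C [d d0 HC]] := IH _ fk.2.
(* The radius [e] is divided into k+4 shares: one for t - t0, one for the mean value point, and k+2
   to cover the k+1 remaining steps. *)
exists C, (Num.min (d / 2) (e / (k.+4)%:R)); first by rewrite lt_min !divr_gt0.
case=> // a s t [sk] sd; rewrite lt_min => /andP[td te].
have {}sd b : b \in a :: s -> `|b| < d / 2 /\ `|b| < e / (k.+4)%:R.
  by move=> /sd; rewrite lt_min => /andP[].
have e4 : e = e / k.+4%:R + e / k.+4%:R + (k.+2)%:R * (e / k.+4%:R).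
  by rewrite -(natr1 k.+3) -(natr1 k.+2); field; rewrite -!natrD ?natr1 pnatr_eq0.
have ns : norm_sum s <= k.+2%:R * (e / k.+4%:R).
  rewrite (le_trans (norm_sum_le (d := e / k.+4%:R) _))//.
    by move=> b bs; rewrite ltW//; have [] := sd b; rewrite // inE bs orbT.
  by rewrite sk ler_wpM2r// ?ler_nat// divr_ge0// ltW.
have seg q : `|q - t| <= `|a| ->
    is_derive q 1 (DL s f) (DL s (derive1 f) q) /\ `|q - t0| < d.
  move=> qt; split; last first.
    have -> : q - t0 = (q - t) + (t - t0) by ring.
    rewrite (le_lt_trans (ler_normD _ _))// (splitr d) ler_ltD//.
    by rewrite (le_trans qt)// ltW//; have [] := sd _ (mem_head _ _).
  apply: DL_is_derive => r rq; apply: He.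
  have -> : r - t0 = (q - t) + (t - t0) + (r - q) by ring.
  rewrite (le_lt_trans (ler_normD _ _))// e4 ltr_leD//; last exact: le_trans rq ns.
  rewrite (le_lt_trans (ler_normD _ _))// ler_ltD//.
  by rewrite (le_trans qt)// ltW//; have [] := sd _ (mem_head _ _).
rewrite big_cons /=.
have bd q : `|q - t| <= `|a| -> `|DL s (derive1 f) q| <= C * \prod_(b <- s) `|b|.
  move=> qt; apply: HC => //; last by have [] := seg q qt.
  move=> b bs; have [bd _] : `|b| < d / 2 /\ `|b| < e / (k.+4)%:R.
    by apply: sd; rewrite inE bs orbT.
  by rewrite (lt_trans bd)//; lra.
have mv (u v : R) : u <= v -> (forall q, q \in `[u, v] -> `|q - t| <= `|a|) ->
    `|DL s f v - DL s f u| <= C * \prod_(b <- s) `|b| * (v - u).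
  move=> uv H; have [c cI ->] : exists2 c, c \in `[u, v] &
      DL s f v - DL s f u = DL s (derive1 f) c * (v - u).
    apply: MVT_segment => //.
      by move=> x xI; have [] := seg x (H x (subset_itv_oo_cc xI)).
    apply: derivable_within_continuous => x xI.
    by have [[]] := seg x (H x xI).
  rewrite normrM (@ger0_norm _ (v - u)) ?subr_ge0// ler_wpM2r ?subr_ge0//.
  exact: bd (H c cI).
rewrite mulrCA mulrC; have [a0|a0] := leP 0 a.
  have := mv t (t + a); rewrite lerDl (_ : t + a - t = a); last by ring.
  rewrite (ger0_norm a0); apply=> // q; rewrite in_itv/= => /andP[tq qa].
  by rewrite !ger0_norm// ?subr_ge0// lerBlDl.
rewrite distrC (le_trans (mv _ _ _ _))//.
- by rewrite gerDl ltW.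
- move=> q; rewrite in_itv/= => /andP[tq qa].
  by rewrite ler0_norm ?subr_le0// ltr0_norm//; lra.
- by rewrite opprD addNKr (ltr0_norm a0).
Qed.

(** A difference with m equal steps sees only m+1 equidistant points, so it can be read along any
    curve that is affine at these times. *)
Lemma DL_affine (X : zmodType) (Phi : X -> R) (gam : R -> X) m (T tau : R) (p w : X) :
  (forall j, (j <= m)%N -> gam (T + tau *+ j) = p + w *+ j) ->
  DL (nseq m tau) (Phi \o gam) T = DL (nseq m w) Phi p.
Proof.
elim: m T p => [|m IH] T p H /=; first by have := H 0%N isT; rewrite !addr0 => ->.
congr (_ - _).
  by apply: IH => j jm; have := H j.+1 jm; rewrite !mulrS !addrA.
by apply: IH => j jm; apply: H; rewrite leqW.
Qed.

End RealDifferences.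

Section FastSequences.
Variable R : realType.

(** The exponent n^2 makes this smaller than every power of 2^-n, as [rapid] demands. *)
Definition fast (n : nat) : R := dy R (n * n).

Lemma fast_gt0 n : 0 < fast n. Proof. exact: dy_gt0. Qed.

Lemma rapid_le (a : nat -> R) (C : R) :
  (\forall n \near \oo, `|a n| <= C * fast n) -> rapid a.
Proof.
move=> aC m; near=> n.
have an : `|a n| <= C * fast n by near: n.
have nm : (m.+1 <= n)%N by near: n; apply/near_natP; exists m.+1.
have Cn : dy R n < (`|C| + 1)^-1.
  by near: n; apply: dy_small; rewrite invr_gt0 ltr_wpDl.
have fn : fast n <= dy R n ^+ m * dy R n.
  by rewrite -exprSr /dy -exprM; apply: dy_le; rewrite leq_mul2l nm orbT.
rewrite (le_trans an)// (@le_trans _ _ (`|C| * (dy R n ^+ m * dy R n)))//.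
  rewrite (@le_trans _ _ (`|C| * fast n))// ?ler_wpM2l// ler_wpM2r ?ler_norm//.
  by rewrite ltW// fast_gt0.
rewrite mulrCA ler_piMr ?exprn_ge0 ?dy_ge0//.
apply: (@le_trans _ _ ((`|C| + 1) * (`|C| + 1)^-1)); last first.
  by rewrite divff// gt_eqF// ltr_wpDl.
by rewrite ler_pM ?dy_ge0 ?lerDl// ltW.
Unshelve. all: end_near. Qed.

Lemma fast_small (e : R) : 0 < e -> \forall n \near \oo, fast n < e.
Proof.
move=> e0; near=> n; have n0 : (0 < n)%N by near: n; apply/near_natP; exists 1%N.
apply: (@le_lt_trans _ _ (dy R n)); last by near: n; exact: dy_small.
by apply: dy_le; rewrite leq_pmulr.
Unshelve. all: end_near. Qed.

Section Curves.
Variables (X : lmodType R) (E0 : set (X -> R)).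
Hypothesis E0lin : forall l, E0 l -> scalar l.

Lemma interp_curve (p0 : X) (a v : nat -> X) :
  (forall l, E0 l -> rapid (l \o a)) -> (forall l, E0 l -> rapid (l \o v)) ->
  smooth_curve E0 (fun t => p0 + interp a v t).
Proof.
move=> ra rv l El; have ll := E0lin El.
have -> : l \o (fun t => p0 + interp a v t) =
  (fun t => l p0 + interp (l \o a : nat -> R^o) (l \o v) t).
  by apply/funext => t /=; rewrite (scalar_fD ll) (interp_linear _ _ _ ll).
refine (smoothD (smooth_cst _) _).
by apply: interp_smooth; [exact: ra|exact: rv].
Qed.

(** The domain [Good] and the function [Phi] stay abstract because the curve lemma is applied in
    several spaces: in X itself, in the plane for the tube lemma, and in R^3 for the difference
    quotient. *)
Variables (k : nat) (Good : X -> Prop) (Phi : X -> R).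
Hypothesis tested : forall c, smooth_curve E0 c -> Good (c 0) ->
  (\forall t \near (0 : R), Good (c t)) /\ LK k (Phi \o c) 0.

(* All the points [p n] and the segments from them in the direction [v n] lie on
   one smooth curve, traversed with speed [fast n] near [p n]. *)
Lemma fast_difference_bound (p0 : X) (p v : nat -> X) (h : nat -> R) : Good p0 ->
  (forall l, E0 l -> exists C : R, \forall n \near \oo, `|l (p n - p0)| <= C * fast n) ->
  (forall l, E0 l -> exists C : R, \forall n \near \oo, `|l (v n)| <= C) ->
  (forall n, 0 < h n <= fast n ^+ 2) ->
  exists C : R, \forall n \near \oo, Good (p n) /\
    `|DL (nseq k.+1 (h n *: v n)) Phi (p n)| <= C * (h n / fast n) ^+ k.+1.
Proof.
move=> Gp0 hp hv hh.
pose a n := p n - p0; pose w n := fast n *: v n.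
pose c t := p0 + interp a w t.
have sc : smooth_curve E0 c.
  apply: interp_curve => l El.
    by have [C HC] := hp l El; exact: rapid_le HC.
  have [C HC] := hv l El; apply: (@rapid_le _ C); apply: filterS HC => n.
  rewrite /= (scalar_fZ (E0lin El)) normrM gtr0_norm ?fast_gt0// mulrC => H.
  by rewrite ler_wpM2r// ltW// fast_gt0.
have c0 : c 0 = p0 by rewrite /c /interp ltxx addr0.
have [] := tested sc; first by rewrite c0.
move=> /nearR[d d0 Hd] /LK_LocM[C [e e0 HC]].
have cE n t : dy R n <= t -> t < 4 / 3 * dy R n ->
    c t = p n + (t - dy R n) *: (fast n *: v n).
  by move=> nt tn; rewrite /c (interp_piece _ _ nt tn) /piece /a addrA (addrC p0) subrK.
exists C; near=> n.
have fn0 := fast_gt0 n; have dn0 := dy_gt0 R n.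
have [hn0 hn] : 0 < h n /\ h n <= fast n ^+ 2 by have /andP[] := hh n.
(* In curve time a step lasts [h n / fast n], at most [fast n] because [h n] is at most its square.
   So all k+1 steps fit into the affine piece, whose length is 2^-n / 3. *)
have fk : k.+2%:R * fast n <= dy R n / 4.
  have fd : fast n <= dy R n * dy R n.
    rewrite -expr2 /dy -exprM; apply: dy_le; rewrite leq_mul2l.
    by apply/orP; right; near: n; apply/near_natP; exists 2%N.
  have dk : dy R n < (4 * k.+2%:R)^-1.
    by near: n; apply: dy_small; rewrite invr_gt0 mulr_gt0.
  rewrite (le_trans (ler_wpM2l _ fd))// mulrCA ler_wpM2l ?dy_ge0// ltW//.
  apply: (@lt_le_trans _ _ (k.+2%:R * (4 * k.+2%:R)^-1)); first by rewrite ltr_pM2l.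
  by rewrite invfM mulrCA divff ?mulr1// pnatr_eq0.
have hf : h n / fast n <= fast n by rewrite ler_pdivrMr// -expr2.
have f4 : fast n <= dy R n / 4.
  by rewrite (le_trans _ fk)// ler_peMl ?ler1n// ltW.
have dnd : dy R n < d by near: n; exact: dy_small.
have dne : dy R n < e by near: n; exact: dy_small.
split.
  have := Hd (dy R n); rewrite subr0 ger0_norm ?ltW// => /(_ dnd).
  rewrite (cE n) ?subrr ?scale0r ?addr0//; lra.
have -> : DL (nseq k.+1 (h n *: v n)) Phi (p n) =
    DL (nseq k.+1 (h n / fast n)) (Phi \o c) (dy R n).
  apply/esym/DL_affine => j jk.
  have jh : (h n / fast n) *+ j <= dy R n / 4.
    rewrite -mulr_natl (le_trans _ fk)// ler_pM// ?divr_ge0 ?ltW//.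
    by rewrite ltr_nat.
  have jh0 : 0 <= (h n / fast n) *+ j by rewrite mulrn_wge0// divr_ge0// ltW.
  rewrite (cE n); [|lra|lra].
  by rewrite (addrC (dy R n)) addrK scalerA mulrnAl divfK ?gt_eqF// scalerMnl.
have -> : (h n / fast n) ^+ k.+1 = \prod_(b <- nseq k.+1 (h n / fast n)) `|b|.
  by rewrite big_nseq ger0_norm ?divr_ge0 ?ltW// iter_mulr_1.
apply: HC.
- by rewrite size_nseq.
- move=> b /nseqP[-> _]; rewrite ger0_norm ?divr_ge0 ?(ltW hn0) ?(ltW fn0)//; lra.
- by rewrite subr0 ger0_norm ?dy_ge0.
Unshelve. all: end_near. Qed.

(** The form for proofs by contradiction. Of the k+2 factors 1 / [fast n], k+1 account for the speed
    along the curve, and the last one eventually exceeds the unknown constant C. *)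
Lemma fast_difference_contra (p0 : X) (p v : nat -> X) (h : nat -> R) : Good p0 ->
  (forall l, E0 l -> exists C : R, \forall n \near \oo, `|l (p n - p0)| <= C * fast n) ->
  (forall l, E0 l -> exists C : R, \forall n \near \oo, `|l (v n)| <= C) ->
  (forall n, 0 < h n <= fast n ^+ 2) ->
  (forall n, ~ (Good (p n) /\ `|DL (nseq k.+1 (h n *: v n)) Phi (p n)| <=
    (fast n)^-1 ^+ k.+2 * h n ^+ k.+1)) -> False.
Proof.
move=> Gp0 hp hv hh bad.
have [C HC] := fast_difference_bound Gp0 hp hv hh.
have : \forall n \near \oo, False.
  near=> n.
  have [Gpn bd] : Good (p n) /\
    `|DL (nseq k.+1 (h n *: v n)) Phi (p n)| <= C * (h n / fast n) ^+ k.+1 by near: n.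
  have fn0 := fast_gt0 n; have [hn0 _] : 0 < h n /\ h n <= fast n ^+ 2.
    by have /andP[] := hh n.
  apply: (bad n); split=> //; rewrite (le_trans bd)// exprMn mulrCA.
  rewrite [leRHS]mulrC [_^-1 ^+ k.+2]exprS ler_wpM2l ?exprn_ge0 ?(ltW hn0)// ler_wpM2r//.
    by rewrite exprn_ge0// invr_ge0 ltW.
  rewrite (le_trans (ler_norm _))// (@le_trans _ _ (`|C| + 1)) ?lerDl//.
  rewrite -[leLHS]invrK lef_pV2 ?posrE ?invr_gt0 ?ltr_wpDl// ltW//.
  by near: n; apply: fast_small; rewrite invr_gt0 ltr_wpDl.
by move=> /near_natP[N /(_ N (leqnn N))].
Unshelve. all: end_near. Qed.

End Curves.
End FastSequences.

(** * Convenient spaces and their topologies *)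

Section WeakDerivative.
Variable R : realType.

Lemma LK1_quotient (f : R -> R) (t0 : R) : LK 1 f t0 -> exists2 C : R, 0 <= C &
  exists2 d : R, 0 < d & forall s, s != 0 -> `|s| < d ->
    `|s^-1 * (f (t0 + s) - f t0) - derive1 f t0| <= C * `|s|.
Proof.
move=> f1; have /nearR[e e0 He] := LK_is_derive f1.
have [C C0 [d d0 HC]] := LK0_ge0 f1.2.
exists C => //; exists (Num.min d e); first by rewrite lt_min d0.
move=> s s0; rewrite lt_min => /andP[sd se].
have mv (u v : R) : u <= v -> (forall q, q \in `[u, v] -> `|q - t0| <= `|s|) ->
    `|f v - f u - derive1 f t0 * (v - u)| <= C * `|s| * `|v - u|.
  move=> uv H.
  have [c cI ->] : exists2 c, c \in `[u, v] & f v - f u = derive1 f c * (v - u).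
    apply: MVT_segment => //.
      move=> x xI; apply: He.
      by rewrite (le_lt_trans _ se)// H// subset_itv_oo_cc.
    apply: derivable_within_continuous => x xI.
    by have [] := He x (le_lt_trans (H x xI) se).
  rewrite -mulrBl normrM ler_wpM2r// (le_trans (HC _ _ _ _))//.
  - by rewrite (le_lt_trans (H _ cI)).
  - by rewrite subrr normr0.
  - by rewrite ler_wpM2l// H.
have -> : s^-1 * (f (t0 + s) - f t0) - derive1 f t0 =
    s^-1 * (f (t0 + s) - f t0 - derive1 f t0 * s) by field.
rewrite normrM normfV mulrC ler_pdivrMr ?normr_gt0//.
have [s1|s1] := leP 0 s.
  have := mv t0 (t0 + s); rewrite lerDl (_ : t0 + s - t0 = s); last by ring.
  apply=> // q; rewrite in_itv/= => /andP[q1 q2].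
  by rewrite !ger0_norm// ?subr_ge0// lerBlDl.
have := mv (t0 + s) t0; rewrite gerDl (_ : t0 - (t0 + s) = - s); last by ring.
rewrite normrN => H; rewrite -normrN.
have -> : - (f (t0 + s) - f t0 - derive1 f t0 * s) =
  f t0 - f (t0 + s) - derive1 f t0 * - s by ring.
apply: H; first exact: ltW.
move=> q; rewrite in_itv/= => /andP[q1 q2].
by rewrite ler0_norm ?subr_le0// ltr0_norm//; lra.
Qed.

Lemma derive1_left0 (f : R -> R) : derivable f 0 1 -> (forall t, t <= 0 -> f t = 0) ->
  derive1 f 0 = 0.
Proof.
move=> /derivableP df f0; rewrite derive1E.
move/is_deriveP: df => H.
apply/eqP; rewrite -normr_eq0 eq_le normr_ge0 andbT.
apply/ler_addgt0Pl => e e0; rewrite addr0; have [r r0 Hr] := H e e0.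
have := Hr (- (r / 2)); rewrite oppr_eq0 gt_eqF ?divr_gt0// => /(_ isT).
rewrite normrN gtr0_norm ?divr_gt0// => /(_ _).
rewrite add0r !f0// ?subrr ?mulr0 ?sub0r ?normrN; first by apply; lra.
by rewrite oppr_le0 divr_ge0// ltW.
Qed.

(* The difference quotients x n of c along a fast null sequence converge weakly.
   The odd smooth curve g equals t *: x n for t = 2^-n, so its derivative at 0 is
   the weak limit, which is in Y by convenience. *)
Lemma weak_derivative (Y : lmodType R) (F : set (Y -> R)) (c : R -> Y) (t0 : R) :
  ConFKd F -> (forall l, F l -> LK 1 (l \o c) t0) ->
  exists y, forall l, F l -> l y = derive1 (l \o c) t0.
Proof.
move=> [[_ Flin _ _] _ Fc] c1.
pose x n := (fast R n)^-1 *: (c (t0 + fast R n) - c t0).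
pose a n := dy R n *: x n.
pose g t := interp a x t - interp a x (- t).
pose L (l : Y -> R) := derive1 (l \o c) t0.
pose u l n := l (x n) - L l.
pose D l : R -> R := fun t => interp ((fun n => dy R n * u l n) : nat -> R^o) (u l) t.
have ru l : F l -> rapid (u l).
  move=> Fl; have [C C0 [d d0 HC]] := LK1_quotient (c1 l Fl).
  apply: (@rapid_le _ _ C); near=> n.
  have fn0 := fast_gt0 R n.
  rewrite /u /x (scalar_fZ (Flin _ Fl)) (scalar_fB (Flin _ Fl)).
  rewrite -[X in _ <= C * X]gtr0_norm//; apply: HC; first by rewrite gt_eqF.
  by rewrite gtr0_norm//; near: n; exact: fast_small.
have sD l : F l -> smooth (D l).
  move=> Fl; apply: interp_smooth; last exact: ru.
  move=> m; have := ru l Fl m; apply: filterS => n; apply: le_trans.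
  by rewrite normrM ger0_norm ?dy_ge0// ler_piMl// dy_le1.
have D0 l t : t <= 0 -> D l t = 0 by move=> t0'; rewrite /D /interp ltNge t0'.
have gE l : F l -> l \o g = (fun t => t * L l + (D l t - D l (- t))).
  move=> Fl; have ll := Flin _ Fl; apply/funext => t /=.
  rewrite /g (scalar_fB ll) !(interp_linear _ _ _ ll) /D.
  (* Replacing every l (x n) by its limit L l, the interpolation is exactly s L l for s > 0. The
     rest interpolates the rapidly decreasing errors [u l]. *)
  have E s : interp (l \o a : nat -> R^o) (l \o x) s = (if 0 < s then s * L l else 0) +
      interp ((fun n => dy R n * u l n) : nat -> R^o) (u l) s.
    rewrite /interp; case: ifP => _; last by rewrite addr0.
    have la n : l (a n) = dy R n * l (x n) by rewrite /a (scalar_fZ ll).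
    by rewrite /blend /piece /= !la /u -![_ *: _]/(_ * _); ring.
  by rewrite !E oppr_gt0; have [t1|t1|->] := ltrgtP t 0; ring.
have sg : smooth_curve F g.
  move=> l Fl; rewrite gE//.
  refine (smoothD (smoothM smooth_id (smooth_cst _)) (smoothB (sD _ Fl) _)).
  exact: (smooth_comp (sD _ Fl) (smoothN smooth_id)).
have [c' Hc'] := Fc _ sg; exists (c' 0) => l Fl.
have := Hc' l Fl; move/(congr1 (fun h => h 0)) => /= ->.
have dD : is_derive (0 : R) 1 (D l) 0.
  have dd : derivable (D l) (0 : R) 1 by have := sD l Fl 0%N 0.
  rewrite -[X in is_derive _ _ _ X](derive1_left0 dd (D0 l)) derive1E.
  exact: derivableP.
have dN : is_derive (0 : R) 1 (fun t : R => D l (- t)) 0.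
  have := @is_derive1_comp _ (D l) -%R 0 0 (-1); rewrite oppr0 mul0r; apply=> //.
have dg : is_derive (0 : R) 1 (fun t => t * L l + (D l t - D l (- t))) (L l).
  apply: (is_derive_eq (is_deriveD (is_deriveM (is_derive_id _ _)
    (is_derive_cst (L l) _ _)) (is_deriveB dD dN))).
  by rewrite subr0 addr0 scaler0 add0r -[_ *: _]/(_ * _) mulr1.
by rewrite gE// derive1E derive_val.
Unshelve. all: end_near. Qed.

End WeakDerivative.

Section Spaces.
Variable R : realType.

Section OneSpace.
Variables (X : lmodType R) (E : set (X -> R)).

Lemma delta_tau : ConFKd E -> delta (tau E) = E.
Proof.
move=> [[_ Elin _ _] Ec _]; apply/seteqP; split=> [|l El]; first exact: Ec.
split; first exact: Elin.
move=> V oV c sc; rewrite -[X in open X]/((l \o c) @^-1` V).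
by move: V oV; apply/continuousP/smooth_continuous/sc.
Qed.

Lemma DVS0 : DVS E -> E (fun=> 0).
Proof.
move=> [[l El] _ Ecl _]; have := Ecl 0 0 l l El El.
by congr (E _); apply/funext => x; rewrite !mul0r addr0.
Qed.

Lemma DVS_scalar l : DVS E -> E l -> scalar l.
Proof. by move=> [_ Elin _ _]; exact: Elin. Qed.

Lemma smooth_curve_cst (x : X) : smooth_curve E (fun=> x).
Proof. by move=> l _; exact: (smooth_cst (l x)). Qed.

Lemma smooth_curve_comp (c : R -> X) (h : R -> R) :
  smooth_curve E c -> smooth h -> smooth_curve E (fun t => c (h t)).
Proof. by move=> sc sh l El; exact: (smooth_comp (sc l El) sh). Qed.

Lemma smooth_curveDZ (c d : R -> X) (h : R -> R) : DVS E ->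
  smooth_curve E c -> smooth_curve E d -> smooth h ->
  smooth_curve E (fun t => c t + h t *: d t).
Proof.
move=> EV sc sd sh l El; have ll := DVS_scalar EV El.
have -> : l \o (fun t => c t + h t *: d t) = (fun t => (l \o c) t + h t * (l \o d) t).
  by apply/funext => t /=; rewrite (scalar_fD ll) (scalar_fZ ll).
exact: (smoothD (sc l El) (smoothM sh (sd l El))).
Qed.

Lemma tau_near (U : set X) (c : R -> X) (t0 : R) : tau E U -> smooth_curve E c ->
  U (c t0) -> \forall t \near t0, U (c t).
Proof. by move=> EU sc Uc; exact: ((open_near _).1 (EU _ sc)). Qed.

(* A partial curve is extended by 0 outside of its domain. *)
Definition vext (c : pfun R X) (t : R) : X := odflt 0 (c t).

Lemma some_vext (c : pfun R X) t : pdom c t -> c t = Some (vext c t).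
Proof. by move=> /pdomP[x cx]; rewrite /vext cx. Qed.

Lemma pdom_pfun_of (l : X -> R) (c : pfun R X) : pdom (pcomp (pfun_of l) c) = pdom c.
Proof. by apply/funext => t; rewrite /pdom /pcomp /=; case: (c t). Qed.

Lemma pext_pfun_of (l : X -> R) (c : pfun R X) t : pdom c t ->
  pext (pcomp (pfun_of l) c) t = l (vext c t).
Proof. by move=> /some_vext ct; rewrite /pext /pcomp ct. Qed.

Lemma LipkE_LK k (c : pfun R X) : E !=set0 -> LipkE (Some k) E c <->
  open (pdom c) /\ forall l, E l -> forall t, pdom c t -> LK k (l \o vext c) t.
Proof.
move=> [l0 El0].
have nearE l t : open (pdom c) -> pdom c t ->
    \forall s \near t, pext (pcomp (pfun_of l) c) s = (l \o vext c) s.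
  move=> oc ct; apply: filterS ((open_near _).1 oc _ ct) => s.
  exact: pext_pfun_of.
split=> [H|[oc H] l El].
  have oc : open (pdom c) by have /Lipk_LK[] := H l0 El0; rewrite pdom_pfun_of.
  split=> // l El t ct; have /Lipk_LK[_] := H l El; rewrite pdom_pfun_of.
  by move=> /(_ t ct); apply: LK_near; exact: nearE.
apply/Lipk_LK; rewrite pdom_pfun_of; split=> // t ct.
have := H l El t ct; apply: LK_near; apply: filterS (nearE l t oc ct) => s.
by move=> ->.
Qed.

Lemma smooth_LipkE k (c : R -> X) : smooth_curve E c -> LipkE k E (pfun_of c).
Proof.
move=> sc l El.
have H n : Lipk (Some n) (pcomp (pfun_of l) (pfun_of c)).
  apply/Lipk_LK; rewrite pdom_pfun_of; split=> [|t _].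
    by rewrite (_ : pdom _ = setT); [exact: openT|apply/seteqP; split].
  exact: ((smoothP _).1 (sc l El)).
by case: k => [n|]; [exact: H|apply/LipkN].
Qed.

End OneSpace.

Section Products.
Variables (X Y : lmodType R) (E : set (X -> R)) (F : set (Y -> R)).

Lemma prodd_scalar l : DVS E -> DVS F -> prodd E F l -> scalar l.
Proof.
move=> EV FV [l1 [l2 [El1 Fl2 ->]]] a u v /=.
have L1 := DVS_scalar EV El1; have L2 := DVS_scalar FV Fl2.
by rewrite (scalar_fD L1) (scalar_fD L2) (scalar_fZ L1) (scalar_fZ L2) mulrDr addrACA.
Qed.

Lemma prodd_fst l : DVS F -> E l -> prodd E F (fun p => l p.1).
Proof.
move=> FV El; exists l, (fun=> 0); split=> //; first exact: DVS0.
by apply/funext => p; rewrite addr0.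
Qed.

Lemma prodd_snd l : DVS E -> F l -> prodd E F (fun p => l p.2).
Proof.
move=> EV Fl; exists (fun=> 0), l; split=> //; first exact: DVS0.
by apply/funext => p; rewrite add0r.
Qed.

Lemma smooth_curve_prodd (c : R -> X * Y) : DVS E -> DVS F ->
  smooth_curve (prodd E F) c <->
  smooth_curve E (fun t => (c t).1) /\ smooth_curve F (fun t => (c t).2).
Proof.
move=> EV FV; split=> [sc|[s1 s2] l [l1 [l2 [El1 Fl2 ->]]]].
  by split=> l ?; [exact: (sc _ (prodd_fst FV _))|exact: (sc _ (prodd_snd EV _))].
exact: (smoothD (s1 _ El1) (s2 _ Fl2)).
Qed.

Lemma DVS_prodd : DVS E -> DVS F -> DVS (prodd E F).
Proof.
move=> EV FV; split.
- by exists (fun p => 0 + 0); exists (fun=> 0), (fun=> 0); split=> //; exact: DVS0.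
- by move=> l; exact: prodd_scalar.
- move=> a b l m [l1 [l2 [El1 Fl2 ->]]] [m1 [m2 [Em1 Fm2 ->]]].
  exists (fun x => a * l1 x + b * m1 x), (fun y => a * l2 y + b * m2 y).
  split; first by case: EV => _ _ + _; exact.
    by case: FV => _ _ + _; exact.
  by apply/funext => p; rewrite !mulrDr addrACA.
move=> [x y] [x' y'] xy; have [xx|xx] := EM (x = x').
  case: (FV) => _ _ _ /(_ y y')[yy|l Fl lyy]; first by apply: xy; rewrite xx yy.
  by exists (fun p => l p.2) => //; exact: prodd_snd.
case: (EV) => _ _ _ /(_ x x' xx)[l El lxx].
by exists (fun p => l p.1) => //; exact: prodd_fst.
Qed.

(** A linear functional on the product is the sum of its restrictions to the two factors, and these
    stay continuous because x -> (x, 0) and y -> (0, y) preserve smooth curves. *)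
Lemma ConFKd_prodd : ConFKd E -> ConFKd F -> ConFKd (prodd E F).
Proof.
move=> [EV Ec Es] [FV Fc Fs]; split; first exact: DVS_prodd.
  move=> l [ll lc]; exists (fun x => l (x, 0)), (fun y => l (0, y)); split.
  - apply: Ec; split.
      move=> a u v; rewrite -ll; congr l; congr pair => /=.
      by rewrite scaler0 addr0.
    move=> V /lc H c sc; apply: (H (fun t => (c t, 0))).
    by apply/smooth_curve_prodd => //; split=> //; exact: smooth_curve_cst.
  - apply: Fc; split.
      move=> a u v; rewrite -ll; congr l; congr pair => /=.
      by rewrite scaler0 addr0.
    move=> V /lc H c sc; apply: (H (fun t => (0, c t))).
    by apply/smooth_curve_prodd => //; split=> //; exact: smooth_curve_cst.
  apply/funext => -[x y] /=; rewrite -(scalar_fD ll); congr l; congr pair => /=.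
    by rewrite addr0.
  by rewrite add0r.
move=> c /(smooth_curve_prodd _ EV FV)[s1 s2].
have [c1 H1] := Es _ s1; have [c2 H2] := Fs _ s2.
exists (fun t => (c1 t, c2 t)) => l [l1 [l2 [El1 Fl2 ->]]].
apply/funext => t /=.
have := H1 _ El1; move/(congr1 (fun h => h t)) => /= ->.
have := H2 _ Fl2; move/(congr1 (fun h => h t)) => /= ->.
have d1 : derivable (l1 \o (fun t => (c t).1)) t 1 by have := s1 _ El1 0%N t.
have d2 : derivable (l2 \o (fun t => (c t).2)) t 1 by have := s2 _ Fl2 0%N t.
by rewrite !derive1E -deriveD.
Qed.

End Products.

Definition Rd : set (R^o -> R) := [set l | exists a, l = fun x => a * x].

Lemma DVS_Rd : DVS Rd.
Proof.
split.
- by exists (fun x => 0 * x); exists 0.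
- by move=> _ [a ->] b u v; rewrite mulrDr mulrCA.
- move=> a b _ _ [c ->] [d ->]; exists (a * c + b * d).
  by apply/funext => x; rewrite mulrDl !mulrA.
- by move=> x y xy; exists (fun x => 1 * x); [exists 1|rewrite !mul1r].
Qed.

Lemma smooth_curve_Rd (c : R -> R^o) : smooth_curve Rd c <-> smooth c.
Proof.
split=> [sc|sc _ [a ->]]; last exact: (smoothM (smooth_cst a) sc).
have := sc (fun x => 1 * x); rewrite (_ : _ \o c = c).
  by apply; exists 1.
by apply/funext => t /=; rewrite mul1r.
Qed.

Lemma ConFKd_Rd : ConFKd Rd.
Proof.
split; first exact: DVS_Rd.
  move=> l [ll _]; exists (l 1); apply/funext => x.
  by rewrite mulrC -(scalar_fZ ll) -[x *: _]/(x * 1) mulr1.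
move=> c /smooth_curve_Rd sc; exists (derive1 c) => _ [a ->]; apply/funext => t /=.
have dc : derivable c t 1 by have := sc 0%N t.
rewrite !derive1E; have := deriveZ a dc; rewrite -[RHS]/(a * _) => <-; congr derive.
Qed.

End Spaces.
Arguments smooth_curve_cst {R X} E x.

Section Uniform.
Variable R : realType.

(** Compactness of the segment. One number d is both the radius of the neighbourhood and the
    parameter of P; monotonicity in d allows passing to a common smaller value. *)
Lemma segment_uniform (P : R -> R -> Prop) (a b : R) :
  (forall t d d', 0 < d' -> d' <= d -> P t d -> P t d') ->
  (forall t, a <= t <= b -> exists2 d : R, 0 < d & forall t', `|t' - t| < d -> P t' d) ->
  exists2 d : R, 0 < d & forall t, a <= t <= b -> P t d.
Proof.
move=> Pmon Ploc.
have /compact_near_coveringP := @segment_compact R a b.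
move=> /(_ R (0 : R)^'+ (fun d t => P t d) _) H.
have /H : forall x : R, `[a, b]%classic x -> \forall x' \near x & d \near 0^'+, P x' d.
  move=> x; rewrite /= in_itv => /Ploc[d0 d00 Hd0].
  exists ([set t' | `|t' - x| < d0], [set d | 0 < d <= d0]).
    split=> /=; first by apply/nearR; exists d0.
    near=> d; apply/andP; split; near: d; [exact: nbhs_right_gt|exact: nbhs_right_le].
  by move=> [t' d] /= [t'x /andP[dgt0 dd0]]; apply: (Pmon _ d0) => //; exact: Hd0.
move=> Hn; near (0 : R)^'+ => d.
exists d; first by near: d; exact: nbhs_right_gt.
by move=> t tab; apply: (near Hn d) => //=; rewrite in_itv.
Unshelve. all: end_near. Qed.

(* The tube lemma: J is a compact interval around [t0] with [{x0} x J] in W, and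
   the points x with [{x} x J] in W form an open set. *)
Lemma prodtop_tau (X : lmodType R) (G : set (X -> R)) : DVS G ->
  prodtop (tau G) (@real_top R) = tau (prodd G (@Rd R)).
Proof.
move=> GV; have RV := DVS_Rd R; apply/seteqP; split=> W.
  move=> WW c /(smooth_curve_prodd _ GV RV)[s1 /smooth_curve_Rd s2].
  apply/open_near => t /WW[U [V [GU oV Uc Vc UVW]]].
  have U1 := tau_near GU s1 Uc.
  have V1 : \forall s \near t, V (c s).2.
    by apply: smooth_continuous s2 _ _ _; exact: open_nbhs_nbhs.
  by apply: filterS2 U1 V1 => s Us Vs; apply: UVW.
move=> TW [x0 t0] /= Wp.
have Wc c d t : smooth_curve G c -> smooth d -> W (c t, d t) ->
    \forall s \near t, W (c s, d s).
  move=> sc sd Wcd; apply: ((open_near _).1 (TW (fun t => (c t, d t)) _)) => //.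
  by apply/smooth_curve_prodd => //; split=> //=; exact/smooth_curve_Rd.
have /nearR[e e0 He] := Wc _ _ t0 (smooth_curve_cst G x0) smooth_id Wp.
pose J (t : R) := t0 - e / 2 <= t <= t0 + e / 2.
have JE t : J t -> `|t - t0| < e.
  by move=> /andP[t1 t2]; rewrite ltr_norml; apply/andP; split; lra.
exists [set x | forall t, J t -> W (x, t)], [set t | `|t - t0| < e / 2]; split.
- move=> c sc; apply/open_near => s0 /= Ws0.
  apply/nearR.
  have := @segment_uniform (fun t d => forall s, `|s - s0| < d -> W (c s, t))
    (t0 - e / 2) (t0 + e / 2).
  case=> [t d d' d'0 d'd H s sd|t1 Jt1|d d0 Hd].
  + by apply: H; exact: lt_le_trans sd d'd.
  + apply: contrapT => noex.
    have /choice[q Hq] n : exists q : R^o * R^o,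
        [/\ `|q.1 - s0| < fast R n, `|q.2 - t1| < fast R n & ~ W (c q.1, q.2)].
      apply: contrapT => nex; apply: noex; exists (fast R n); first exact: fast_gt0.
      move=> t td s sd; apply: contrapT => nW; apply: nex.
      by exists (s, t).
    have Rlin l : prodd (@Rd R) (@Rd R) l -> scalar l by exact: prodd_scalar.
    (* The curve lemma is used in the plane for its claim about [Good], here the preimage of W under
       (s, t) -> (c s, t); the tested function is 0. *)
    apply: (@fast_difference_contra _ _ _ Rlin 0 (fun q => W (c q.1, q.2)) (fun=> 0)
       _ (s0, t1) q (fun=> 0) (fun n => fast R n ^+ 2)).
    * move=> g /(smooth_curve_prodd _ RV RV)[/smooth_curve_Rd s1 /smooth_curve_Rd s2] Wg.
      split; last exact: LK_cst.
      exact: (Wc (fun t => c (g t).1) (fun t => (g t).2) 0 (smooth_curve_comp sc s1) s2 Wg).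
    * exact: Ws0.
    * move=> _ [_ [_ [[a ->] [b ->] ->]]] /=; exists (`|a| + `|b|); near=> n.
      have [q1 q2 _] := Hq n.
      rewrite (le_trans (ler_normD _ _))// mulrDl !normrM lerD// ler_wpM2l// ltW//.
    * by move=> l pl; exists 0; near=> n; rewrite (scalar_f0 (Rlin _ pl)) normr0.
    * by move=> n; rewrite lexx exprn_gt0// fast_gt0.
    * by move=> n [Wn _]; have [] := Hq n.
  by exists d => // s sd t Jt; exact: (Hd t Jt s sd).
- apply/open_near => t /= td; near=> s => /=.
  near: s; apply/nearR; exists (e / 2 - `|t - t0|); first by rewrite subr_gt0.
  move=> s st; have -> : s - t0 = (s - t) + (t - t0) by ring.
  by rewrite (le_lt_trans (ler_normD _ _))// -ltrBrDr.
- by move=> t Jt; exact: He (JE t Jt).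
- by rewrite /= subrr normr0 divr_gt0.
move=> [x t] /= [Hx td]; apply: Hx.
by move: td; rewrite ltr_norml /J => /andP[t1 t2]; apply/andP; split; lra.
Unshelve. all: end_near. Qed.

Lemma bgn_top_tau (X : lmodType R) (E : set (X -> R)) : ConFKd E ->
  bgn_top (tau E) = tau (prodd (prodd E E) (@Rd R)).
Proof.
move=> EC; rewrite /bgn_top /proda delta_tau// prodtop_tau//.
by case: EC => EV _ _; exact: DVS_prodd.
Qed.

End Uniform.

(** * Maps tested on smooth curves *)

Section SmoothTest.
Variables (R : realType) (X Y : lmodType R).
Variables (E : set (X -> R)) (F : set (Y -> R)) (f : pfun X Y).

(* The a priori weaker condition through which both classes are compared. *)
Definition smooth_tested (k : nat) : Prop := [/\ ConFKd E, ConFKd F &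
  forall c : R -> X, smooth_curve E c -> LipkE (Some k) F (pcomp f (pfun_of c))].

Definition fext (x : X) : Y := odflt 0 (f x).

Lemma some_fext x : pdom f x -> f x = Some (fext x).
Proof. by move=> /pdomP[y fx]; rewrite /fext fx. Qed.

Lemma LipFKd_tested (k : nat) : LipFKd (Some k) E F f -> smooth_tested k.
Proof. by move=> [EC FC H]; split=> // c sc; apply: H; exact: smooth_LipkE. Qed.

Lemma LipFKdN_tested (k : nat) : LipFKd None E F f -> smooth_tested k.
Proof.
move=> [EC FC H]; split=> // c sc l Fl; have := H _ (smooth_LipkE None sc) l Fl.
by move=> /LipkN.
Qed.

Lemma tested_le j k : (j <= k)%N -> smooth_tested k -> smooth_tested j.
Proof.
move=> jk [EC FC H]; split=> // c sc.
have F0 : F !=set0 by case: FC => -[].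
have /(LipkE_LK _ _ F0)[oc Hc] := H c sc.
by apply/(LipkE_LK _ _ F0); split=> // l Fl t ct; exact: LK_le jk (Hc l Fl t ct).
Qed.

Lemma tested_curve k l (c : R -> X) (t0 : R) : smooth_tested k -> F l ->
  smooth_curve E c -> pdom f (c t0) ->
  (\forall t \near t0, pdom f (c t)) /\ LK k (fun t => l (fext (c t))) t0.
Proof.
move=> [EC FC H] Fl sc fc; have F0 : F !=set0 by case: FC => -[].
have /(LipkE_LK _ _ F0)[oc Hc] := H c sc.
split; first exact: ((open_near _).1 oc).
exact: (Hc l Fl t0 fc).
Qed.

Lemma tested_tau k : smooth_tested k -> tau E (pdom f).
Proof.
move=> [EC FC H] c sc; have F0 : F !=set0 by case: FC => -[].
by have /(LipkE_LK _ _ F0)[] := H c sc.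
Qed.

(** If f along a Lip^0 curve c fails to be Lipschitz near [t0], there are bad pairs s, t converging
    fast to [t0]. The points c s and the slopes of the chords to c t are weakly controlled because c
    is Lip^0, so one smooth curve contains the bad chords. *)
Lemma tested0_LipFKd : smooth_tested 0 -> LipFKd (Some 0%N) E F f.
Proof.
move=> H; have [EC FC _] := H; split=> // c Ec.
have EV : DVS E by case: EC. have FV : DVS F by case: FC.
have E0 : E !=set0 by case: EV. have F0 : F !=set0 by case: FV.
have Elin l : E l -> scalar l by exact: DVS_scalar.
have /(LipkE_LK _ _ E0)[oc Lc] := Ec.
pose ce := vext c.
have main l t0 : F l -> pdom (pcomp f c) t0 ->
    exists2 d : R, 0 < d & forall s t, `|s - t0| < d -> `|t - t0| < d ->
      pdom f (ce s) /\ `|l (fext (ce s)) - l (fext (ce t))| <= d^-1 * `|s - t|.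
  move=> Fl; rewrite /pdom /pcomp /=; case ct0 : (c t0) => [x0|//] fx0.
  have ce0 : ce t0 = x0 by rewrite /ce /vext ct0.
  have dt0 : pdom c t0 by rewrite /pdom /= ct0.
  apply: contrapT => nex.
  (* The choice of [q n] must not depend on the functional m, whose Lipschitz constant D and radius
     e vary with m. The estimates are therefore recorded for all m, D and e at once, valid as soon
     as r < e. *)
  have /choice[q Hq] n : exists q : (X * X) * R, [/\
      forall m, E m -> exists2 r : R, r < fast R n & forall D e : R, 0 <= D -> r < e ->
         (forall s t, `|s - t0| < e -> `|t - t0| < e -> `|m (ce s) - m (ce t)| <= D * `|s - t|)
         -> `|m (q.1.1 - x0)| <= D * fast R n /\ `|m q.1.2| <= D,
      0 < q.2 <= fast R n ^+ 2 &
      ~ (pdom f q.1.1 /\ `|DL (nseq 1 (q.2 *: q.1.2)) (fun x => l (fext x)) q.1.1| <=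
        (fast R n)^-1 ^+ 2 * q.2 ^+ 1)].
    have fn0 := fast_gt0 R n.
    pose d := fast R n ^+ 2 / 2.
    have d0 : 0 < d by rewrite divr_gt0// exprn_gt0.
    have fn1 : fast R n <= 1 by exact: dy_le1.
    have dfn : d < fast R n.
      by rewrite /d expr2 ltr_pdivrMr// ltr_pM2l//; lra.
    apply: contrapT => nex'; apply: nex; exists d => // s t sd td.
    apply: contrapT => bad; apply: nex'.
    have E1 (m : X -> R) (D e : R) : E m -> 0 <= D -> d < e ->
        (forall s t, `|s - t0| < e -> `|t - t0| < e -> `|m (ce s) - m (ce t)| <= D * `|s - t|) ->
        `|m (ce s - x0)| <= D * fast R n.
      move=> Em D0 de H'; rewrite (scalar_fB (Elin _ Em)) -ce0.
      rewrite (le_trans (H' _ _ _ _))//; first exact: lt_trans sd de.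
        by rewrite subrr normr0 (lt_trans d0).
      by rewrite ler_wpM2l// ltW// (lt_trans sd).
    have st2 : `|s - t| < fast R n ^+ 2.
      have -> : s - t = (s - t0) - (t - t0) by ring.
      by rewrite (le_lt_trans (ler_normB _ _))// (splitr (_ ^+ 2)) ltrD.
    (* For s = t the values cannot violate the bound, so c s must leave the domain of f; direction 0
       and any admissible step length record this. *)
    have [st|st] := eqVneq s t.
      exists ((ce s, 0), fast R n ^+ 2); split=> /=.
      - move=> m Em; exists d => // D e D0 de H'; split; first exact: E1 de H'.
        by rewrite (scalar_f0 (Elin _ Em)) normr0.
      - by rewrite lexx exprn_gt0.
      - move=> [ds _]; apply: bad; split=> //.
        by rewrite -st !subrr normr0 mulr0.
    have st0 : 0 < `|s - t| by rewrite normr_gt0 subr_eq0.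
    exists ((ce s, `|s - t|^-1 *: (ce t - ce s)), `|s - t|); split=> /=.
    - move=> m Em; exists d => // D e D0 de H'; split; first exact: E1 de H'.
      rewrite (scalar_fZ (Elin _ Em)) (scalar_fB (Elin _ Em)) normrM normfV normr_id (distrC (m (ce t))).
      rewrite mulrC ler_pdivrMr//; apply: H'; [exact: lt_trans sd de|exact: lt_trans td de].
    - by rewrite st0 ltW.
    - rewrite scalerA divff ?gt_eqF// scale1r (addrC (ce s)) subrK => -[ds H'].
      apply: bad; split=> //; rewrite distrC (le_trans H')// expr1 ler_wpM2r//.
      rewrite /d invfM invrK exprVn ler_peMr ?invr_ge0 ?exprn_ge0 ?(ltW fn0)//; lra.
  have aux m : E m -> exists2 D : R, 0 <= D & \forall n \near \oo,
       `|m ((q n).1.1 - x0)| <= D * fast R n /\ `|m (q n).1.2| <= D.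
    move=> Em; have /LK0_ge0[D D0 [e e0 HD]] := Lc m Em t0 dt0.
    exists D => //; near=> n; have [/(_ m Em)[r rn Hr] _ _] := Hq n.
    apply: (Hr D e) => //; apply: (lt_trans rn); near: n; exact: fast_small.
  apply: (@fast_difference_contra _ _ E Elin 0 (pdom f) (fun x => l (fext x)) _ x0
    (fun n => (q n).1.1) (fun n => (q n).1.2) (fun n => (q n).2)).
  - by move=> g sg fg; exact: tested_curve.
  - exact: fx0.
  - by move=> m /aux[D D0 HD]; exists D; apply: filterS HD => n [].
  - by move=> m /aux[D D0 HD]; exists D; apply: filterS HD => n [].
  - by move=> n; have [] := Hq n.
  - by move=> n; have [] := Hq n.
apply/(LipkE_LK _ _ F0).
have domE t : pdom c t -> pdom (pcomp f c) t = pdom f (ce t).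
  by move=> /some_vext ct; rewrite /pdom /pcomp /= ct.
have subd t : pdom (pcomp f c) t -> pdom c t by rewrite /pdom /pcomp /=; case: (c t).
have extE t : pdom c t -> vext (pcomp f c) t = fext (ce t).
  by move=> /some_vext ct; rewrite /vext /pcomp ct.
have [l0 Fl0] := F0; split.
  apply/open_near => t0 dt0; have [d d0 Hd] := main l0 t0 Fl0 dt0.
  have df : \forall t \near t0, pdom f (ce t).
    by apply/nearR; exists d => // t td; have [] := Hd t t td td.
  by apply: filterS2 ((open_near _).1 oc _ (subd _ dt0)) df => s cs; rewrite domE.
move=> l Fl t0 dt0; have [d d0 Hd] := main l t0 Fl dt0.
have : LK 0 (fun t => l (fext (ce t))) t0.
  by exists d^-1, d => // s t sd td; have [] := Hd s t sd td.
apply: LK_near; apply: filterS ((open_near _).1 oc _ (subd _ dt0)) => s cs /=.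
by rewrite extE.
Unshelve. all: end_near. Qed.

End SmoothTest.

(** * Difference quotients of Lip^1 functions of one variable *)

Section DifferenceQuotient.
Variable R : realType.

Lemma mvt_increment (f : R -> R) (t s : R) :
  (forall q : R, `|q - t| <= `|s| -> is_derive q 1 f (derive1 f q)) ->
  exists x, [/\ `|x - t| <= `|s|, `|x - (t + s)| <= `|s| &
    f (t + s) - f t = derive1 f x * s].
Proof.
move=> H; have [s0|s0] := leP 0 s.
  have I x : x \in `[t, t + s] -> `|x - t| <= `|s| /\ `|x - (t + s)| <= `|s|.
    rewrite in_itv/= (ger0_norm s0) => /andP[x1 x2]; split.
      by rewrite ger0_norm; lra.
    by rewrite ler0_norm; lra.
  have [x xI E] : exists2 x, x \in `[t, t + s] &
      f (t + s) - f t = derive1 f x * (t + s - t).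
    apply: MVT_segment; first by rewrite lerDl.
      by move=> x xI; apply: H; have [] := I x (subset_itv_oo_cc xI).
    by apply: derivable_within_continuous => x xI; have [] := H x (I x xI).1.
  by exists x; have [? ?] := I x xI; split=> //; rewrite E; congr (_ * _); ring.
have I x : x \in `[t + s, t] -> `|x - t| <= `|s| /\ `|x - (t + s)| <= `|s|.
  rewrite in_itv/= (ltr0_norm s0) => /andP[x1 x2]; split.
    by rewrite ler0_norm; lra.
  by rewrite ger0_norm; lra.
have [x xI E] : exists2 x, x \in `[t + s, t] &
    f t - f (t + s) = derive1 f x * (t - (t + s)).
  apply: MVT_segment; first by rewrite gerDl ltW.
    by move=> x xI; apply: H; have [] := I x (subset_itv_oo_cc xI).
  by apply: derivable_within_continuous => x xI; have [] := H x (I x xI).1.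
exists x; have [? ?] := I x xI; split=> //.
by apply: oppr_inj; rewrite opprB E; ring.
Qed.

(** Off 0 the quotient q has derivative (f' (t + s) - q s) / s, bounded because q s is a value of f'
    within distance |s| of t + s. Points on opposite sides of 0 are compared through q 0. *)
Lemma LK0_quotient (f : R -> R) (t : R) : LK 1 f t ->
  LK 0 (fun s : R => if s == 0 then derive1 f t else s^-1 * (f (t + s) - f t)) 0.
Proof.
move=> f1; set q : R -> R := fun s => _.
have /nearR[e e0 He] := LK_is_derive f1.
have [C C0 [d d0 HC]] := LK0_ge0 f1.2.
pose r := Num.min d e; have r0 : 0 < r by rewrite lt_min d0.
have rd (s : R) : `|s| < r -> `|s| < d by rewrite lt_min => /andP[].
have re (s : R) : `|s| < r -> `|s| < e by rewrite lt_min => /andP[].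
have q0 : q 0 = derive1 f t by rewrite /q eqxx.
have qE (s : R) : s != 0 -> q s = s^-1 * (f (t + s) - f t) by rewrite /q => /negPf ->.
have mv (s : R) : s != 0 -> `|s| < r -> `|q s - derive1 f t| <= C * `|s| /\
    `|derive1 f (t + s) - q s| <= C * `|s|.
  move=> s0 sr.
  have [|x [xt xts E]] := @mvt_increment f t s.
    by move=> z zt; apply: He; rewrite (le_lt_trans zt)// re.
  have -> : q s = derive1 f x by rewrite qE// E; field.
  have xd : `|x - t| < d by rewrite (le_lt_trans xt)// rd.
  have td : `|t - t| < d by rewrite subrr normr0.
  have tsd : `|t + s - t| < d by rewrite (_ : t + s - t = s); [exact: rd|ring].
  split; first by rewrite (le_trans (HC _ _ xd td))// ler_wpM2l.
  by rewrite (le_trans (HC _ _ tsd xd))// ler_wpM2l// distrC.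
have dq (s : R) : s != 0 -> `|s| < r -> is_derive s 1 q (s^-1 * (derive1 f (t + s) - q s)).
  move=> s0 sr.
  have fs : is_derive (t + s) 1 f (derive1 f (t + s)).
    by apply: He; rewrite (_ : t + s - t = s); [exact: re|ring].
  have ds : is_derive s 1 (fun s => t + s) (1 : R).
    have := is_derive_affine t 1 s; congr is_derive.
    by apply/funext => z; rewrite mul1r.
  have dfs := @is_derive1_comp _ f (fun s => t + s) s _ _ fs ds.
  have s0' : id s != 0 by [].
  have di := is_deriveV s0' (is_derive_id s (1 : R)).
  have dq' := is_deriveM di (is_deriveB dfs (is_derive_cst (f t) s 1)).
  have E : \forall z \near s,
      ((fun y => (id y)^-1) * (f \o (fun s => t + s) - cst (f t))) z = q z.
    near=> z; rewrite qE//; near: z; exact: (cvgr_neq0 _ cvg_id s0).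
  apply: (is_derive_eq (near_eq_is_derive E dq')).
  have -> : (f \o (fun s => t + s) - cst (f t)) s = f (t + s) - f t by [].
  by rewrite qE// -![_ *: _]/(_ * _); field.
have same (s s' : R) : s <= s' -> 0 < s * s' -> `|s| < r -> `|s'| < r ->
    `|q s' - q s| <= C * `|s' - s|.
  move=> ss ss0 sr s'r.
  have I z : z \in `[s, s'] -> z != 0 /\ `|z| < r.
    rewrite in_itv/= => /andP[z1 z2]; split.
      apply/eqP => z0; rewrite z0 in z1 z2.
      by move: ss0; rewrite ltNge mulr_le0_ge0.
    by move: sr s'r; rewrite !ltr_norml => /andP[? ?] /andP[? ?]; apply/andP; split; lra.
  have [x xI E] : exists2 x, x \in `[s, s'] & q s' - q s =
      (x^-1 * (derive1 f (t + x) - q x)) * (s' - s).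
    apply: MVT_segment => //.
      by move=> z /subset_itv_oo_cc/I[z0 zr]; exact: dq.
    apply: derivable_within_continuous => z /I[z0 zr].
    by have [] := dq z z0 zr.
  have [x0 xr] := I x xI.
  rewrite E !normrM ler_wpM2r// normfV mulrC ler_pdivrMr ?normr_gt0//.
  by have [] := mv x x0 xr.
exists C, r => // s s'; rewrite !subr0.
wlog ss : s s' / s <= s'.
  move=> W sr s'r; have [ss|/ltW ss] := leP s s'; first exact: W.
  by rewrite distrC (distrC s); exact: W.
move=> sr s'r; have [s0|s0] := eqVneq s 0.
  have [s'0|s'0] := eqVneq s' 0; first by rewrite s0 s'0 !subrr normr0 mulr0.
  by rewrite s0 q0 sub0r normrN distrC; have [] := mv s' s'0 s'r.
have [s'0|s'0] := eqVneq s' 0.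
  by rewrite s'0 q0 subr0; have [] := mv s s0 sr.
have [ss0|ss0] := ltP 0 (s * s').
  by rewrite distrC (distrC s); exact: same.
have [sn s'p] : s <= 0 /\ 0 <= s'.
  have [sn|sp] := leP s 0; last first.
    by move: ss0; rewrite leNgt mulr_gt0// (lt_le_trans sp).
  split=> //; rewrite leNgt; apply/negP => s'n.
  by move: ss0; rewrite leNgt nmulr_rgt0 ?s'n// lt_neqAle s0.
have -> : q s - q s' = (q s - derive1 f t) - (q s' - derive1 f t) by ring.
rewrite (le_trans (ler_normB _ _))//.
have [m1 _] := mv s s0 sr; have [m2 _] := mv s' s'0 s'r.
rewrite (le_trans (lerD m1 m2))// -mulrDr ler_wpM2l//.
by rewrite (ler0_norm sn) (ger0_norm s'p) ler0_norm; lra.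
Unshelve. all: end_near. Qed.

End DifferenceQuotient.

(** * From the Bertram-Glöckner-Neeb classes to Lip^k *)

Section BGNtoLip.
Variables (R : realType).

(** The dualized spaces quantified in [LipFKa] are determined by their topologies, through
    [delta_tau]. *)
Lemma LipFKa_tau k (X Y : lmodType R) (E : set (X -> R)) (F : set (Y -> R))
    (f : pfun X Y) : ConFKd E -> ConFKd F ->
  LipFKa k (tau E) (tau F) f <-> LipFKd k E F f.
Proof.
move=> EC FC; split=> [[E1 [F1 [H EE FF]]]|H]; last by exists E, F.
have [E1C F1C _] := H.
by rewrite -(delta_tau EC) EE (delta_tau E1C) -(delta_tau FC) FF (delta_tau F1C).
Qed.

Definition bgn_dual (X : lmodType R) (E : set (X -> R)) := prodd (prodd E E) (@Rd R).

Lemma ConFKd_bgn (X : lmodType R) (E : set (X -> R)) :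
  ConFKd E -> ConFKd (bgn_dual E).
Proof.
by move=> EC; apply: ConFKd_prodd; [exact: ConFKd_prodd|exact: ConFKd_Rd].
Qed.

Lemma LipkE_bgn k (X : lmodType R) (E : set (X -> R)) (c : pfun R (X * X * R^o)) :
  DVS E -> open (pdom c) ->
  (forall t, pdom c t ->
    [/\ forall l, E l -> LK k (fun s => l (vext c s).1.1) t,
        forall l, E l -> LK k (fun s => l (vext c s).1.2) t
      & LK k (fun s => (vext c s).2 : R) t]) ->
  LipkE (Some k) (bgn_dual E) c.
Proof.
move=> EV oc H; have BV := DVS_prodd (DVS_prodd EV EV) (DVS_Rd R).
apply/LipkE_LK; first by case: BV.
split=> // _ [_ [_ [[l1 [l2 [El1 El2 ->]]] [a ->] ->]]] t ct.
have [H1 H2 H3] := H t ct.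
exact: LK_add (LK_add (H1 l1 El1) (H2 l2 El2)) (LK_mul (LK_cst k a t) H3).
Qed.

(** The source space varies in the induction, since the difference quotient lives on X * X * R. *)
Lemma DBGN_LipFKd n (Y : lmodType R) (F : set (Y -> R)) : ConFKd F ->
  forall (X : lmodType R) (E : set (X -> R)) (f : pfun X Y), ConFKd E ->
  DBGN_fin n (tau E) (tau F) f -> LipFKd (Some n) E F f.
Proof.
move=> FC; have FV : DVS F by case: FC.
have F0 : F !=set0 by case: FV.
elim: n => [|n IH] X E f EC; first by move=> /(LipFKa_tau _ _ EC FC).
move=> /= [/(LipFKa_tau _ _ EC FC)[_ _ f0] [g [gdom gq g0] gn]].
have EV : DVS E by case: EC.
have E0 : E !=set0 by case: EV.
have Elin l : E l -> scalar l by exact: DVS_scalar.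
have BC := ConFKd_bgn EC.
rewrite (bgn_top_tau EC) in g0 gn.
have /(LipFKa_tau _ _ BC FC)[_ _ {}g0] := g0.
have [_ _ {gn}gn] := IH _ _ _ BC gn.
have gdomE x u t : pdom g (x, u, t) <-> pdom f (x + t *: u) /\ pdom f x.
  by rewrite gdom.
split=> // c Ec; have /(LipkE_LK _ _ E0)[oc Lc] := Ec.
have dce t : pdom c t -> c t = Some (vext c t) by exact: some_vext.
(* The definition of convenience differentiates only smooth curves defined on all of R; for the
   partial Lip^(n+1) curve c, [weak_derivative] is needed. *)
have /choice[c' Hc'] (t : R) : exists y, pdom c t -> forall l, E l ->
    l y = derive1 (l \o vext c) t.
  have [ct|nct] := EM (pdom c t); last by exists 0.
  have [|y Hy] := @weak_derivative _ _ E (vext c) t EC; last by exists y.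
  by move=> l El; apply: LK_le (Lc l El t ct).
pose c2 : pfun R (X * X * R^o) := fun t => omap (fun x => (x, c' t, 0)) (c t).
have c2dom : pdom c2 = pdom c.
  by apply/funext => t; rewrite /pdom /c2 /=; case: (c t).
have c2E t : pdom c t -> c2 t = Some (vext c t, c' t, 0).
  by move=> /dce ct; rewrite /c2 ct.
have v2E t : pdom c t -> vext c2 t = (vext c t, c' t, 0).
  by move=> /c2E ct; rewrite /vext ct.
have Ec2 : LipkE (Some n) (bgn_dual E) c2.
  apply: LipkE_bgn => //; first by rewrite c2dom.
  move=> t; rewrite c2dom => ct.
  have nc := (open_near _).1 oc _ ct; split=> [l El|l El|].
  - have := LK_pred (Lc l El t ct); apply: LK_near; apply: filterS nc => s cs /=.
    by rewrite v2E.
  - have [_] := Lc l El t ct; apply: LK_near; apply: filterS nc => s cs /=.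
    by rewrite v2E// Hc'.
  - have := LK_cst n (0 : R) t; apply: LK_near; apply: filterS nc => s cs /=.
    by rewrite v2E.
have Lg2 := gn _ Ec2.
have Ec0 : LipkE (Some 0%N) E c.
  apply/(LipkE_LK _ _ E0); split=> // l El t ct; exact: LK_le (Lc l El t ct).
have /(LipkE_LK _ _ F0)[ofc Lfc] := f0 _ Ec0.
have subd t : pdom (pcomp f c) t -> pdom c t by rewrite /pdom /pcomp /=; case: (c t).
have fdom t : pdom (pcomp f c) t -> pdom f (vext c t).
  by move=> dt; have := dt; rewrite /pdom /pcomp /= dce; last exact: subd.
have fcE t : pdom (pcomp f c) t -> pcomp f c t = Some (vext (pcomp f c) t).
  exact: some_vext.
have g2dom t : pdom (pcomp f c) t -> pdom (pcomp g c2) t.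
  move=> dt; rewrite /pdom /pcomp /= c2E; last exact: subd.
  by apply/gdomE; rewrite scale0r addr0; split; exact: fdom.
have der l t : F l -> pdom (pcomp f c) t ->
    is_derive t 1 (l \o vext (pcomp f c)) ((l \o vext (pcomp g c2)) t).
  move=> Fl dt; have ct := subd _ dt; have ll := DVS_scalar FV Fl.
  (* [g \o c3] is the difference quotient of [f \o c] at t. *)
  pose c3 : pfun R (X * X * R^o) := fun s => omap (fun x => (vext c t,
    if s == 0 then c' t else s^-1 *: (x - vext c t), s)) (c (t + s)).
  have c3dom s : pdom c3 s = pdom c (t + s) by rewrite /pdom /c3 /=; case: (c _).
  have c3E s : pdom c (t + s) -> c3 s = Some (vext c t,
      if s == 0 then c' t else s^-1 *: (vext c (t + s) - vext c t), s).
    by move=> /dce ct'; rewrite /c3 ct'.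
  have v3E s : pdom c (t + s) -> vext c3 s = (vext c t,
      if s == 0 then c' t else s^-1 *: (vext c (t + s) - vext c t), s).
    by move=> /c3E ct'; rewrite /vext ct'.
  have scnt (s : R) : {for s, continuous (fun s => t + s)}.
    by apply: LK_continuous (LK_add (LK_cst 0 t s) (LK_id 0 s)).
  have nearc (s : R) : pdom c (t + s) -> \forall z \near s, pdom c (t + z).
    by move=> ds; exact: (scnt s _ ((open_near _).1 oc _ ds)).
  have oc3 : open (pdom c3).
    apply/open_near => s; rewrite c3dom => /nearc; apply: filterS => z.
    by rewrite c3dom.
  have Ec3 : LipkE (Some 0%N) (bgn_dual E) c3.
    apply: LipkE_bgn => // s; rewrite c3dom => ds.
    have nc := nearc _ ds; split=> [l1 El1|l1 El1|].
    - have := LK_cst 0 (l1 (vext c t)) s; apply: LK_near.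
      by apply: filterS nc => z dz; rewrite v3E.
    - have [s0|s0] := eqVneq s 0.
        rewrite s0 in nc *.
        have /LK0_quotient := LK_le (isT : (1 <= n.+1)%N) (Lc l1 El1 t ct).
        apply: LK_near; apply: filterS nc => z dz; rewrite v3E//=.
        case: ifP => _; first by rewrite Hc'.
        by rewrite (scalar_fZ (Elin _ El1)) (scalar_fB (Elin _ El1)).
      have L1 : LK 0 (fun z => z^-1 * (l1 (vext c (t + z)) - l1 (vext c t))) s.
        apply: LK_mul; first exact: LK_inv (LK_id 0 s).
        apply: LK_sub; last exact: LK_cst.
        apply: (@LK_comp _ 0 (l1 \o vext c)); first exact: LK_le (Lc l1 El1 _ ds).
        exact: LK_add (LK_cst 0 t s) (LK_id 0 s).
      apply: LK_near L1.
      have nz : \forall z \near s, z != 0 by exact: (cvgr_neq0 _ cvg_id s0).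
      apply: filterS2 nc nz => z dz z0; rewrite v3E//= (negPf z0).
      by rewrite (scalar_fZ (Elin _ El1)) (scalar_fB (Elin _ El1)).
    - have := LK_id 0 s; apply: LK_near.
      by apply: filterS nc => z dz; rewrite v3E.
  have c0 : pdom c (t + 0) by rewrite addr0.
  have c30 : c3 0 = c2 t by rewrite c3E// eqxx c2E.
  have g30 : pdom (pcomp g c3) 0 by rewrite /pdom /pcomp /= c30; exact: g2dom.
  (* Continuity of l along [g \o c3] at 0 is the differentiability sought: off 0 the values are the
     difference quotients of l along f \o c at t, and at 0 the value is that of g at (c t, c' t,
     0). *)
  have /(LipkE_LK _ _ F0)[_ Lg3] := g0 _ Ec3.
  have /LK_continuous/cvgrPdist_le H3 := Lg3 l Fl 0 g30.
  apply/is_deriveP => e e0.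
  have /nearR[r1 r10 Hr1] := H3 e e0.
  have nfc : \forall s \near (0 : R), pdom (pcomp f c) (t + s).
    apply: (scnt 0); apply: (open_near _).1 ofc _ _.
    by rewrite addr0.
  have /nearR[r2 r20 Hr2] := nfc.
  exists (Num.min r1 r2); first by rewrite lt_min r10.
  move=> s s0; rewrite lt_min => /andP[s1 s2].
  have dts : pdom (pcomp f c) (t + s) by apply: Hr2; rewrite subr0.
  have := Hr1 s; rewrite subr0 => /(_ s1); rewrite distrC; congr (_ <= e); congr `| _ - _ |.
    rewrite -!(scalar_fB ll, scalar_fZ ll) /=; congr l.
    have c3s := c3E _ (subd _ dts).
    have [d gd] : exists d, g (vext c t, s^-1 *: (vext c (t + s) - vext c t), s) = Some d.
      apply/pdomP/gdomE; rewrite scalerA divff// scale1r addrC subrK.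
      by split; exact: fdom.
    rewrite /vext /pcomp c3s (negPf s0) /= gd /= -/(vext c) -/(vext (pcomp f c)).
    apply: (gq _ _ _ _ _ _ gd) => //.
      by rewrite -fcE// /pcomp dce//.
    rewrite scalerA divff// scale1r addrC subrK -fcE// /pcomp dce//.
    exact: subd.
  by rewrite /= /vext /pcomp c30.
apply/(LipkE_LK _ _ F0); split=> // l Fl t dt.
have /(LipkE_LK _ _ F0)[_ Lg] := Lg2.
apply: (@LKS _ n _ (l \o vext (pcomp g c2))); last exact: Lg Fl _ (g2dom _ dt).
by apply: filterS ((open_near _).1 ofc _ dt) => s; exact: der.
Qed.

End BGNtoLip.

(** * Mixed differences *)

Section Polarization.
Variables (R : realType) (V : normedModType R).
Implicit Types (phi : V -> R) (s : seq V).

(** The coefficients are binomial numbers with alternating signs; polarization needs only the size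
    of the first. *)
Lemma DL_nseq_coef m : exists2 c : nat -> R, c 0%N != 0 /\ `|c 0%N| = 1 &
  forall phi b al, DL (nseq m al) phi b = \sum_(i < m.+1) c i * phi (b + al *+ i).
Proof.
elim: m => [|m [c [c0 c1] H]].
  exists (fun=> 1); first by rewrite oner_neq0 normr1.
  by move=> phi b al; rewrite big_ord1 mul1r addr0.
exists (fun j => (if j is i.+1 then c i else 0) - (if (j <= m)%N then c j else 0)).
  by rewrite /= sub0r oppr_eq0 normrN.
move=> phi b al; rewrite /= !H.
under [RHS]eq_bigr do rewrite mulrBl.
rewrite big_split /= sumrN; congr (_ - _).
  rewrite [RHS]big_ord_recl /= mul0r add0r; apply: eq_bigr => i _.
  by rewrite /bump /= add1n mulrS addrA.
rewrite [RHS]big_ord_recr /= ltnn mul0r addr0; apply: eq_bigr => i _.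
by rewrite ifT// -ltnS.
Qed.

Definition vsum s : R := \sum_(a <- s) `|a|.

Lemma vsum_cons a s : vsum (a :: s) = `|a| + vsum s.
Proof. by rewrite /vsum big_cons. Qed.

Lemma vsum_ge0 s : 0 <= vsum s.
Proof. exact: sumr_ge0. Qed.

(** Differences in which base point and step move together: adding a to b and subtracting w a from
    the step moves the point b + i al by (1 - i w) a. The weight w = 1/i thus leaves the i-th point
    fixed. *)
Fixpoint shears m phi (L : seq (V * R)) (b al : V) : R :=
  if L is p :: L' then shears m phi L' (b + p.1) (al - p.2 *: p.1) - shears m phi L' b al
  else DL (nseq m al) phi b.

Lemma shears_bound m phi L b al (B : R) :
  (forall p, p \in L -> 0 <= p.2 <= 1) ->
  (forall b' al', `|b' - b| <= vsum (unzip1 L) -> `|al' - al| <= vsum (unzip1 L) ->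
     `|DL (nseq m al') phi b'| <= B) ->
  `|shears m phi L b al| <= 2 ^+ (size L) * B.
Proof.
elim: L b al => [|[a w] L IH] b al wL H /=.
  by rewrite expr0 mul1r; apply: H; rewrite subrr normr0 vsum_ge0.
have /andP[w0 w1] := wL _ (mem_head _ _).
rewrite (le_trans (ler_normB _ _))// exprS -mulrA mulr_natl mulr2n lerD//.
  apply: IH => [p pL|b' al' bb aa]; first by apply: wL; rewrite inE pL orbT.
  apply: H; rewrite /= vsum_cons.
    have -> : b' - b = a + (b' - (b + a)) by rewrite opprD (addrA b') (addrC a) subrK.
    by rewrite (le_trans (ler_normD _ _))// lerD2l.
  have -> : al' - al = (al' - (al - w *: a)) - w *: a by rewrite opprB addrA addrAC addrK.
  rewrite (le_trans (ler_normB _ _))// addrC lerD// normrZ ger0_norm//.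
  by rewrite ler_piMl.
apply: IH => [p pL|b' al' bb aa]; first by apply: wL; rewrite inE pL orbT.
by apply: H; rewrite /= vsum_cons ler_wpDl.
Qed.

Lemma shears_sum m phi L (c : nat -> R) :
  (forall b al, DL (nseq m al) phi b = \sum_(i < m.+1) c i * phi (b + al *+ i)) ->
  forall b al, shears m phi L b al =
    \sum_(i < m.+1) c i * DL [seq (1 - i%:R * p.2) *: p.1 | p <- L] phi (b + al *+ i).
Proof.
move=> H; elim: L => [|[a w] L IH] b al /=; first exact: H.
rewrite !IH -sumrB; apply: eq_bigr => i _; rewrite -mulrBr; congr (_ * (DL _ _ _ - _)).
rewrite mulrnBl scalerBl scale1r -scalerA scaler_nat.
by rewrite -!addrA; congr (b + _); rewrite addrCA.
Qed.

(* In the expansion of the shears with weights 1, 1/2, ..., 1/m only the term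
   i = 0 survives: for 1 <= i <= m the i-th step is multiplied by 1 - i / i. *)
Lemma polarization phi s b (B : R) :
  (forall b' al, `|b' - b| <= vsum s -> `|al| <= vsum s ->
     `|DL (nseq (size s) al) phi b'| <= B) ->
  `|DL s phi b| <= 2 ^+ size s * B.
Proof.
move=> H; set m := size s in H *.
have [c [c0 c1] Hc] := DL_nseq_coef m.
pose L := zip s (mkseq (fun j => (j.+1%:R)^-1 : R) m).
have sL : size L = m by rewrite size_zip size_mkseq minnn.
have uL : unzip1 L = s by apply: unzip1_zip; rewrite size_mkseq.
have := @shears_bound m phi L b 0 B; rewrite sL uL => HB.
have {}HB : `|shears m phi L b 0| <= 2 ^+ m * B.
  apply: HB => [[a w] /= aw|b' al' bb]; last by rewrite subr0; exact: H.
  have : w \in unzip2 L by apply/mapP; exists (a, w).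
  rewrite unzip2_zip ?size_mkseq// => /mapP[j _ ->].
  by rewrite invr_ge0 ler0n/= invf_le1// ler1n.
suff E : shears m phi L b 0 = c 0%N * DL s phi b.
  by move: HB; rewrite E normrM c1 mul1r.
rewrite (shears_sum L (Hc phi)) big_ord_recl /= big1 ?addr0.
  congr (_ * DL _ _ _); rewrite -[RHS]uL; apply: eq_map => -[a w] /=.
  by rewrite mul0r subr0 scale1r.
move=> i _; rewrite DL0 ?mulr0//; apply/mapP.
have im : (i < m)%N by exact: ltn_ord.
exists (nth (0, 0) L i); first by rewrite mem_nth// sL.
rewrite /L nth_zip ?size_mkseq//= nth_mkseq// /bump /= add1n.
by rewrite divff ?pnatr_eq0// subrr scale0r.
Qed.

End Polarization.

Section Subdivision.
Variable R : realType.
Implicit Types (psi : R -> R).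

Lemma DL_cons_comm b (s : seq R) psi p :
  DL (b :: s) psi p = DL s (fun q => psi (q + b) - psi q) p.
Proof.
elim: s p => // a s IH p; rewrite DL_swap.
by rewrite [RHS]/= -!IH.
Qed.

(** A difference with step M b telescopes into M differences with step b at shifted base points. *)
Lemma DL_subdivide (L : seq (nat * R)) psi t (B : R) :
  (forall t', `|t' - t| <= \sum_(p <- L) p.1%:R * `|p.2| ->
     `|DL (unzip2 L) psi t'| <= B) ->
  `|DL [seq p.1%:R * p.2 | p <- L] psi t| <= (\prod_(p <- L) p.1)%N%:R * B.
Proof.
elim: L psi t B => [|[M b] L IH] psi t B H /=.
  by rewrite big_nil mul1r; apply: H; rewrite subrr normr0 big_nil.
set L' := [seq _ | _ <- _].
have E : DL L' psi (t + M%:R * b) - DL L' psi t =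
    \sum_(0 <= j < M) DL (b :: L') psi (t + j%:R * b).
  rewrite (telescope_sumr_eq (fun j => DL L' psi (t + j%:R * b)))//.
    by rewrite mul0r addr0.
  by move=> j _ /=; rewrite -natr1 mulrDl mul1r addrA.
rewrite E big_cons /= natrM -mulrA big_mkord mulr_natl.
rewrite (le_trans (ler_norm_sum _ _ _))//.
rewrite -[M in leRHS]card_ord -sumr_const ler_sum// => j _.
rewrite [X in `|X|](DL_cons_comm b L' psi); apply: IH => t' tt.
rewrite -DL_cons_comm; apply: H; rewrite big_cons /=.
have -> : t' - t = j%:R * b + (t' - (t + j%:R * b)) by ring.
rewrite (le_trans (ler_normD _ _))// lerD// normrM normr_nat ler_wpM2r//.
by rewrite ler_nat ltnW.
Qed.

End Subdivision.

Section MixedBound.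
Variable R : realType.

Lemma DL_sub (s : seq R) (f g : R -> R) p :
  DL s (fun q => f q - g q) p = DL s f p - DL s g p.
Proof. by elim: s p => //= a s IH p; rewrite !IH; ring. Qed.

Lemma DL_param_derive (phi : R -> R -> R) (h : R -> R) (y : R) s r :
  (forall q, `|q - r| <= norm_sum s -> is_derive y 1 (phi q) (h q)) ->
  is_derive y 1 (fun t => DL s (fun q => phi q t) r) (DL s h r).
Proof.
elim: s r => [|a s IH] r H /=; first by apply: H; rewrite subrr normr0 norm_sum_ge0.
apply: is_deriveB; apply: IH => q qr; apply: H; rewrite norm_sum_cons.
  have -> : q - r = a + (q - (r + a)) by ring.
  by rewrite (le_trans (ler_normD _ _))// lerD2l.
by rewrite ler_wpDl.
Qed.

Lemma DL_lift (s : seq R) (Phi : R^o * R^o -> R) t y :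
  DL [seq (b, 0) | b <- s] Phi (t, y) = DL s (fun q => Phi (q, y)) t.
Proof.
elim: s t => //= b s IH t; rewrite -!IH; congr (DL _ _ _ - _).
by congr pair => /=; rewrite addr0.
Qed.

Lemma norm_lower_bound (s : seq R) : 0 \notin s ->
  exists2 mu : R, 0 < mu & forall a, a \in s -> mu <= `|a|.
Proof.
elim: s => [|a s IH]; first by exists 1.
rewrite inE negb_or eq_sym => /andP[a0 /IH[mu mu0 H]].
exists (Num.min `|a| mu); first by rewrite lt_min normr_gt0 a0.
move=> b; rewrite inE => /orP[/eqP ->|bs]; first by rewrite ge_min lexx.
by rewrite ge_min H ?orbT.
Qed.

(** In K, 2^(k+1) comes from rounding the numbers of pieces, 2^(k+2) from polarization, and
    (k+2)^(k+2) from its steps, which can be as long as the sum of k+2 vectors of norm at most t. *)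
Lemma mixed_bound k : exists K : R, forall (phi : R -> R -> R) (h : R -> R) (r0 d C : R),
  0 <= C -> 0 < d ->
  (forall b al : R^o * R^o, `|b.1 - r0| < d -> `|b.2| < d -> `|al| < d ->
    `|DL (nseq k.+2 al) (fun p : R^o * R^o => phi p.1 p.2) b| <= C * `|al| ^+ k.+2) ->
  (forall r, `|r - r0| < d -> is_derive (0 : R) 1 (phi r) (h r)) ->
  forall s r, size s = k.+1 -> (forall a, a \in s -> `|a| < d / (2 * k.+2)%:R) ->
    `|r - r0| < d / (2 * k.+2)%:R -> `|DL s h r| <= K * C * \prod_(a <- s) `|a|.
Proof.
exists (2 ^+ k.+1 * (2 ^+ k.+2 * k.+2%:R ^+ k.+2)).
move=> phi h r0 d C C0 d0 Hl Hd s r sk sd rd; set K := 2 ^+ k.+1 * _.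
set d' := d / _ in sd rd.
have d'0 : 0 < d' by rewrite divr_gt0// ltr0n.
(* The shares are for r itself, for the shifts along the steps in s, and for the displacements in
   polarization. *)
have dE : d = d' + k.+1%:R * d' + k.+2%:R * d'.
  have nE : (2 * k.+2)%:R = 1 + k.+1%:R + k.+2%:R :> R by rewrite mul2n -addnn natrD nat1r.
  by rewrite -{1}[d'](mul1r) -!mulrDl -nE /d' mulrC divfK ?pnatr_eq0.
have pr0 : 0 <= \prod_(a <- s) `|a| by exact: prodr_ge0.
have K0 : 0 <= K by apply: mulr_ge0; last apply: mulr_ge0; apply: exprn_ge0; rewrite ler0n.
have [s0|s0] := boolP (0 \in s); first by rewrite DL0// normr0; exact: mulr_ge0 (mulr_ge0 K0 C0) pr0.
have [mu0 mu00 Hmu0] := norm_lower_bound s0.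
pose mu := Num.min mu0 d'.
have mu_gt0 : 0 < mu by rewrite lt_min mu00.
have mud : mu <= d' by rewrite ge_min lexx orbT.
have Hmu a : a \in s -> mu <= `|a| by move=> /Hmu0; apply: le_trans; rewrite ge_min lexx.
have ns : norm_sum s <= k.+1%:R * d'.
  by rewrite -sk; apply: norm_sum_le => a /sd/ltW.
have der : is_derive (0 : R) 1 (fun t => DL s (fun q => phi q t) r) (DL s h r).
  apply: DL_param_derive => q qr; apply: Hd.
  have -> : q - r0 = (r - r0) + (q - r) by ring.
  rewrite (le_lt_trans (ler_normD _ _))// dE -addrA ltr_leD// (le_trans qr)//.
  by rewrite (le_trans ns)// lerDl mulr_ge0// ltW.
have bound t : 0 < t -> t <= mu ->
    `|DL s (fun q => phi q t) r - DL s (fun q => phi q 0) r| <= K * C * \prod_(a <- s) `|a| * t.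
  move=> t0 tmu; rewrite -DL_sub; set psi := fun q => _.
  (* The pieces of a have length at most t, and as t does not exceed any step in s, there are at
     most 2 |a| / t of them. *)
  pose M (a : R) := (Num.truncn (`|a| / t)).+1.
  have M0 a : (M a)%:R != 0 :> R by rewrite pnatr_eq0.
  have at0 (a : R) : 0 <= `|a| / t by rewrite divr_ge0// ltW.
  have M1 a : `|a| / t < (M a)%:R by have /andP[] := truncn_itv (at0 a).
  have M2 a : a \in s -> (M a)%:R <= 2 * (`|a| / t).
    move=> as_; have /andP[h1 _] := truncn_itv (at0 a).
    have h2 : 1 <= `|a| / t by rewrite ler_pdivlMr// mul1r (le_trans tmu)// Hmu.
    have -> : (M a)%:R = (Num.truncn (`|a| / t))%:R + 1 :> R by rewrite /M -natr1.
    lra.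
  pose L := [seq (M a, a / (M a)%:R) | a <- s].
  have Ls : [seq p.1%:R * p.2 | p <- L] = s.
    rewrite -map_comp -[RHS]map_id; apply: eq_map => a /=.
    by rewrite mulrC divfK.
  have bt (b : R) : b \in unzip2 L -> `|b| <= t.
    rewrite /unzip2 /L -map_comp => /mapP[a _ ->] /=.
    rewrite normrM normfV normr_nat ler_pdivrMr ?ltr0n// mulrC.
    by rewrite -ler_pdivrMr// ltW.
  have sumL : \sum_(p <- L) p.1%:R * `|p.2| = norm_sum s.
    rewrite big_map /norm_sum; apply: eq_bigr => a _ /=.
    by rewrite normrM normfV normr_nat mulrC divfK.
  have szL : size (unzip2 L) = k.+1 by rewrite !size_map.
  rewrite -{1}Ls.
  have := @DL_subdivide R L psi r (2 ^+ k.+2 * (C * (k.+2%:R * t) ^+ k.+2)).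
  rewrite sumL => H.
  have {H} H : `|DL [seq p.1%:R * p.2 | p <- L] psi r| <=
      (\prod_(p <- L) p.1)%N%:R * (2 ^+ k.+2 * (C * (k.+2%:R * t) ^+ k.+2)).
    apply: H => t' tt.
    pose S : seq (R^o * R^o) := (0, t) :: [seq (b, 0) | b <- unzip2 L].
    have -> : DL (unzip2 L) psi t' = DL S (fun p => phi p.1 p.2) (t', 0).
      rewrite /= DL_lift DL_sub; congr (_ - _).
        by rewrite /= add0r addr0.
      by rewrite DL_lift.
    have szS : size S = k.+2 by rewrite /= size_map szL.
    have vS : vsum S <= k.+2%:R * t.
      rewrite vsum_cons -natr1 mulrDl mul1r addrC lerD//.
        rewrite /vsum big_map -szL; apply: (le_trans _ (norm_sum_le bt)).
        rewrite /norm_sum ler_sum// => b _.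
        by rewrite prod_normE /= normr0 ge_max lexx normr_ge0.
      by rewrite prod_normE /= normr0 ge_max (ltW t0) (ger0_norm (ltW t0)) lexx.
    have kt : k.+2%:R * t <= k.+2%:R * d' by rewrite ler_wpM2l// (le_trans tmu).
    have [kd1 kd2] : 0 <= k.+1%:R * d' /\ 0 <= k.+2%:R * d'.
      by split; rewrite mulr_ge0// ltW.
    have := @polarization _ _ (fun p : R^o * R^o => phi p.1 p.2) S (t', 0) (C * (k.+2%:R * t) ^+ k.+2).
    rewrite szS; apply => b' al bb aa.
    have [b1 b2] : `|b'.1 - t'| <= k.+2%:R * t /\ `|b'.2| <= k.+2%:R * t.
      have := le_trans bb vS; rewrite prod_normE ge_max /= => /andP[-> ].
      by rewrite subr0.
    have al1 : `|al| <= k.+2%:R * t := le_trans aa vS.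
    apply: (le_trans (Hl b' al _ _ _)).
    - have -> : b'.1 - r0 = (r - r0) + (t' - r) + (b'.1 - t') by ring.
      rewrite (le_lt_trans (ler_normD _ _))// dE ltr_leD//; last exact: le_trans b1 kt.
      by rewrite (le_lt_trans (ler_normD _ _))// ltr_leD// (le_trans tt).
    - by rewrite (le_lt_trans b2)// dE; lra.
    - by rewrite (le_lt_trans al1)// dE; lra.
    - by rewrite ler_wpM2l// lerXn2r// ?nnegrE ?mulr_ge0// ltW.
  rewrite (le_trans H)//.
  have PM : (\prod_(p <- L) p.1)%N%:R <= 2 ^+ k.+1 * (\prod_(a <- s) `|a|) / t ^+ k.+1 :> R.
    rewrite big_map /= -sk natr_prod.
    have H2 : \prod_(a <- s) (M a)%:R <= \prod_(a <- s) (2 * (`|a| / t)) :> R.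
      rewrite big_seq [leRHS]big_seq; apply: ler_prod => a as_.
      by rewrite ler0n M2.
    rewrite (le_trans H2)// big_split /= big_split /= !big_const_seq count_predT.
    by rewrite !iter_mulr_1 exprVn mulrA.
  rewrite (le_trans (ler_wpM2r _ PM))//.
    apply: mulr_ge0; first exact: exprn_ge0.
    by apply: mulr_ge0 => //; apply: exprn_ge0; rewrite mulr_ge0// ltW.
  rewrite /K exprMn (exprS t k.+1) le_eqVlt; apply/orP; left; apply/eqP.
  by field; rewrite ?expf_neq0// gt_eqF.
apply/ler_addgt0Pl => e e0.
have [rho rho0 Hrho] := (is_deriveP _ _ _).1 der e e0.
pose t := Num.min mu (rho / 2).
have t0 : 0 < t by rewrite lt_min mu_gt0 divr_gt0.
have tmu : t <= mu by rewrite ge_min lexx.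
have trho : `|t| < rho.
  by rewrite gtr0_norm// (@le_lt_trans _ _ (rho / 2)) ?ge_min ?lexx ?orbT//; lra.
have tn0 : t != 0 by rewrite gt_eqF.
have := Hrho t tn0 trho; rewrite add0r => h1.
have h2 : `|t^-1 * (DL s (fun q => phi q t) r - DL s (fun q => phi q 0) r)| <=
    K * C * \prod_(a <- s) `|a|.
  by rewrite normrM normfV (gtr0_norm t0) mulrC ler_pdivrMr// bound.
have -> : DL s h r = t^-1 * (DL s (fun q => phi q t) r - DL s (fun q => phi q 0) r) -
  (t^-1 * (DL s (fun q => phi q t) r - DL s (fun q => phi q 0) r) - DL s h r) by ring.
by rewrite (le_trans (ler_normB _ _))// addrC lerD.
Qed.

End MixedBound.

(** * Lip^k functions recognized by their differences *)

Section LipCriterion.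
Variable R : realType.
Implicit Types h : R -> R.

Lemma LocM0_LK h r0 : LocM 0 h r0 -> LK 0 h r0.
Proof.
move=> [C [d d0 H]]; exists C, (d / 2); first by rewrite divr_gt0.
move=> s t sd td.
have := H [:: s - t] t erefl; rewrite big_seq1 /= (addrC t (s - t)) subrK; apply.
  move=> a; rewrite inE => /eqP ->.
  have -> : s - t = (s - r0) - (t - r0) by ring.
  by rewrite (le_lt_trans (ler_normB _ _))// (splitr d) ltrD.
by rewrite (lt_trans td)//; lra.
Qed.

(** One more step x is prepended, the bound is divided by |x|, and x tends to 0. *)
Lemma LocM_derive1 k h r0 : LK 1 h r0 -> LocM k.+1 h r0 -> LocM k (derive1 h) r0.
Proof.
move=> h1 [C [d d0 HC]]; have /nearR[e e0 He] := LK_is_derive h1.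
exists `|C|, (Num.min d (e / k.+2%:R)); first by rewrite lt_min d0 divr_gt0.
move=> s t sk sd; rewrite lt_min => /andP[td te].
have {}sd a : a \in s -> `|a| < d /\ `|a| < e / k.+2%:R.
  by move=> /sd; rewrite lt_min => /andP[].
have ns : norm_sum s <= k.+1%:R * (e / k.+2%:R).
  by rewrite -[X in X%:R * _]sk; apply: norm_sum_le => a /sd[_ /ltW].
have eE : e = e / k.+2%:R + k.+1%:R * (e / k.+2%:R).
  by rewrite -[X in _ = X + _]mul1r -mulrDl nat1r mulrC divfK ?pnatr_eq0.
have der : is_derive t 1 (DL s h) (DL s (derive1 h) t).
  apply: DL_is_derive => q qt; apply: He.
  have -> : q - r0 = (t - r0) + (q - t) by ring.
  by rewrite (le_lt_trans (ler_normD _ _))// eE ltr_leD// (le_trans qt).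
apply/ler_addgt0Pl => eps eps0.
have [rho rho0 Hrho] := (is_deriveP _ _ _).1 der eps eps0.
pose x := Num.min (d / 2) (rho / 2).
have x0 : 0 < x by rewrite lt_min !divr_gt0.
have xd : `|x| < d.
  by rewrite gtr0_norm// (@le_lt_trans _ _ (d / 2)) ?ge_min ?lexx//; lra.
have xrho : `|x| < rho.
  by rewrite gtr0_norm// (@le_lt_trans _ _ (rho / 2)) ?ge_min ?lexx ?orbT//; lra.
have xn0 : x != 0 by rewrite gt_eqF.
have h1' := Hrho x xn0 xrho.
have h2 : `|x^-1 * (DL s h (t + x) - DL s h t)| <= `|C| * \prod_(a <- s) `|a|.
  have := HC (x :: s) t; rewrite /= sk big_cons => /(_ erefl) H.
  rewrite normrM normfV mulrC ler_pdivrMr ?normr_gt0// -mulrA [X in `|C| * X]mulrC.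
  rewrite (le_trans (H _ td))//.
    by move=> a; rewrite inE => /orP[/eqP -> //|/sd[]].
  by rewrite ler_wpM2r ?ler_norm// mulr_ge0// prodr_ge0.
have -> : DL s (derive1 h) t = x^-1 * (DL s h (t + x) - DL s h t) -
   (x^-1 * (DL s h (t + x) - DL s h t) - DL s (derive1 h) t) by ring.
by rewrite (le_trans (ler_normB _ _))// addrC lerD.
Qed.

(* The difference quotients q r n over 2^-n converge since q r n + 2 C 2^-n
   decreases in n. *)
Lemma LocM1_LK1 h r0 : LK 0 h r0 -> LocM 1 h r0 -> LK 1 h r0.
Proof.
move=> /LK0_ge0[L L0 [d1 d10 HL]] [C' [d2 d20 HC']].
pose C := `|C'|; have C0 : 0 <= C by exact: normr_ge0.
pose d := Num.min d1 d2 / 2.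
have d0 : 0 < d by rewrite divr_gt0// lt_min d10.
have dd1 : d + d <= d1 by rewrite -splitr ge_min lexx.
have dd2 : d + d <= d2 by rewrite -splitr ge_min lexx orbT.
have HD r a b : `|r - r0| < d -> `|a| < d -> `|b| < d ->
    `|(h (r + a + b) - h (r + a)) - (h (r + b) - h r)| <= C * (`|a| * `|b|).
  move=> rd ad bd; have := HC' [:: a; b] r erefl; rewrite /= big_cons big_seq1 => H.
  rewrite (le_trans (H _ _))//.
  - move=> x; rewrite !inE => /orP[]/eqP ->; lra.
  - lra.
  - by rewrite ler_wpM2r ?ler_norm// mulr_ge0.
clearbody C d.
have hL r s : `|r - r0| < d -> `|s| < d -> `|h (r + s) - h r| <= L * `|s|.
  move=> rd sd; rewrite (le_trans (HL _ _ _ _))//.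
  - have -> : r + s - r0 = (r - r0) + s by ring.
    by rewrite (le_lt_trans (ler_normD _ _))// (lt_le_trans _ dd1)// ltrD.
  - lra.
  - by rewrite (_ : r + s - r = s)//; ring.
(* The increment over s is compared with m = floor (s / s') increments over s'. Second differences
   add up to at most C s^2; the remainder s - m s' and the replacement of m by s / s' cost L s'
   each. *)
have comp r s s' : `|r - r0| < d / 2 -> 0 < s -> s < d / 2 -> 0 < s' -> s' <= s ->
    `|(h (r + s) - h r) - s / s' * (h (r + s') - h r)| <= C * s ^+ 2 + 2 * L * s'.
  move=> rd s0 sd s'0 s's.
  have /andP[m1 m2] := truncn_itv (ltW (divr_gt0 s0 s'0)).
  set m := Num.truncn (s / s') in m1 m2.
  have ms : m%:R * s' <= s by rewrite -ler_pdivlMr.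
  have ms2 : s < m%:R * s' + s' by rewrite -{2}(mul1r s') -mulrDl natr1 -ltr_pdivrMr.
  have E : h (r + m%:R * s') - h r =
      \sum_(0 <= j < m) (h (r + j%:R * s' + s') - h (r + j%:R * s')).
    rewrite (telescope_sumr_eq (fun j => h (r + j%:R * s')))//.
      by rewrite mul0r addr0.
    by move=> j _ /=; rewrite -natr1 mulrDl mul1r addrA.
  have B1 : `|(h (r + m%:R * s') - h r) - m%:R * (h (r + s') - h r)| <= C * s ^+ 2.
    rewrite E big_mkord mulr_natl -[m in X in _ - X]card_ord -sumr_const -sumrB.
    rewrite (le_trans (ler_norm_sum _ _ _))//.
    apply: (@le_trans _ _ (\sum_(j < m) C * (s * s'))).
      apply: ler_sum => j _.
      have js : j%:R * s' <= s.
        by rewrite (le_trans _ ms)// ler_wpM2r ?ler_nat ?(ltW s'0)// ltnW.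
      have js0 : 0 <= j%:R * s' by rewrite mulr_ge0// ltW.
      rewrite (le_trans (HD _ _ _ _ _ _))//.
      - lra.
      - by rewrite (ger0_norm js0); lra.
      - by rewrite (gtr0_norm s'0); lra.
      by rewrite (ger0_norm js0) (gtr0_norm s'0) ler_wpM2l// ler_wpM2r// ltW.
    rewrite sumr_const card_ord -mulr_natl.
    have : m%:R * s' * (C * s) <= s * (C * s) by rewrite ler_wpM2r// mulr_ge0// ltW.
    by rewrite expr2; lra.
  have B2 : `|h (r + s) - h (r + m%:R * s')| <= L * s'.
    have ms0 : 0 <= m%:R * s' by rewrite mulr_ge0// ltW.
    have -> : r + s = r + m%:R * s' + (s - m%:R * s') by ring.
    rewrite (le_trans (hL _ _ _ _))//.
    - have -> : r + m%:R * s' - r0 = (r - r0) + m%:R * s' by ring.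
      by rewrite (le_lt_trans (ler_normD _ _))// (ger0_norm ms0); lra.
    - by rewrite ger0_norm; lra.
    - by rewrite ler_wpM2l// ger0_norm; lra.
  have B3 : `|(m%:R - s / s') * (h (r + s') - h r)| <= L * s'.
    rewrite normrM (@le_trans _ _ (1 * (L * `|s'|)))//; last by rewrite mul1r ger0_norm// ltW.
    apply: ler_pM => //; last by apply: hL; [lra|rewrite ger0_norm ?(ltW s'0)//; lra].
    by move: m2; rewrite -natr1 => m2; rewrite ler0_norm; lra.
  have -> : (h (r + s) - h r) - s / s' * (h (r + s') - h r) =
    ((h (r + m%:R * s') - h r) - m%:R * (h (r + s') - h r)) +
    (h (r + s) - h (r + m%:R * s')) + (m%:R - s / s') * (h (r + s') - h r) by ring.
  rewrite (le_trans (ler_normD _ _))//.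
  have := ler_normD ((h (r + m%:R * s') - h r) - m%:R * (h (r + s') - h r))
    (h (r + s) - h (r + m%:R * s')).
  lra.
pose q r n := (dy R n)^-1 * (h (r + dy R n) - h r).
have [N HN] : exists N, forall n, (N <= n)%N -> dy R n < d / 2.
  by apply/near_natP; apply: dy_small; rewrite divr_gt0.
have qbnd r n : `|r - r0| < d -> (N <= n)%N -> `|q r n| <= L.
  move=> rd nN; have dn := HN n nN; have dn0 := dy_gt0 R n.
  rewrite /q normrM normfV (gtr0_norm dn0) mulrC ler_pdivrMr//.
  by rewrite -[X in _ <= L * X](gtr0_norm dn0); apply: hL => //; rewrite gtr0_norm//; lra.
have qstep r n : `|r - r0| < d -> (N <= n)%N -> q r n.+1 - q r n <= C * dy R n.+1.
  move=> rd nN; have dn := HN n nN; have dn0 := dy_gt0 R n; have dS := dyS R n.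
  have e1 : h (r + dy R n) = h (r + dy R n.+1 + dy R n.+1).
    by congr h; rewrite dS; field.
  have dS0 := dy_gt0 R n.+1.
  have E : q r n.+1 - q r n = - (dy R n)^-1 *
     ((h (r + dy R n.+1 + dy R n.+1) - h (r + dy R n.+1)) - (h (r + dy R n.+1) - h r)).
    by rewrite /q e1 dS; field; rewrite gt_eqF.
  rewrite E (le_trans (ler_norm _))// normrM normrN normfV (gtr0_norm dn0).
  rewrite mulrC ler_pdivrMr// (le_trans (HD _ _ _ _ _ _))//.
  - by rewrite gtr0_norm//; lra.
  - by rewrite gtr0_norm//; lra.
  - by rewrite gtr0_norm// -mulrA ler_wpM2l// ler_wpM2l ?(ltW dS0)//; lra.
have lim r : `|r - r0| < d -> exists l : R, q r n @[n --> \oo] --> l.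
  move=> rd; pose u n := q r (n + N)%N + 2 * C * dy R (n + N)%N.
  have ud : nonincreasing_seq u.
    apply/nonincreasing_seqP => n; rewrite /u addSn.
    have := qstep r (n + N)%N rd (leq_addl _ _).
    rewrite dyS; have : 0 <= C * dy R (n + N) by rewrite mulr_ge0// dy_ge0.
    lra.
  have ub : has_lbound (range u).
    exists (- L) => _ [n _ <-]; rewrite /u.
    have := qbnd r (n + N)%N rd (leq_addl _ _); rewrite ler_norml => /andP[qL _].
    by rewrite (le_trans qL)// lerDl !mulr_ge0// dy_ge0.
  have uc := nonincreasing_is_cvgn ud ub.
  exists (limn u).
  have dyc : dy R n @[n --> \oo] --> (0 : R).
    apply/cvgrPdist_lt => e e0; near=> n; rewrite sub0r normrN gtr0_norm ?dy_gt0//.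
    by near: n; exact: dy_small.
  rewrite -(cvg_shiftn N).
  have -> : (fun n => q r (n + N)%N) = (fun n => u n - 2 * C * dy R (n + N)%N).
    by apply/funext => n; rewrite /u addrK.
  have dyc2 : 2 * C * dy R (n + N)%N @[n --> \oo] --> 2 * C * 0.
    by apply: cvgMr; rewrite (cvg_shiftn N (dy R)).
  have := cvgB uc dyc2; rewrite mulr0 subr0; exact.
have /choice[D HDl] (r : R) : exists l : R, `|r - r0| < d -> q r n @[n --> \oo] --> l.
  by have [/lim[l Hl]|n] := EM (`|r - r0| < d); [exists l|exists 0].
have Dn r e : `|r - r0| < d -> 0 < e -> \forall n \near \oo, `|D r - q r n| <= e.
  by move=> rd e0; have /cvgrPdist_le := HDl r rd; apply.
have dn e : 0 < e -> \forall n \near \oo, 2 * L * dy R n <= e.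
  move=> e0; have : 0 < e / (2 * L + 1) by rewrite divr_gt0// ltr_wpDl// mulr_ge0.
  move/dy_small; apply: filterS => n; rewrite ltr_pdivlMr ?ltr_wpDl ?mulr_ge0// => H.
  have := dy_ge0 R n; lra.
have Dq r s : `|r - r0| < d / 2 -> 0 < s -> s < d / 2 ->
    `|(h (r + s) - h r) - s * D r| <= C * s ^+ 2.
  move=> rd s0 sd; apply/ler_addgt0Pl => e e0.
  have rd' : `|r - r0| < d by lra.
  have es : 0 < e / 2 / s by rewrite !divr_gt0.
  have e2 : 0 < e / 2 by rewrite divr_gt0.
  near \oo => n.
  have n1 : `|D r - q r n| <= e / 2 / s by near: n; exact: Dn.
  have n2 : 2 * L * dy R n <= e / 2 by near: n; exact: dn.
  have n3 : dy R n < s by near: n; exact: dy_small.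
  have := comp r s (dy R n) rd s0 sd (dy_gt0 R n) (ltW n3).
  rewrite -mulrA -/(q r n) => n4.
  have n5 : `|s * (D r - q r n)| <= e / 2.
    by rewrite normrM gtr0_norm// mulrC -ler_pdivlMr.
  have -> : h (r + s) - h r - s * D r =
    (h (r + s) - h r - s * q r n) - s * (D r - q r n) by ring.
  rewrite (le_trans (ler_normB _ _))//; lra.
have DLip r r' : `|r - r0| < d / 4 -> `|r' - r0| < d / 4 -> `|D r - D r'| <= C * `|r - r'|.
  move=> rd rd'; apply/ler_addgt0Pl => e e0.
  have e2 : 0 < e / 2 by rewrite divr_gt0.
  have rd1 : `|r - r0| < d by lra.
  have rd1' : `|r' - r0| < d by lra.
  near \oo => n.
  have n1 : `|D r - q r n| <= e / 2 by near: n; exact: Dn.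
  have n2 : `|D r' - q r' n| <= e / 2 by near: n; exact: Dn.
  have n3 : dy R n < d by near: n; exact: dy_small.
  have dn0 := dy_gt0 R n.
  have n4 : `|q r n - q r' n| <= C * `|r - r'|.
    have rr : `|r - r'| < d.
      have -> : r - r' = (r - r0) - (r' - r0) by ring.
      by rewrite (le_lt_trans (ler_normB _ _))//; lra.
    have := @HD r' (r - r') (dy R n) rd1' rr; rewrite (gtr0_norm dn0) => /(_ n3).
    rewrite (addrC r' (r - r')) subrK => H.
    by rewrite /q -mulrBr normrM normfV (gtr0_norm dn0) mulrC ler_pdivrMr// -mulrA.
  have -> : D r - D r' = (D r - q r n) - (D r' - q r' n) + (q r n - q r' n) by ring.
  rewrite (le_trans (ler_normD _ _))//.
  have := ler_normB (D r - q r n) (D r' - q r' n); lra.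
apply: (@LKS _ 0 h D); last by exists C, (d / 4); [rewrite divr_gt0|].
apply/nearR; exists (d / 8); first by rewrite divr_gt0.
move=> r rd; apply/is_deriveP => e e0.
exists (Num.min (d / 8) (e / (2 * C + 1))).
  by rewrite lt_min !divr_gt0// ltr_wpDl// mulr_ge0// ler0n.
move=> s s0; rewrite lt_min => /andP[sd se].
have {}se : 2 * (C * `|s|) <= e.
  move: se; rewrite ltr_pdivlMr ?ltr_wpDl ?mulr_ge0// => H.
  by have := normr_ge0 s; lra.
have Cs : 0 <= C * `|s| by rewrite mulr_ge0.
have [sp|sn|s00] := ltrgtP 0 s; last by rewrite -s00 eqxx in s0.
  have H rs ss := Dq r s rs sp ss.
  have -> : s^-1 * (h (r + s) - h r) - D r = s^-1 * (h (r + s) - h r - s * D r).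
    by field.
  have sd2 : s < d / 2 by move: sd; rewrite (gtr0_norm sp); lra.
  rewrite normrM normfV mulrC ler_pdivrMr ?normr_gt0// (le_trans (H _ _))//; first lra.
  have : C * `|s| * `|s| <= e * `|s| by rewrite ler_wpM2r//; lra.
  by rewrite -mulrA -expr2 (gtr0_norm sp).
(* [Dq] covers positive increments only. For s < 0 it is applied at x = r + s with increment -s, and
   D x is then compared with D r; hence the factor 2 in 2 C. *)
pose x := r + s; have xd : `|x - r0| < d / 4.
  have -> : x - r0 = (r - r0) + s by rewrite /x; ring.
  by rewrite (le_lt_trans (ler_normD _ _))//; lra.
have H1 := Dq x (- s); rewrite oppr_gt0 sn (_ : x + - s = r) in H1; last by rewrite /x; ring.
have H2 : `|h r - h x - - s * D x| <= C * `|s| ^+ 2.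
  rewrite (le_trans (H1 _ _ _))//; first lra.
    by rewrite -(ltr0_norm sn); lra.
  by rewrite (ltr0_norm sn).
have H3 := DLip x r xd; rewrite (_ : x - r = s) in H3; last by rewrite /x; ring.
have -> : s^-1 * (h (r + s) - h r) - D r =
   - s^-1 * (h r - h x - - s * D x) + (D x - D r) by rewrite -/x; field.
rewrite (le_trans (ler_normD _ _))//.
have H4 : `|- s^-1 * (h r - h x - - s * D x)| <= C * `|s|.
  rewrite normrM normrN normfV mulrC ler_pdivrMr ?normr_gt0// -mulrA -expr2.
  exact: H2.
have : `|D x - D r| <= C * `|s| by apply: H3; lra.
lra.
Unshelve. all: end_near. Qed.

Lemma LocM_LK k h r0 : LK k h r0 -> LocM k.+1 h r0 -> LK k.+1 h r0.
Proof.
elim: k h => [|k IH] h; first exact: LocM1_LK1.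
move=> hk HM; split; first by case: hk.
apply: IH; first by case: hk.
by apply: LocM_derive1 HM; exact: LK_le hk.
Qed.

End LipCriterion.

(** * Difference quotients of maps tested on smooth curves *)

Section Quotient.
Variables (R : realType) (X Y : lmodType R).
Variables (E : set (X -> R)) (F : set (Y -> R)).
Variables (f : pfun X Y) (g : pfun (X * X * R^o) Y).

(** Unlike [is_bgn_quot], this does not assume that g is Lip^0, which is to be proved; the values at
    t = 0 are therefore prescribed. *)
Definition quotient_spec : Prop :=
  [/\ forall x u t, pdom g (x, u, t) <-> pdom f (x + t *: u) /\ pdom f x,
      forall x u (t : R), pdom f (x + t *: u) -> pdom f x -> t != 0 ->
        fext g (x, u, t) = t^-1 *: (fext f (x + t *: u) - fext f x)
    & forall x u, pdom f x -> forall l, F l ->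
        l (fext g (x, u, 0)) = derive1 (fun s : R => l (fext f (x + s *: u))) 0].

Lemma DL_local (s : seq R) (h h' : R -> R) r :
  (forall q, `|q - r| <= norm_sum s -> h q = h' q) -> DL s h r = DL s h' r.
Proof.
elim: s r => [|a s IH] r H /=; first by apply: H; rewrite subrr normr0 norm_sum_ge0.
congr (_ - _); apply: IH => q qr; apply: H; rewrite norm_sum_cons.
  have -> : q - r = a + (q - (r + a)) by ring.
  by rewrite (le_trans (ler_normD _ _))// lerD2l.
by rewrite ler_wpDl.
Qed.

Lemma DL_freeze m (w1 w2 : R) (K : R -> R -> R -> R) r s y :
  DL (nseq m ((w1, 0, w2) : R^o * R^o * R^o)) (fun p => K p.1.1 p.1.2 p.2) (r, s, y) =
  DL (nseq m ((w1, w2) : R^o * R^o)) (fun p => K p.1 s p.2) (r, y).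
Proof.
elim: m r y => //= m IH r y; rewrite -!IH; congr (DL _ _ _ - _).
by congr pair => /=; congr pair => /=; rewrite addr0.
Qed.

Section Directional.
Variables (k : nat) (x u : R -> X) (t : R -> R) (r0 : R) (l : Y -> R).
Hypotheses (ft : smooth_tested E F f k.+1) (gs : quotient_spec) (Fl : F l).
Hypotheses (sx : smooth_curve E x) (su : smooth_curve E u) (st : smooth t).
Hypotheses (t0 : t r0 = 0) (fx0 : pdom f (x r0)).

(** For y = 0 and s from 0 to 1 this runs through the segment from x r to x r + t r u r. The
    variable y probes the direction u r even where t r = 0, and [hh] is the derivative in this
    direction. *)
Let sig (r s y : R) : X := x r + (s * t r + y) *: u r.
Let K (r s y : R) : R := l (fext f (sig r s y)).
Let hh (r s : R) : R := derive1 (K r s) 0.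
Let A (r : R) : R := l (fext g (x r, u r, t r)).

Let EV : DVS E. Proof. by have [[]] := ft. Qed.

Lemma sig_curve (c1 c2 c3 : R -> R) : smooth c1 -> smooth c2 -> smooth c3 ->
  smooth_curve E (fun q => sig (c1 q) (c2 q) (c3 q)).
Proof.
move=> s1 s2 s3; apply: (smooth_curveDZ EV (smooth_curve_comp sx s1)
  (smooth_curve_comp su s1)).
exact: (smoothD (smoothM s2 (smooth_comp st s1)) s3).
Qed.

(** The curve lemma is applied in R^3 to the variables (r, s, y), with directions whose s-component
    is 0. Letting the base point vary in s as well makes the bound uniform for s near [s0]. *)
Lemma line_bound (s0 : R) : exists2 d : R, 0 < d & forall r s y w1 w2,
  `|r - r0| < d -> `|s - s0| < d -> `|y| < d -> `|w1| < d -> `|w2| < d ->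
  pdom f (sig r s y) /\
  `|DL (nseq k.+2 ((w1, w2) : R^o * R^o)) (fun p => K p.1 s p.2) (r, y)| <=
    d^-1 * Num.max `|w1| `|w2| ^+ k.+2.
Proof.
pose Rd3 := prodd (prodd (@Rd R) (@Rd R)) (@Rd R).
have RV := DVS_Rd R; have RRV := DVS_prodd RV RV; have R3V := DVS_prodd RRV RV.
have Rlin m : Rd3 m -> scalar m by exact: DVS_scalar.
apply: contrapT => nex.
have /choice[q Hq] n : exists q : (R^o * R^o * R^o) * (R^o * R^o * R^o) * R,
  [/\ [/\ `|q.1.1.1.1 - r0| <= fast R n, `|q.1.1.1.2 - s0| <= fast R n & `|q.1.1.2| <= fast R n],
      [/\ `|q.1.2.1.1| <= 1, `|q.1.2.1.2| <= 1 & `|q.1.2.2| <= 1],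
      0 < q.2 <= fast R n ^+ 2
    & ~ (pdom f (sig q.1.1.1.1 q.1.1.1.2 q.1.1.2) /\
      `|DL (nseq k.+2 (q.2 *: q.1.2)) (fun p : R^o * R^o * R^o => K p.1.1 p.1.2 p.2) q.1.1| <=
        (fast R n)^-1 ^+ k.+3 * q.2 ^+ k.+2)].
  have fn0 := fast_gt0 R n; have fn1 : fast R n <= 1 by exact: dy_le1.
  (* As a radius this lies below [fast n] and its square, and its inverse is exactly the constant in
     [fast_difference_contra] for differences of order k+2. *)
  pose d := fast R n ^+ k.+3.
  have d0 : 0 < d by rewrite exprn_gt0.
  have dfn : d <= fast R n by rewrite -[leRHS]expr1 ler_wiXn2l// ltW.
  have dfn2 : d <= fast R n ^+ 2 by rewrite ler_wiXn2l// ltW.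
  apply: contrapT => nex'; apply: nex; exists d => // r s y w1 w2 rd sd yd wd1 wd2.
  apply: contrapT => bad; apply: nex'.
  pose m := Num.max `|w1| `|w2|.
  have m0 : 0 <= m by rewrite le_max normr_ge0.
  have [mz|mz] := eqVneq m 0.
    exists ((r, s, y), (0, 0, 0), fast R n ^+ 2); split=> /=.
    - by rewrite !ltW// (lt_le_trans _ dfn).
    - by rewrite normr0 ler01.
    - by rewrite exprn_gt0/=.
    move=> [dom _]; apply: bad; split=> //.
    have /andP[] : (`|w1| <= 0) && (`|w2| <= 0) by rewrite -ge_max -mz.
    rewrite !normr_le0 => /eqP -> /eqP ->.
    rewrite DL0 ?mem_head// normr0; apply: mulr_ge0.
      by rewrite invr_ge0; exact: ltW d0.
    by apply: exprn_ge0; rewrite le_max lexx.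
  have mp : 0 < m by rewrite lt_neqAle eq_sym mz.
  have ww : m *: ((m^-1 * w1, 0, m^-1 * w2) : R^o * R^o * R^o) = (w1, 0, w2).
    by congr pair => /=; [congr pair => /=|]; rewrite ?scaler0// -[_ *: _]/(_ * _) mulVKf.
  have DE := DL_freeze k.+2 w1 w2 K r s y; rewrite -ww in DE.
  exists ((r, s, y), (m^-1 * w1, 0, m^-1 * w2), m); split.
  - by rewrite /= !ltW// (lt_le_trans _ dfn).
  - rewrite /= !normrM normfV (ger0_norm m0) normr0 ler01 !(mulrC m^-1) !ler_pdivrMr// mul1r.
    by rewrite !le_max !lexx orbT.
  - by rewrite /= mp (le_trans _ dfn2)// ltW// gt_max wd1.
  move=> [dom H]; apply: bad; split=> //; rewrite -DE.
  by apply: (le_trans H); rewrite /d exprVn.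
apply: (@fast_difference_contra R _ Rd3 Rlin k.+1 (fun p => pdom f (sig p.1.1 p.1.2 p.2))
   (fun p => K p.1.1 p.1.2 p.2) _ (r0, s0, 0)
   (fun n => (q n).1.1) (fun n => (q n).1.2) (fun n => (q n).2)).
- move=> c /(smooth_curve_prodd _ RRV RV)[/(smooth_curve_prodd _ RV RV)[]].
  move=> /smooth_curve_Rd c1 /smooth_curve_Rd c2 /smooth_curve_Rd c3 dom.
  exact: (tested_curve ft Fl (sig_curve c1 c2 c3) dom).
- by rewrite /sig /= t0 mulr0 addr0 scale0r addr0.
- move=> _ [_ [_ [[_ [_ [[a ->] [b ->] ->]]] [c ->] ->]]] /=.
  exists (`|a| + `|b| + `|c|); near=> n; have [[q1 q2 q3] _ _ _] := Hq n.
  rewrite (le_trans (ler_normD _ _))// mulrDl lerD//.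
    by rewrite (le_trans (ler_normD _ _))// mulrDl !normrM lerD// ler_wpM2l.
  by rewrite subr0 normrM ler_wpM2l.
- move=> _ [_ [_ [[_ [_ [[a ->] [b ->] ->]]] [c ->] ->]]] /=.
  exists (`|a| + `|b| + `|c|); near=> n; have [_ [q1 q2 q3] _ _] := Hq n.
  rewrite (le_trans (ler_normD _ _))// lerD//.
    by rewrite (le_trans (ler_normD _ _))// !normrM lerD// ler_piMr.
  by rewrite normrM ler_piMr.
- by move=> n; have [] := Hq n.
- by move=> n; have [] := Hq n.
Unshelve. all: end_near. Qed.

Lemma is_derive_K r s : pdom f (sig r s 0) -> is_derive (0 : R) 1 (K r s) (hh r s).
Proof.
move=> dom; rewrite /hh derive1E; apply: derivableP.
have [_] := tested_curve ft Fl (sig_curve (smooth_cst r) (smooth_cst s) smooth_id) dom.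
exact: LK_derivable.
Qed.

Lemma hh_bound : exists2 d : R, 0 < d & forall s, 0 <= s <= 1 ->
  forall r, `|r - r0| < d -> pdom f (sig r s 0) /\
   forall a, size a = k.+1 -> (forall b, b \in a -> `|b| < d) ->
     `|DL a (fun r => hh r s) r| <= d^-1 * \prod_(b <- a) `|b|.
Proof.
have [Kc HKc] := mixed_bound R k.
apply: (@segment_uniform R (fun s d => forall r, `|r - r0| < d -> pdom f (sig r s 0) /\
   forall a, size a = k.+1 -> (forall b, b \in a -> `|b| < d) ->
     `|DL a (fun r => hh r s) r| <= d^-1 * \prod_(b <- a) `|b|)).
  move=> s d d' d'0 d'd H r rd; have [H1 H2] := H r (lt_le_trans rd d'd); split=> // a sa ad.
  rewrite (le_trans (H2 a sa _))//; first by move=> b ba; rewrite (lt_le_trans (ad b ba)).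
  rewrite ler_wpM2r ?prodr_ge0// lef_pV2 ?posrE// (lt_le_trans d'0)//.
move=> s0 _; have [d d0 Hd] := line_bound s0.
have di0 : 0 <= d^-1 by rewrite invr_ge0 ltW.
(* The second term makes the constant at most e^-1, so that one number is both radius and inverse
   constant, the monotone form wanted by [segment_uniform]. *)
pose e := Num.min (d / (2 * k.+2)%:R) (`|Kc * d^-1| + 1)^-1.
have e0 : 0 < e by rewrite lt_min divr_gt0//= invr_gt0 ltr_wpDl.
have ed : e <= d / (2 * k.+2)%:R by rewrite ge_min lexx.
have ed' : e <= d by rewrite (le_trans ed)// ler_pdivrMr// ler_peMr ?(ltW d0)// ler1n.
exists e => // s se r re.
have sd : `|s - s0| < d by rewrite (lt_le_trans se).
have zd : `|0 : R| < d by rewrite normr0.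
split; first by have [] := Hd r s 0 0 0 (lt_le_trans re ed') sd zd zd zd.
move=> a sa ad; have := HKc (fun r y => K r s y) (fun r => hh r s) r0 d d^-1 di0 d0 _ _ a r sa.
move=> H; rewrite (le_trans (H _ _ _ _))//.
- move=> [b1 b2] [w1 w2] /= h1 h2; rewrite prod_normE/= gt_max => /andP[h3 h4].
  by have [] := Hd b1 s b2 w1 w2 h1 sd h2 h3 h4.
- by move=> q qd; apply: is_derive_K; have [] := Hd q s 0 0 0 qd sd zd zd zd.
- by move=> b /ad be; exact: lt_le_trans be ed.
- exact: lt_le_trans re ed.
rewrite ler_wpM2r ?prodr_ge0// (le_trans (ler_norm _))//.
rewrite (@le_trans _ _ (`|Kc * d^-1| + 1)) ?lerDl// -[leLHS]invrK.
by rewrite lef_pV2 ?posrE ?invr_gt0 ?ltr_wpDl// ge_min lexx orbT.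
Qed.

(* [Yf r s] is [s * g (x r, u r, s * t r)], an antiderivative of [hh r] in s that
   vanishes at 0; it replaces an integral over [0, 1]. *)
Let Yf (r s : R) : R :=
  if t r == 0 then s * A r else (t r)^-1 * (K r s 0 - K r 0 0).

Lemma is_derive_Y r s : pdom f (sig r s 0) -> is_derive s 1 (Yf r) (hh r s).
Proof.
move=> dom; have dK := is_derive_K dom.
rewrite /Yf; case: eqP => [tr|/eqP tr].
  have -> : hh r s = A r.
    rewrite /hh /A tr; have [_ _ ->//] := gs.
      congr (derive1 _ 0); apply/funext => y.
      by rewrite /K /sig tr mulr0 add0r.
    by move: dom; rewrite /sig tr mulr0 addr0 scale0r addr0.
  have := is_derive_affine 0 (A r) s; congr is_derive.
  by apply/funext => z; rewrite add0r mulrC.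
have aff : is_derive s 1 (fun z => (z - s) * t r) (t r).
  have := is_derive_affine (- s * t r) (t r) s; congr is_derive.
  by apply/funext => z; ring.
have dK' : is_derive ((s - s) * t r) 1 (K r s) (hh r s) by rewrite subrr mul0r.
have dc := @is_derive1_comp _ (K r s) (fun z => (z - s) * t r) s _ _ dK' aff.
have E1 : K r s \o (fun z => (z - s) * t r) = fun z => K r z 0.
  by apply/funext => z /=; rewrite /K /sig; congr (l (fext f (_ + _ *: _))); ring.
rewrite E1 in dc.
have := is_deriveZ (t r)^-1 (is_deriveB dc (is_derive_cst (K r 0 0) s 1)).
rewrite subr0 -[_ *: (_ * _)]/(_ * (_ * _)) (_ : (t r)^-1 * (hh r s * t r) = hh r s)//.
by field.
Qed.

Lemma quotient_LocM : LocM k A r0.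
Proof.
have [d d0 Hd] := hh_bound.
exists d^-1, (d / k.+2%:R); first by rewrite divr_gt0.
move=> a r sa ad rd.
have de : d = d / k.+2%:R + k.+1%:R * (d / k.+2%:R).
  by rewrite -[X in _ = X + _]mul1r -mulrDl nat1r mulrC divfK ?pnatr_eq0.
have dd : d / k.+2%:R <= d by rewrite ler_pdivrMr// ler_peMr ?(ltW d0)// ler1n.
have ns : norm_sum a <= k.+1%:R * (d / k.+2%:R).
  by rewrite -[X in X%:R * _]sa; apply: norm_sum_le => b /ad/ltW.
have near q : `|q - r| <= norm_sum a -> `|q - r0| < d.
  move=> qr; have -> : q - r0 = (r - r0) + (q - r) by ring.
  by rewrite (le_lt_trans (ler_normD _ _))// de ltr_leD// (le_trans qr).
have I1 : 0 <= (1 : R) <= 1 by rewrite ler01 lexx.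
have I0 : 0 <= (0 : R) <= 1 by rewrite ler01 lexx.
have -> : DL a A r = DL a (fun q => Yf q 1 - Yf q 0) r.
  apply: DL_local => q /near qd.
  have [d1 _] := Hd 1 I1 q qd; have [d00 _] := Hd 0 I0 q qd.
  rewrite /sig mul1r addr0 in d1; rewrite /sig mul0r addr0 scale0r addr0 in d00.
  rewrite /Yf; case: eqP => [tq|/eqP tq]; first by rewrite mul1r mul0r subr0.
  rewrite subrr mulr0 subr0 /A; have [_ gq _] := gs.
  have ll : scalar l by apply: DVS_scalar Fl; have [_ []] := ft.
  rewrite gq// (scalar_fZ ll) (scalar_fB ll) /K /sig mul1r addr0 mul0r addr0.
  by rewrite scale0r addr0.
rewrite DL_sub.
have der (s : R) : 0 <= s <= 1 -> is_derive s 1 (fun z => DL a (fun q => Yf q z) r)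
    (DL a (fun q => hh q s) r).
  move=> sI; apply: DL_param_derive => q /near qd.
  by apply: is_derive_Y; have [] := Hd s sI q qd.
(* The mean value theorem in s is applied to the whole difference in r, so that one c serves all the
   points of this difference. *)
have [c cI ->] : exists2 c, c \in `[0 : R, 1] &
    DL a (fun q => Yf q 1) r - DL a (fun q => Yf q 0) r = DL a (fun q => hh q c) r * (1 - 0).
  apply: (@MVT_segment _ (fun z => DL a (fun q => Yf q z) r)
    (fun s => DL a (fun q => hh q s) r)) => //.
    by move=> z /subset_itv_oo_cc; rewrite in_itv/=; exact: der.
  by apply: derivable_within_continuous => z; rewrite in_itv/= => /der[].
rewrite in_itv/= in cI; rewrite subr0 mulr1.
have [_ H] := Hd c cI r (lt_le_trans rd dd); apply: H => // b /ad bd.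
exact: lt_le_trans bd dd.
Qed.

End Directional.

Lemma quotient_LK_neq0 k (x u : R -> X) (t : R -> R) (r0 : R) (l : Y -> R) :
  smooth_tested E F f k.+1 -> quotient_spec -> F l ->
  smooth_curve E x -> smooth_curve E u -> smooth t -> t r0 != 0 ->
  pdom f (x r0) -> pdom f (x r0 + t r0 *: u r0) ->
  LK k (fun r => l (fext g (x r, u r, t r))) r0.
Proof.
move=> ft [_ gq _] Fl sx su st t0 fx fxu.
have EV : DVS E by have [[]] := ft.
have ll : scalar l by apply: DVS_scalar Fl; have [_ []] := ft.
have [n1 /LK_pred L1] := tested_curve ft Fl sx fx.
have [n2 /LK_pred L2] := tested_curve ft Fl (smooth_curveDZ EV sx su st) fxu.
have Lt : LK k t r0 by exact: (smoothP t).1.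
have nt : \forall r \near r0, t r != 0.
  have tc : {for r0, continuous t} := LK_continuous Lt.
  exact: (cvgr_neq0 _ tc t0).
apply: LK_near (LK_mul (LK_inv t0 Lt) (LK_sub L2 L1)).
near=> r; rewrite gq.
- by rewrite (scalar_fZ ll) (scalar_fB ll).
- by near: r.
- by near: r.
- by near: r.
Unshelve. all: end_near. Qed.

Lemma quotient_LipkE k (c : R -> X * X * R^o) :
  smooth_tested E F f k.+1 -> quotient_spec -> smooth_curve (bgn_dual E) c ->
  (forall l r0, F l -> smooth_curve E (fun r => (c r).1.1) ->
    smooth_curve E (fun r => (c r).1.2) -> smooth (fun r => (c r).2 : R) ->
    (c r0).2 = 0 -> pdom f (c r0).1.1 ->
    LK k (fun r => l (fext g ((c r).1.1, (c r).1.2, (c r).2))) r0) ->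
  LipkE (Some k) F (pcomp g (pfun_of c)).
Proof.
move=> ft gs sc H0; have [[EV _ _] FC _] := ft; have [gd _ _] := gs.
have F0 : F !=set0 by case: FC => -[].
have /(smooth_curve_prodd _ (DVS_prodd EV EV) (DVS_Rd R))[] := sc.
move=> /(smooth_curve_prodd _ EV EV)[/= sx su] /smooth_curve_Rd st.
have cE r : c r = ((c r).1.1, (c r).1.2, (c r).2) by case: (c r) => [[]].
have domE r : pdom (pcomp g (pfun_of c)) r <->
    pdom f ((c r).1.1 + (c r).2 *: (c r).1.2) /\ pdom f (c r).1.1.
  by rewrite -gd -cE.
apply/(LipkE_LK _ _ F0); split.
  apply/open_near => r /domE[d1 d2].
  have n1 := tau_near (tested_tau ft) (smooth_curveDZ EV sx su st) d1.
  have n2 := tau_near (tested_tau ft) sx d2.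
  by apply: filterS2 n1 n2 => q q1 q2; apply/domE.
move=> l Fl r0 /domE[d1 d2].
suff : LK k (fun r => l (fext g ((c r).1.1, (c r).1.2, (c r).2))) r0.
  by apply: LK_near; near=> r; rewrite -cE.
have [t0|t0] := eqVneq (c r0).2 0; first exact: H0.
exact: (quotient_LK_neq0 ft gs Fl sx su st t0 d2 d1).
Unshelve. all: end_near. Qed.

(** The induction hypothesis, for the same f and g, gives the order k regularity that [LocM_LK]
    raises by one. For k = 0 the difference bound is itself the Lipschitz estimate. *)
Lemma quotient_tested k : smooth_tested E F f k.+1 -> quotient_spec ->
  smooth_tested (bgn_dual E) F g k.
Proof.
elim: k => [|k IH] ft gs; (split; first by apply: ConFKd_bgn; case: ft).
- by case: ft.
- move=> c sc; apply: (quotient_LipkE ft gs sc) => l r0 Fl sx su st t0 fx.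
  exact/LocM0_LK/(quotient_LocM ft gs Fl sx su st t0 fx).
- by case: ft.
move=> c sc; have gt := IH (tested_le (leqnSn _) ft) gs.
apply: (quotient_LipkE ft gs sc) => l r0 Fl sx su st t0 fx.
apply: LocM_LK; last exact: (quotient_LocM ft gs Fl sx su st t0 fx).
have dom : pdom g (c r0).
  have [gd _ _] := gs; case: (c r0) t0 fx => [[x1 u1] t1] /= -> fx.
  by apply/gd; rewrite scale0r addr0.
have [_] := tested_curve gt Fl sc dom; apply: LK_near; near=> r.
by case: (c r) => [[]].
Unshelve. all: end_near. Qed.

End Quotient.

(** * From Lip^k to the Bertram-Glöckner-Neeb classes, and the equality *)

Section Main.
Variable R : realType.

Lemma tested_DBGN n (Y : lmodType R) (F : set (Y -> R)) :
  forall (X : lmodType R) (E : set (X -> R)) (f : pfun X Y),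
  smooth_tested E F f n -> DBGN_fin n (tau E) (tau F) f.
Proof.
elim: n => [|n IH] X E f ft.
  by have [EC FC _] := ft; apply/LipFKa_tau => //; exact: tested0_LipFKd.
have [EC FC _] := ft; have EV : DVS E by case: EC.
have f0 := tested_le (leq0n _) ft.
split; first by apply/LipFKa_tau => //; exact: tested0_LipFKd.
have /choice[df Hdf] (p : X * X) : exists y, pdom f p.1 -> forall l, F l ->
    l y = derive1 (fun s : R => l (fext f (p.1 + s *: p.2))) 0.
  have [fp|nfp] := EM (pdom f p.1); last by exists 0.
  have [|y Hy] := @weak_derivative _ _ F (fun s => fext f (p.1 + s *: p.2)) 0 FC.
    move=> l Fl.
    have sl := smooth_curveDZ EV (smooth_curve_cst E p.1) (smooth_curve_cst E p.2) smooth_id.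
    have [|_] := @tested_curve _ _ _ E F f n.+1 l _ 0 ft Fl sl.
      by rewrite scale0r addr0.
    exact: LK_le.
  by exists y.
(* At t = 0 the value is the weak directional derivative [df], which lies in Y by convenience of
   [F]. *)
pose g : pfun (X * X * R^o) Y := fun p =>
  if (f p.1.1, f (p.1.1 + (p.2 : R) *: p.1.2)) is (Some a, Some b)
  then Some (if p.2 == 0 then df p.1 else (p.2 : R)^-1 *: (b - a)) else None.
have gdom x u t : pdom g (x, u, t) <-> pdom f (x + t *: u) /\ pdom f x.
  rewrite /pdom /g /=; case: (f x) => [a|]; last by split=> // -[].
  by case: (f _) => [b|]; split=> // -[].
have gs : quotient_spec F f g.
  split=> // [x u t|x u fx l Fl].
    move=> /some_fext fxu /some_fext fx t0.
    by rewrite {1}/fext /g /= fx fxu /= (negPf t0).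
  rewrite {1}/fext /g /= scale0r addr0 (some_fext fx) /= eqxx.
  exact: (Hdf (x, u)).
have gt := quotient_tested ft gs.
rewrite (bgn_top_tau EC); exists g; last exact: IH.
split.
- by apply/seteqP; split=> -[[x u] t]; move=> /gdom.
- move=> x u t a b d + fx fxu t0; rewrite /g /= fx fxu (negPf t0).
  by case.
rewrite (bgn_top_tau EC); apply/LipFKa_tau => //; first exact: ConFKd_bgn.
exact: tested0_LipFKd (tested_le (leq0n _) gt).
Qed.

End Main.

Theorem theorem12 (R : realType) (k : lip_order) (X Y : lmodType R)
    (E : set (set X)) (F : set (set Y)) (f : pfun X Y) :
  LipFKa k E F f <-> DBGN k E F f.
Proof.
split.
  move=> [E0 [F0 [H -> ->]]]; case: k H => [n|] H /=.
    exact: tested_DBGN (LipFKd_tested H).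
  by move=> n; exact: tested_DBGN (LipFKdN_tested n H).
(* Membership at order 0 supplies convenient dualized spaces inducing the topologies [E] and [F],
   which [DBGN_LipFKd] needs. *)
have base n : DBGN_fin n E F f -> LipFKa (Some 0%N) E F f by case: n => [|n] // [].
case: k => [n|] /= H.
  have [E0 [F0 [[EC FC _] EE FF]]] := base _ H; exists E0, F0; split=> //.
  by apply: DBGN_LipFKd => //; rewrite -EE -FF.
have [E0 [F0 [[EC FC _] EE FF]]] := base _ (H 0%N); exists E0, F0; split=> //.
split=> // c Ec l Fl; apply/LipkN => n.
have [_ _ Hn] : LipFKd (Some n) E0 F0 f by apply: DBGN_LipFKd => //; rewrite -EE -FF.
by apply: Hn Fl => m Em; exact: (LipkN _).1 (Ec m Em) n.
Qed.
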